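(* Let $X$ be a germ of real-analytic submanifold at the origin in $\mathbb{R}^n$. Then, for any strongly regular sequence $M$ and any closed ideal $\mathcal{I}_M$ of $\mathcal{C}_M(\mathbb{R}^n,0)$, one has $$\mathcal{I}_M\cap\underline{m}^\infty_{X,M}=\underline{m}^\infty_{X,M}\,\mathcal{I}_M.$$ In particular, $\underline{m}^\infty_{X,M}=\underline{m}^\infty_{X,M}\,\underline{m}^\infty_{X,M}$.
   Context: A sequence $M=(M_j)_{j\geq 0}$ of real numbers is \emph{strongly regular} if, for some constant $A>0$: (1) $M_0=1$ and $M$ is non-decreasing; (2) $M$ is logarithmically convex, i.e. the quotients $M_{j+1}/M_j$ form a non-decreasing sequence; (3) $M_{j+k}\leq A^{j+k}M_jM_k$ for all $j,k\in\mathbb{N}$; (4) $\sum_{j\geq \ell}\frac{M_j}{(j+1)M_{j+1}}\leq A\frac{M_\ell}{M_{\ell+1}}$ for all $\ell\in\mathbb{N}$. Here $\mathbb{N}=\{0,1,2,\dots\}$. For a multi-index $J=(j_1,\dots,j_n)\in\mathbb{N}^n$, $j=j_1+\cdots+j_n$ denotes its length and $D^J=\partial^j/\partial x_1^{j_1}\cdots\partial x_n^{j_n}$. For $\Omega\subset\mathbb{R}^n$ open and $\sigma>0$, $\mathcal{C}_{M,\sigma}(\Omega)$ is the Banach space of complex-valued $C^\infty$ functions $f$ on $\Omega$ for which there is a constant $C$ with $|D^Jf(x)|\leq C\sigma^jj!M_j$ for all $J\in\mathbb{N}^n$, $x\in\Omega$, normed by the smallest such $C$. $\mathcal{C}_M(\Omega)=\bigcup_{\sigma>0}\mathcal{C}_{M,\sigma}(\Omega)$,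 with its natural (LB)-space (inductive limit) topology. $\mathcal{C}^\infty(\mathbb{R}^n,0)$ is the ring of germs at $0$ of $C^\infty$ functions, and $\mathcal{C}_M(\mathbb{R}^n,0)$ is the ring of those germs $f$ having a representative in $\mathcal{C}_M(\Omega_f)$ for some open neighborhood $\Omega_f$ of $0$. For an open neighborhood $\Omega$ of $0$, $\pi_\Omega$ maps a function on $\Omega$ to its germ at $0$. An ideal $\mathcal{I}_{M,\Omega}$ of $\mathcal{C}_M(\Omega)$ is a representative of an ideal $\mathcal{I}_M$ of $\mathcal{C}_M(\mathbb{R}^n,0)$ if $\pi_\Omega(\mathcal{I}_{M,\Omega})=\mathcal{I}_M$. The ideal $\mathcal{I}_M$ is \emph{closed} if, for any sufficiently small $\Omega$, it has a representative which is closed in the (LB)-space $\mathcal{C}_M(\Omega)$. A germ is flat on the germ of closed set $X$ if it vanishes together with all its derivatives on $X$; $\underline{m}^\infty_{X,M}$ is the ideal of germs in $\mathcal{C}_M(\mathbb{R}^n,0)$ which are flat on $X$. Products of ideals are the usual ones (finite sums of products). *)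

(* Defs.v *)
From HB Require Import structures.
From mathcomp Require Import all_boot all_order all_algebra.
From mathcomp Require Import generic_quotient ring_quotient.
From mathcomp Require Import complex.
From mathcomp Require Import all_classical all_reals all_analysis.

Set Implicit Arguments.
Unset Strict Implicit.
Unset Printing Implicit Defensive.

Import Order.TTheory GRing.Theory Num.Theory.
Import numFieldNormedType.Exports.

Local Open Scope classical_set_scope.
Local Open Scope ring_scope.

Section StronglyRegular.
Variable R : realType.

Definition strongly_regular (M : nat -> R) : Prop :=
  exists A : R, 0 < A /\
  [/\ M 0%N = 1 /\ (forall j, M j <= M j.+1),
      forall j, M j.+1 / M j <= M j.+2 / M j.+1,
      forall j k, M (j + k)%N <= A ^+ (j + k) * M j * M k &
      forall l, (\sum_(l <= j <oo) (M j / (j.+1%:R * M j.+1))%:E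
                   <= (A * (M l / M l.+1))%:E)%E].

End StronglyRegular.

Section Ideals.
Variable A : comNzRingType.

(* [S] is a subset of [A] closed under the ring operations, whose unit may
   differ from that of [A]: for functions on Omega extended by zero the unit
   is the indicator function of Omega. *)
Definition is_ideal_of (S I : set A) : Prop :=
  [/\ I `<=` S, I 0,
      forall f g, I f -> I g -> I (f - g) &
      forall a f, S a -> I f -> I (a * f)].

Definition ideal_mul (I J : set A) : set A :=
  [set h | exists s : seq (A * A),
     (forall p, p \in s -> I p.1 /\ J p.2) /\ h = \sum_(p <- s) p.1 * p.2].

End Ideals.

(* Derivatives of complex-valued functions are taken componentwise on real and
   imaginary parts, since [R[i]] is not a normed module over [R]. *)
Section Derivatives.
Variables (R : realType) (n : nat).
Implicit Types (Omega : set 'rV[R]_n).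

Definition mindex := {ffun 'I_n -> nat}.

Definition mlength (J : mindex) : nat := (\sum_i J i)%N.

Definition pderiv (i : 'I_n) (g : 'rV[R]_n -> R) : 'rV[R]_n -> R :=
  fun x => 'D_(delta_mx 0 i) g x.

Definition pderivs (s : seq 'I_n) (g : 'rV[R]_n -> R) : 'rV[R]_n -> R :=
  foldr pderiv g s.

Definition smooth_on Omega (g : 'rV[R]_n -> R) : Prop :=
  forall (s : seq 'I_n) (x : 'rV[R]_n), Omega x ->
    {for x, continuous (pderivs s g)} /\
    forall i : 'I_n, derivable (pderivs s g) x (delta_mx 0 i).

Definition mderivR (J : mindex) (g : 'rV[R]_n -> R) : 'rV[R]_n -> R :=
  foldr (fun i h => iter (J i) (pderiv i) h) g (enum 'I_n).

Definition csmooth_on Omega (f : 'rV[R]_n -> R[i]) : Prop :=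
  smooth_on Omega (fun x => complex.Re (f x)) /\
  smooth_on Omega (fun x => complex.Im (f x)).

Definition mderiv (J : mindex) (f : 'rV[R]_n -> R[i]) : 'rV[R]_n -> R[i] :=
  fun x => Complex (mderivR J (fun y => complex.Re (f y)) x)
                   (mderivR J (fun y => complex.Im (f y)) x).

End Derivatives.

Section CarlemanClasses.
Variables (R : realType) (n : nat).
Variable M : nat -> R.
Implicit Types (Omega : set 'rV[R]_n) (f g : 'rV[R]_n -> R[i]).

(* A function on the open set [Omega] is represented by its extension by zero
   to the whole space; all conditions are only tested at points of [Omega],
   where the derivatives do not depend on the extension. *)
Definition supported_in Omega f : Prop := forall x, ~ Omega x -> f x = 0.

Definition CM_bound (sigma : R) Omega (C : R) f : Prop :=
  forall (J : mindex n) (x : 'rV[R]_n), Omega x ->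
    Normc.normc (mderiv J f x)
      <= C * sigma ^+ mlength J * (mlength J)`!%:R * M (mlength J).

Definition CMs (sigma : R) Omega : set ('rV[R]_n -> R[i]) :=
  [set f | [/\ supported_in Omega f, csmooth_on Omega f &
               exists C : R, CM_bound sigma Omega C f]].

Definition CMs_norm (sigma : R) Omega f : R :=
  inf [set C : R | 0 <= C /\ CM_bound sigma Omega C f].

Definition CM Omega : set ('rV[R]_n -> R[i]) :=
  [set f | exists sigma : R, 0 < sigma /\ CMs sigma Omega f].

Definition absolutely_convex (U : set ('rV[R]_n -> R[i])) : Prop :=
  forall f g (a b : R[i]), U f -> U g -> Normc.normc a + Normc.normc b <= 1 ->
    U (fun x => a * f x + b * g x).

(* The (LB) topology is the finest locally convex topology on [CM Omega] for
   which all the inclusions of the Banach spaces [CMs sigma Omega] are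
   continuous: a base of neighbourhoods of 0 is given by the absolutely convex
   sets whose trace on each [CMs sigma Omega] is a neighbourhood of 0. *)
Definition LB_basic_nbhs0 Omega (U : set ('rV[R]_n -> R[i])) : Prop :=
  [/\ U `<=` CM Omega, absolutely_convex U &
      forall sigma : R, 0 < sigma -> exists eps : R, 0 < eps /\
        forall f, CMs sigma Omega f -> CMs_norm sigma Omega f < eps -> U f].

Definition LB_open Omega (V : set ('rV[R]_n -> R[i])) : Prop :=
  V `<=` CM Omega /\
  forall f, V f -> exists U, LB_basic_nbhs0 Omega U /\
    forall u, U u -> V (f + u).

Definition LB_closed Omega (F : set ('rV[R]_n -> R[i])) : Prop :=
  F `<=` CM Omega /\ LB_open Omega (CM Omega `\` F).

End CarlemanClasses.

(* Germs at 0 of arbitrary complex-valued functions form the quotient of the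
   ring of all functions on R^n by the ideal of functions vanishing near 0. *)
Section Germs.
Variables (R : realType) (n : nat).

Definition null_germ : {pred ('rV[R]_n -> R[i])} :=
  fun f => `[< \forall x \near (0 : 'rV[R]_n), f x = 0 >].

Lemma null_germ_idealr : idealr_closed null_germ.
Proof.
split.
- by apply/asboolP; near=> x.
- apply/negP => /asboolP h1; have /= := nbhs_singleton h1.
  by apply/eqP; exact: oner_neq0.
- move=> a f g /asboolP hf /asboolP hg; apply/asboolP.
  near=> x; have fx : f x = 0 by near: x.
  have gx : g x = 0 by near: x.
  by rewrite -[LHS]/(a x * f x + g x) fx gx mulr0 addr0.
Unshelve. all: by end_near. Qed.

HB.instance Definition _ :=
  @isIdealr.Build ('rV[R]_n -> R[i]) null_germ null_germ_idealr.

Definition germ : comNzRingType := {ideal_quot null_germ}.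

Definition to_germ (f : 'rV[R]_n -> R[i]) : germ :=
  (\pi_({ideal_quot null_germ}) f)%qT.

Lemma to_germP (f g : 'rV[R]_n -> R[i]) :
  to_germ f = to_germ g <-> \forall x \near (0 : 'rV[R]_n), f x = g x.
Proof.
have E : (to_germ f == to_germ g) = (f - g \in null_germ).
  by rewrite /to_germ Quotient.idealrBE.
split=> [/eqP|h].
- rewrite E => /asboolP h; near=> x.
  by apply/eqP; rewrite -subr_eq0; apply/eqP; near: x.
- apply/eqP; rewrite E; apply/asboolP; near=> x.
  by rewrite -[LHS]/(f x - g x); apply/eqP; rewrite subr_eq0; apply/eqP; near: x.
Unshelve. all: by end_near. Qed.

Variable M : nat -> R.

Definition CM_germ : set germ :=
  [set gam : germ | exists (Omega : set 'rV[R]_n) (f : 'rV[R]_n -> R[i]),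
     [/\ open_nbhs (0 : 'rV[R]_n) Omega, CM M Omega f & gam = to_germ f]].

Definition closed_ideal (I : set germ) : Prop :=
  is_ideal_of CM_germ I /\
  exists Omega0 : set 'rV[R]_n, open_nbhs (0 : 'rV[R]_n) Omega0 /\
    forall Omega : set 'rV[R]_n, open_nbhs (0 : 'rV[R]_n) Omega -> Omega `<=` Omega0 ->
    exists IOmega : set ('rV[R]_n -> R[i]),
      [/\ is_ideal_of (CM M Omega) IOmega, to_germ @` IOmega = I &
          LB_closed M Omega IOmega].

(* [X] is any representative of a germ of set at 0. *)
Definition flat_on (X : set 'rV[R]_n) (gam : germ) : Prop :=
  exists f : 'rV[R]_n -> R[i], gam = to_germ f /\
    \forall x \near (0 : 'rV[R]_n),
      X x -> forall J : mindex n, mderiv J f x = 0.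

Definition flat_ideal (X : set 'rV[R]_n) : set germ :=
  [set gam | CM_germ gam /\ flat_on X gam].

End Germs.

Section AnalyticSubmanifold.
Variables (R : realType) (n : nat).

Definition monomial (h : 'rV[R]_n) (J : mindex n) : R :=
  \prod_(i < n) h 0 i ^+ J i.

(* Near every point, [g] is the sum of an absolutely convergent power series;
   the sum is taken along the boxes {J | J_i < N for all i}. *)
Definition real_analytic_on (U : set 'rV[R]_n) (g : 'rV[R]_n -> R) : Prop :=
  forall a, U a -> exists (c : mindex n -> R) (r : R), 0 < r /\
    forall h : 'rV[R]_n, `|h| < r ->
      summable [set: mindex n] (fun J => (c J * monomial h J)%:E) /\
      (fun N : nat => \sum_(K : {ffun 'I_n -> 'I_N})
         let J : mindex n := [ffun i => nat_of_ord (K i)] in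
         c J * monomial h J) @ \oo --> g (a + h).

Definition analytic_map_on (U : set 'rV[R]_n) (phi : 'rV[R]_n -> 'rV[R]_n) :=
  forall i : 'I_n, real_analytic_on U (fun x => phi x 0 i).

(* Near 0, [X] is straightened to the linear subspace {y | y_i = 0, i >= k} by
   a real-analytic diffeomorphism [phi] from [U] to [V], with inverse [psi]. *)
Definition analytic_submanifold_germ (X : set 'rV[R]_n) : Prop :=
  exists (k : nat) (U V : set 'rV[R]_n) (phi psi : 'rV[R]_n -> 'rV[R]_n),
  [/\ (k <= n)%N,
      open_nbhs (0 : 'rV[R]_n) U /\ open_nbhs (0 : 'rV[R]_n) V,
      [/\ analytic_map_on U phi, analytic_map_on V psi & phi 0 = 0],
      (forall x, U x -> V (phi x) /\ psi (phi x) = x) /\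
      (forall y, V y -> U (psi y) /\ phi (psi y) = y) &
      forall x, U x ->
        (X x <-> forall i : 'I_n, (k <= i)%N -> phi x 0 i = 0)].

End AnalyticSubmanifold.

(* Main.v *)
Require Import Defs.
From mathcomp Require Import all_boot all_order all_algebra.
From mathcomp Require Import all_classical all_reals all_analysis.
From mathcomp Require Import complex ring lra zify.

(** A germ flat on [X] decays, near [X], faster than every [(c d)^k M_k] where
    [d] is the distance to [X].  The idea is to divide it by a flat function
    [w = exp(-P)], with [P = K sum_j e_j / (rho^q + e_j)], where [rho ~ d^2] is
    the sum of the squares of analytic equations of [X] and [e_j] is a large
    power of [M_j / M_{j+1}], so that [P] counts the quotients exceeding [d].
    Since [1/(rho^q + e_j)] has derivatives controlled by its own value at
    scale [d], [exp(P)] and [exp(-P)] have explicit bounds; moderate growth and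
    strong non-quasianalyticity of [M] turn them into Carleman bounds for [w]
    and for [g = f / w].  The partial sums [P_k] are bounded near [X], so
    [exp(P_k) f] belongs to any ideal containing [f]; these functions converge
    to [g] in some [C_{M,sigma}], hence [g] lies in every closed ideal
    containing [f].  As [f] is flat only on a small piece of [X], it is first
    multiplied by a compactly supported [chi], built in the same way from the
    equation of a sphere, which is invertible as a germ. *)

Set Implicit Arguments.
Unset Strict Implicit.
Unset Printing Implicit Defensive.

Import Order.TTheory GRing.Theory Num.Theory.
Import numFieldNormedType.Exports.
Local Open Scope classical_set_scope.
Local Open Scope ring_scope.

(** * Smooth functions and the Leibniz rule along words *)

(** Flatness of [exp(-P)] wants [P] large, while division wants [exp(P)] beaten by the decay of [f];
    two separate constants reconcile these demands. Put [a_j = M_j / M_{j+1}] and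
    [e_j = (a_j / B)^{2q}], let [N] count the [j] with [a_j > B d], and let [C] be the constant in
    [sum_{j >= l} a_j^{2q} <= C (l+1) a_l^{2q}]. Then [P] lies between [K N / 2] and
    [K (N + C (N+1))]. As [P] bounds its own derivatives at scale [d], differentiating [exp(-P)]
    still leaves [exp(-P/2)], and differentiating [exp(P)] costs at most [exp(3P/2)]. The constant
    [K] depends only on the growth constant [A]: it gives [exp(-P/2) <= A^{-2N}], which moderate
    growth bounds by [(B d)^j M_j] for every [j]. The constant [B] is fixed afterwards, from the
    decay rate [T] of [f], so large that [(A^2 T d)^N M_N <= (A^2 T / B)^N] absorbs [exp(3P/2)] up
    to a constant. *)

Section DirectionalDerivative.
Variables (R : realType) (n : nat).
Implicit Types (x v : 'rV[R]_n) (g : 'rV[R]_n -> R).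

(** A division-free form: the inequality is trivial at [h = 0], so no punctured neighbourhood
    remains, and rescaling, translating or dominating increments becomes elementary. *)
Lemma is_derive_epsP x v g (l : R) : is_derive x v g l <->
  forall e : R, 0 < e -> exists d : R, 0 < d /\
    forall h : R, `|h| < d -> `|g (x + h *: v) - g x - h * l| <= e * `|h|.
Proof.
split=> [[gx <-] e e0|H].
  have /cvgrPdist_le /(_ e e0) := gx.
  rewrite /dnbhs near_withinE => /nbhs_ballP[d /= d0 H].
  exists d; split => // h hd.
  have [->|h0] := eqVneq h 0.
    by rewrite scale0r addr0 mul0r subrr subr0 normr0 mulr0.
  have hb : ball (0 : R) d h by rewrite /ball /= sub0r normrN.
  have := H h hb h0; rewrite -/(derive g x v) /= => Hh.
  have -> : g (x + h *: v) - g x - h * 'D_v g x =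
    - (h * ('D_v g x - h^-1 *: (g (h *: v + x) - g x))).
    rewrite mulrBr /GRing.scale /= mulrA divff // mul1r [h *: v + x]addrC; ring.
  by rewrite normrN normrM mulrC ler_wpM2r.
have C : (fun h : R => h^-1 *: ((g \o shift x) (h *: v) - g x)) @ 0^' --> l.
  apply/cvgrPdist_le => e e0; have [d [d0 {}H]] := H e e0.
  rewrite near_withinE; apply/nbhs_ballP; exists d => //= h.
  rewrite /ball /= sub0r normrN => hd h0.
  have hn : 0 < `|h| by rewrite normr_gt0.
  rewrite -(ler_pM2r hn) -normrM; apply: le_trans (H h hd).
  rewrite -normrN [h *: v + x]addrC /GRing.scale /= mulrBl -mulrA [(_ - _) * h]mulrC.
  by rewrite mulKf // opprB [h * l]mulrC.
apply: DeriveDef; first by apply/cvg_ex; exists l.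
exact: cvg_lim.
Qed.

End DirectionalDerivative.

(** Both difference quotients are the same function of [h]. This carries the one-variable chain rule
    and mean value theorem over to directional derivatives. *)
Lemma is_derive_line (R : realType) (n : nat) (x v : 'rV[R]_n)
    (g : 'rV[R]_n -> R) (t l : R) :
  is_derive (x + t *: v) v g l <-> is_derive t 1 (fun h : R => g (x + h *: v)) l.
Proof.
have E : (fun h : R => h^-1 *: ((g \o shift (x + t *: v)) (h *: v) -
                                g (x + t *: v))) =
  (fun h : R => h^-1 *: (((fun h : R => g (x + h *: v)) \o shift t) (h *: 1) -
                                g (x + t *: v))).
  apply/funext => h /=; congr (_ *: (g _ - _)).
  by rewrite [h *: 1]mulr1 scalerDl addrCA.
split=> -[d1 d2].
  by apply: DeriveDef; [rewrite /derivable -E|rewrite -d2 /derive -E].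
by apply: DeriveDef; [rewrite /derivable E|rewrite -d2 /derive E].
Qed.

Section Smooth.
Variables (R : realType) (n : nat).
Implicit Types (Om : set 'rV[R]_n) (f g : 'rV[R]_n -> R) (i : 'I_n) (s : seq 'I_n).

Definition ax i : 'rV[R]_n := delta_mx 0 i.

Lemma open_near Om x (P : 'rV[R]_n -> Prop) :
  open Om -> Om x -> (forall y, Om y -> P y) -> \forall y \near x, P y.
Proof. by move=> oOm Omx H; apply: filterS H _; exact: open_nbhs_nbhs. Qed.

Lemma pderiv_congr Om f g i x : open Om -> (forall y, Om y -> f y = g y) ->
  Om x -> pderiv i f x = pderiv i g x.
Proof.
by move=> oOm fg Omx; apply: near_eq_derive; exact: open_near oOm Omx fg.
Qed.

Lemma pderivs_congr Om f g s : open Om -> (forall y, Om y -> f y = g y) ->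
  forall x, Om x -> pderivs s f x = pderivs s g x.
Proof.
by move=> oOm fg; elim: s => //= i s IH x; exact: pderiv_congr oOm IH.
Qed.

Lemma pderivs_cat s t f : pderivs (s ++ t) f = pderivs s (pderivs t f).
Proof. by rewrite /pderivs foldr_cat. Qed.

Lemma pderivs_rcons s i f : pderivs (rcons s i) f = pderivs s (pderiv i f).
Proof. by rewrite -cats1 pderivs_cat. Qed.

Definition regular_on Om g := forall x, Om x ->
  {for x, continuous g} /\ forall i, derivable g x (ax i).

Lemma regular_congr Om f g : open Om -> (forall y, Om y -> f y = g y) ->
  regular_on Om f -> regular_on Om g.
Proof.
move=> oOm fg rf x Omx; have [cf df] := rf x Omx; split=> [|i].
  have fg' := open_near oOm Omx fg.
  have : g @ x --> f x by exact: cvg_trans (near_eq_cvg fg') cf.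
  by rewrite (fg x Omx).
by apply: near_eq_derivable (df i); exact: open_near oOm Omx fg.
Qed.

Lemma smoothP Om g : smooth_on Om g <-> forall s, regular_on Om (pderivs s g).
Proof. by split=> H s x; exact: H. Qed.

Lemma smooth_regular Om g : smooth_on Om g -> regular_on Om g.
Proof. by move=> /smoothP /(_ [::]). Qed.

Lemma smooth_pderivs Om g s : smooth_on Om g -> smooth_on Om (pderivs s g).
Proof. by move=> /smoothP H; apply/smoothP => t; rewrite -pderivs_cat. Qed.

Lemma smooth_sub Om Om' g : Om' `<=` Om -> smooth_on Om g -> smooth_on Om' g.
Proof. by move=> sub H s x /sub Omx; exact: H. Qed.

Lemma smooth_congr Om f g : open Om -> (forall y, Om y -> f y = g y) ->
  smooth_on Om f -> smooth_on Om g.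
Proof.
move=> oOm fg /smoothP sf; apply/smoothP => s.
exact: regular_congr oOm (pderivs_congr s oOm fg) (sf s).
Qed.

Lemma smooth_is_derive Om g x i : smooth_on Om g -> Om x ->
  is_derive x (ax i) g (pderiv i g x).
Proof.
by move=> /smooth_regular sg /sg[_ dg]; apply: derivableP; exact: dg.
Qed.

(* Closed under partial derivatives, so smoothness of all its members follows
   from their mere regularity. *)
Inductive smooth_expr Om : ('rV[R]_n -> R) -> Prop :=
| SESmooth g of smooth_on Om g : smooth_expr Om g
| SECst c : smooth_expr Om (fun=> c)
| SEAdd f g of smooth_expr Om f & smooth_expr Om g :
    smooth_expr Om (fun x => f x + g x)
| SEMul f g of smooth_expr Om f & smooth_expr Om g :
    smooth_expr Om (fun x => f x * g x)
| SEExp f of smooth_expr Om f : smooth_expr Om (fun x => expR (f x))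
| SEInv f of smooth_expr Om f & (forall x, Om x -> f x != 0) :
    smooth_expr Om (fun x => (f x)^-1).

Lemma is_derive_expR_comp g x v l : is_derive x v g l ->
  is_derive x v (fun y => expR (g y)) (l * expR (g x)).
Proof.
move=> dg; have E : x = x + 0 *: v by rewrite scale0r addr0.
rewrite E; apply/is_derive_line.
have dg' : is_derive (0 : R) 1 (fun h : R => g (x + h *: v)) l.
  by apply/is_derive_line; rewrite -E.
by have := is_derive1_comp (is_derive_expR (g (x + 0 *: v))) dg'; rewrite mulrC.
Qed.

Lemma regular_expr Om f : smooth_expr Om f -> regular_on Om f.
Proof.
elim=> {f} [g /smooth_regular //|c x _|f g _ IHf _ IHg x Omx|f g _ IHf _ IHg x Omx
           |f _ IHf x Omx|f _ IHf f0 x Omx].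
- by split=> [|i]; [exact: cst_continuous|exact: derivable_cst].
- have [cf df] := IHf x Omx; have [cg dg] := IHg x Omx.
  by split=> [|i]; [exact: continuousD|exact: derivableD].
- have [cf df] := IHf x Omx; have [cg dg] := IHg x Omx.
  by split=> [|i]; [exact: continuousM|exact: derivableM].
- have [cf df] := IHf x Omx; split=> [|i].
    by apply: continuous_comp => //; exact: continuous_expR.
  by have [] := is_derive_expR_comp (derivableP (df i)).
- have [cf df] := IHf x Omx; split=> [|i].
    by apply: continuousV => //; exact: f0.
  by apply: derivableV => //; exact: f0.
Qed.

Lemma pderiv_cst c i x : pderiv i (fun=> c) x = 0 :> R.
Proof. exact: derive_cst. Qed.

Section PderivRules.
Variables (Om : set 'rV[R]_n).
Implicit Types (x : 'rV[R]_n).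

Lemma pderivD f g i x : regular_on Om f -> regular_on Om g -> Om x ->
  pderiv i (fun y => f y + g y) x = pderiv i f x + pderiv i g x.
Proof. by move=> rf rg Omx; apply: deriveD; [case: (rf x)|case: (rg x)]. Qed.

Lemma pderivM f g i x : regular_on Om f -> regular_on Om g -> Om x ->
  pderiv i (fun y => f y * g y) x = pderiv i f x * g x + f x * pderiv i g x.
Proof.
move=> rf rg Omx; rewrite /pderiv deriveM; [|by case: (rf x)|by case: (rg x)].
by rewrite addrC /GRing.scale /= mulrC.
Qed.

Lemma pderiv_expR f i x : regular_on Om f -> Om x ->
  pderiv i (fun y => expR (f y)) x = pderiv i f x * expR (f x).
Proof.
move=> rf Omx; apply: derive_val; apply: is_derive_expR_comp.
by apply: derivableP; case: (rf x Omx).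
Qed.

(** The right side uses only constants, products and inverses, so that it is again a
    [smooth_expr]. *)
Lemma pderivV f i x : regular_on Om f -> Om x -> f x != 0 ->
  pderiv i (fun y => (f y)^-1) x = pderiv i f x * (-1 * ((f x)^-1 * (f x)^-1)).
Proof.
move=> rf Omx f0; rewrite /pderiv deriveV //; last by case: (rf x Omx).
by rewrite /GRing.scale /= -exprVn; ring.
Qed.

End PderivRules.

Lemma pderiv_smooth_expr Om f i : open Om -> smooth_expr Om f ->
  exists2 h, smooth_expr Om h & forall x, Om x -> pderiv i f x = h x.
Proof.
move=> oOm; elim=> {f} [g sg|c|f g sf [f' sf' Ef] sg [g' sg' Eg]
  |f g sf [f' sf' Ef] sg [g' sg' Eg]|f sf [f' sf' Ef]|f sf [f' sf' Ef] f0].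
- by exists (pderiv i g) => //; apply: SESmooth; exact: (smooth_pderivs [:: i] sg).
- exists (fun=> 0) => [|x _]; first exact: SECst.
  exact: pderiv_cst.
- exists (fun x => f' x + g' x) => [|x Omx]; first exact: SEAdd.
  by rewrite (pderivD _ (regular_expr sf) (regular_expr sg) Omx) Ef // Eg.
- exists (fun x => f' x * g x + f x * g' x) => [|x Omx].
    by apply: SEAdd; apply: SEMul.
  by rewrite (pderivM _ (regular_expr sf) (regular_expr sg) Omx) Ef // Eg.
- exists (fun x => f' x * expR (f x)) => [|x Omx].
    by apply: SEMul => //; exact: SEExp.
  by rewrite (pderiv_expR _ (regular_expr sf) Omx) Ef.
- exists (fun x => f' x * (-1 * ((f x)^-1 * (f x)^-1))) => [|x Omx].
    by repeat (apply: SEMul || apply: SEInv || apply: SECst || assumption).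
  by rewrite (pderivV _ (regular_expr sf) Omx (f0 _ Omx)) Ef.
Qed.

Lemma smooth_exprW Om f : open Om -> smooth_expr Om f -> smooth_on Om f.
Proof.
move=> oOm sf; apply/smoothP => s.
suff [h sh E] : exists2 h, smooth_expr Om h & forall x, Om x -> pderivs s f x = h x.
  by apply: (regular_congr oOm _ (regular_expr sh)) => y Omy; rewrite E.
elim: s => [|i s [h sh E]] /=; first by exists f.
have [h' sh' E'] := pderiv_smooth_expr i oOm sh.
by exists h' => // x Omx; rewrite (pderiv_congr i oOm E Omx) E'.
Qed.

Lemma smooth_cst Om c : open Om -> smooth_on Om (fun=> c).
Proof. by move=> oOm; apply: smooth_exprW => //; exact: SECst. Qed.

Lemma smoothD Om f g : open Om -> smooth_on Om f -> smooth_on Om g ->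
  smooth_on Om (fun x => f x + g x).
Proof. by move=> oOm sf sg; apply: smooth_exprW => //; apply: SEAdd; exact: SESmooth. Qed.

Lemma smoothM Om f g : open Om -> smooth_on Om f -> smooth_on Om g ->
  smooth_on Om (fun x => f x * g x).
Proof. by move=> oOm sf sg; apply: smooth_exprW => //; apply: SEMul; exact: SESmooth. Qed.

Lemma smooth_expR Om f : open Om -> smooth_on Om f -> smooth_on Om (fun x => expR (f x)).
Proof. by move=> oOm sf; apply: smooth_exprW => //; apply: SEExp; exact: SESmooth. Qed.

Lemma smoothV Om f : open Om -> smooth_on Om f -> (forall x, Om x -> f x != 0) ->
  smooth_on Om (fun x => (f x)^-1).
Proof. by move=> oOm sf f0; apply: smooth_exprW => //; apply: SEInv => //; exact: SESmooth. Qed.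

Lemma smooth_sum Om I (r : seq I) (P : pred I) (F : I -> 'rV[R]_n -> R) : open Om ->
  (forall k, P k -> smooth_on Om (F k)) -> smooth_on Om (fun x => \sum_(k <- r | P k) F k x).
Proof.
move=> oOm sF; elim: r => [|k r IH].
  by apply: smooth_congr oOm _ (smooth_cst 0 oOm) => y _; rewrite big_nil.
have [Pk|nPk] := boolP (P k); last first.
  by apply: smooth_congr oOm _ IH => y _; rewrite big_cons (negbTE nPk).
by apply: smooth_congr oOm _ (smoothD oOm (sF _ Pk) IH) => y _; rewrite big_cons Pk.
Qed.

Lemma smoothX Om f k : open Om -> smooth_on Om f -> smooth_on Om (fun x => f x ^+ k).
Proof.
move=> oOm sf; elim: k => [|k IH].
  by apply: smooth_congr oOm _ (smooth_cst 1 oOm) => y _; rewrite expr0.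
by apply: smooth_congr oOm _ (smoothM oOm sf IH) => y _; rewrite exprS.
Qed.

Lemma pderivsD Om f g s : open Om -> smooth_on Om f -> smooth_on Om g ->
  forall x, Om x -> pderivs s (fun y => f y + g y) x = pderivs s f x + pderivs s g x.
Proof.
move=> oOm sf sg; elim: s => //= i s IH x Omx.
rewrite (pderiv_congr i oOm IH Omx).
exact: (pderivD _ (smooth_regular (smooth_pderivs s sf)) (smooth_regular (smooth_pderivs s sg))).
Qed.

Lemma pderivs_cst Om s (c : R) : open Om -> (0 < size s)%N ->
  forall x, Om x -> pderivs s (fun=> c) x = 0.
Proof.
move=> oOm; elim: s => //= i [|j s] IH _ x Omx; first exact: pderiv_cst.
rewrite (pderiv_congr (g := fun=> 0) i oOm _ Omx); first exact: pderiv_cst.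
by move=> y Omy; apply: IH.
Qed.

Lemma pderivsZ Om c f s : open Om -> smooth_on Om f ->
  forall x, Om x -> pderivs s (fun y => c * f y) x = c * pderivs s f x.
Proof.
move=> oOm sf; elim: s => //= i s IH x Omx.
rewrite (pderiv_congr i oOm IH Omx).
rewrite (pderivM _ (smooth_regular (smooth_cst c oOm)) (smooth_regular (smooth_pderivs s sf))) //.
by rewrite pderiv_cst mul0r add0r.
Qed.

Lemma smoothN Om f : open Om -> smooth_on Om f -> smooth_on Om (fun x => - f x).
Proof.
move=> oOm sf; apply: smooth_congr oOm _ (smoothM oOm (smooth_cst (-1) oOm) sf).
by move=> y _; rewrite mulN1r.
Qed.

Lemma pderivsN Om f s : open Om -> smooth_on Om f ->
  forall x, Om x -> pderivs s (fun y => - f y) x = - pderivs s f x.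
Proof.
move=> oOm sf x Omx; rewrite -mulN1r -(pderivsZ _ _ oOm sf Omx).
by apply: pderivs_congr oOm _ _ Omx => y _; rewrite mulN1r.
Qed.

Lemma pderivsB Om f g s : open Om -> smooth_on Om f -> smooth_on Om g ->
  forall x, Om x -> pderivs s (fun y => f y - g y) x = pderivs s f x - pderivs s g x.
Proof.
move=> oOm sf sg x Omx.
by rewrite (pderivsD _ oOm sf (smoothN oOm sg)) // (pderivsN _ oOm sg).
Qed.

Lemma pderivs_sum Om I (r : seq I) (P : pred I) (F : I -> 'rV[R]_n -> R) s : open Om ->
  (forall k, P k -> smooth_on Om (F k)) -> forall x, Om x ->
  pderivs s (fun x => \sum_(k <- r | P k) F k x) x = \sum_(k <- r | P k) pderivs s (F k) x.
Proof.
move=> oOm sF; elim: r => [|k r IH] x Omx.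
  rewrite (pderivs_congr (g := fun=> 0) s oOm _ Omx) => [|y _]; last by rewrite big_nil.
  rewrite big_nil; by case: s => // i s; exact: (pderivs_cst (s := i :: s) _ oOm).
rewrite big_cons; have [Pk|nPk] := boolP (P k); last first.
  by rewrite -IH //; apply: pderivs_congr oOm _ _ Omx => y _; rewrite big_cons (negbTE nPk).
rewrite -IH // -(pderivsD _ oOm (sF _ Pk) (smooth_sum _ oOm sF) Omx).
by apply: pderivs_congr oOm _ _ Omx => y _; rewrite big_cons Pk.
Qed.

(* Only the lengths of the words matter, so the bound is the one-variable
   Leibniz rule. *)
Lemma leibniz_bound Om f g s x (b c : nat -> R) : open Om ->
  smooth_on Om f -> smooth_on Om g -> Om x ->
  (forall t, (size t <= size s)%N -> `|pderivs t f x| <= b (size t)) ->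
  (forall t, (size t <= size s)%N -> `|pderivs t g x| <= c (size t)) ->
  `|pderivs s (fun y => f y * g y) x| <=
    \sum_(k < (size s).+1) 'C(size s, k)%:R * b k * c (size s - k)%N.
Proof.
move=> oOm; elim/last_ind: s f g b c => [|s i IH] f g b c sf sg Omx Hb Hc.
  rewrite big_ord_recl big_ord0 /= addr0 bin0 mul1r normrM.
  by apply: ler_pM => //; [exact: (Hb [::])|exact: (Hc [::])].
have sf' := smooth_pderivs [:: i] sf; have sg' := smooth_pderivs [:: i] sg.
rewrite pderivs_rcons.
rewrite (pderivs_congr (g := fun y => pderiv i f y * g y + f y * pderiv i g y) s oOm _ Omx);
  last by move=> y Omy; rewrite (pderivM _ (smooth_regular sf) (smooth_regular sg)).
rewrite (pderivsD _ oOm (smoothM oOm sf' sg) (smoothM oOm sf sg')) //.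
apply: le_trans (ler_normD _ _) _; rewrite size_rcons.
set m := size s.
have H1 : `|pderivs s (fun y => pderiv i f y * g y) x| <=
    \sum_(k < m.+1) 'C(m, k)%:R * b k.+1 * c (m - k)%N.
  apply: (IH (pderiv i f) g (fun k => b k.+1) c sf' sg Omx) => t ht.
    by rewrite -pderivs_rcons; have := Hb (rcons t i); rewrite !size_rcons; apply.
  by apply: Hc; rewrite size_rcons (leq_trans ht).
have H2 : `|pderivs s (fun y => f y * pderiv i g y) x| <=
    \sum_(k < m.+1) 'C(m, k)%:R * b k * c (m - k).+1.
  apply: (IH f (pderiv i g) b (fun k => c k.+1) sf sg' Omx) => t ht.
    by apply: Hb; rewrite size_rcons (leq_trans ht).
  by rewrite -pderivs_rcons; have := Hc (rcons t i); rewrite !size_rcons; apply.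
apply: le_trans (lerD H1 H2) _.
(* Pascal's rule splits the right side into the two sums; the extra top term vanishes because its
   binomial coefficient does. *)
rewrite [leRHS]big_ord_recl /= bin0 subn0 mul1r.
under [in leRHS]eq_bigr => k _.
  rewrite /bump /= add1n binS natrD mulrDl mulrDl subSS; over.
rewrite big_split /= addrA [leRHS]addrC lerD2l.
rewrite [leLHS]big_ord_recl /= bin0 subn0 mul1r lerD2l.
rewrite [leRHS]big_ord_recr /= bin_small // !mul0r addr0.
apply: ler_sum => k _; rewrite /bump /= add1n.
by rewrite subnSK // ltn_ord.
Qed.

End Smooth.

(** * Axis-parallel paths and Taylor's inequality *)

Section Sequences.
Variable R : realType.
Implicit Types (u : nat -> R) (l b : R).

Lemma cvg_seqP u l : u @ \oo --> l <->
  forall e : R, 0 < e -> exists N, forall m, (N <= m)%N -> `|u m - l| <= e.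
Proof.
split=> [/cvgrPdist_le H e /H [N _ HN]|H].
  by exists N => m Nm; rewrite distrC; exact: HN.
apply/cvgrPdist_le => e /H[N HN]; exists N => // m Nm.
by rewrite distrC; exact: HN.
Qed.

Lemma cauchy_seq_cvg u :
  (forall e : R, 0 < e -> exists N, forall m k, (N <= m)%N -> (N <= k)%N ->
     `|u m - u k| <= e) -> exists l, u @ \oo --> l.
Proof.
move=> H; suff : cvg (u @ \oo) by move=> /cvg_ex.
apply: cauchy_cvg; apply/cauchy_exP => e e0.
have [N HN] := H (e / 2) (divr_gt0 e0 (ltr0Sn _ 1)).
exists (u N); exists N => // m /= Nm; rewrite /ball /=.
by apply: le_lt_trans (HN _ _ (leqnn N) Nm) _; rewrite ltr_pdivrMr // ltr_pMr // ltr1n.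
Qed.

Lemma cvg_norm_le u l b : u @ \oo --> l -> (exists N, forall m, (N <= m)%N -> `|u m| <= b) ->
  `|l| <= b.
Proof.
move=> /cvg_seqP ul [N HN]; apply/ler_addgt0Pr => e e0.
have [N' HN'] := ul e e0; set m := maxn N N'.
have -> : l = u m - (u m - l) by ring.
apply: le_trans (ler_normB _ _) _; apply: lerD; first by rewrite HN // leq_maxl.
by rewrite HN' // leq_maxr.
Qed.

End Sequences.

Section SegmentMeanValue.
Variable R : realType.

(** Both [g + f] and [g - f] have nonnegative derivative, so the mean value theorem suffices and no
    integral appears. *)
Lemma dominated_mvt (f g df dg : R -> R) :
  (forall t : R, 0 <= t <= 1 -> is_derive t 1 f (df t)) ->
  (forall t : R, 0 <= t <= 1 -> is_derive t 1 g (dg t)) ->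
  (forall t : R, 0 <= t <= 1 -> `|df t| <= dg t) ->
  `|f 1 - f 0| <= g 1 - g 0.
Proof.
move=> Hf Hg Hfg.
have cont (h dh : R -> R) : (forall t : R, 0 <= t <= 1 -> is_derive t 1 h (dh t)) ->
    {within `[0, 1], continuous h}.
  move=> Hh; apply: derivable_within_continuous => t; rewrite in_itv /= => t01.
  by have [] := Hh t t01.
have mono (h dh : R -> R) : (forall t : R, 0 <= t <= 1 -> is_derive t 1 h (dh t)) ->
    (forall t : R, 0 <= t <= 1 -> 0 <= dh t) -> 0 <= h 1 - h 0.
  move=> Hh dh0; have [//|||c] := @MVT_segment R h dh 0 1.
  - move=> x; rewrite in_itv /= => /andP[x0 x1]; apply: Hh.
    by rewrite !ltW.
  - exact: cont Hh.
  - by rewrite in_itv /= => c01 ->; rewrite subr0 mulr1 dh0.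
rewrite ler_norml; apply/andP; split.
- have H1 (t : R) : 0 <= t <= 1 -> is_derive t 1 (g + f) ((dg + df) t).
    by move=> t01; apply: is_deriveD; [exact: Hg|exact: Hf].
  have := mono _ _ H1; have H2 (t : R) : 0 <= t <= 1 -> 0 <= (dg + df) t.
    by move=> /Hfg; rewrite ler_norml -[(dg + df) t]/(dg t + df t) => /andP[]; lra.
  move=> /(_ H2).
  by rewrite -[(g + f) 1]/(g 1 + f 1) -[(g + f) 0]/(g 0 + f 0); lra.
- have H1 (t : R) : 0 <= t <= 1 -> is_derive t 1 (g - f) ((dg - df) t).
    by move=> t01; apply: is_deriveB; [exact: Hg|exact: Hf].
  have := mono _ _ H1; have H2 (t : R) : 0 <= t <= 1 -> 0 <= (dg - df) t.
    by move=> /Hfg; rewrite ler_norml -[(dg - df) t]/(dg t - df t) => /andP[]; lra.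
  move=> /(_ H2).
  by rewrite -[(g - f) 1]/(g 1 - f 1) -[(g - f) 0]/(g 0 - f 0); lra.
Qed.

End SegmentMeanValue.

Section AxisPaths.
Variables (R : realType) (n : nat).
Implicit Types (x y z v : 'rV[R]_n) (Om : set 'rV[R]_n) (g : 'rV[R]_n -> R).
Implicit Types (i j : 'I_n) (t l : R).

Lemma is_derive_dirZ x v g t l : is_derive x v g l -> is_derive x (t *: v) g (t * l).
Proof.
move=> /is_derive_epsP H; apply/is_derive_epsP => e e0.
have t1 : 0 < `|t| + 1 by rewrite ltr_wpDl.
have [d [d0 Hd]] := H (e / (`|t| + 1)) (divr_gt0 e0 t1).
exists (d / (`|t| + 1)); split=> [|h hd]; first exact: divr_gt0.
have ht : `|h * t| < d.
  rewrite normrM; apply: le_lt_trans (_ : `|h| * (`|t| + 1) < _).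
    by rewrite ler_wpM2l // lerDl.
  by rewrite -ltr_pdivlMr.
have := Hd _ ht; rewrite scalerA mulrA => /le_trans; apply.
have -> : e / (`|t| + 1) * `|h * t| = e * `|h| * (`|t| / (`|t| + 1)).
  by rewrite normrM; ring.
by rewrite ler_piMr ?mulr_ge0 ?(ltW e0) // ler_pdivrMr // mul1r lerDl.
Qed.

Lemma is_derive_transl x a v g l : is_derive (x + a) v g l ->
  is_derive x v (fun y => g (y + a)) l.
Proof.
move=> /is_derive_epsP H; apply/is_derive_epsP => e /H[d [d0 Hd]].
by exists d; split=> // h /Hd; rewrite [x + a + _]addrAC.
Qed.

Definition axis_segment Om z i t :=
  forall th : R, 0 <= th <= 1 -> Om (z + th *: (t *: ax R i)).

Lemma is_derive_segment g z i t th :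
  derivable g (z + th *: (t *: ax R i)) (ax R i) ->
  is_derive th 1 (fun h : R => g (z + h *: (t *: ax R i)))
    (t * pderiv i g (z + th *: (t *: ax R i))).
Proof.
by move=> dg; apply/is_derive_line; apply: is_derive_dirZ; exact: derivableP.
Qed.

Lemma axis_mvt Om g z i t : regular_on Om g -> axis_segment Om z i t ->
  exists th : R, 0 <= th <= 1 /\
    g (z + t *: ax R i) - g z = t * pderiv i g (z + th *: (t *: ax R i)).
Proof.
move=> rg seg.
have dg th : 0 <= th <= 1 -> derivable g (z + th *: (t *: ax R i)) (ax R i).
  by move=> /seg /rg[].
have [//|||c] := @MVT_segment R (fun h : R => g (z + h *: (t *: ax R i)))
  (fun th => t * pderiv i g (z + th *: (t *: ax R i))) 0 1.
- move=> th; rewrite in_itv /= => /andP[h0 h1]; apply: is_derive_segment.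
  by apply: dg; rewrite !ltW.
- apply: derivable_within_continuous => th; rewrite in_itv /= => /dg h.
  by have [] := is_derive_segment h.
- rewrite in_itv /= => c01; rewrite scale1r scale0r addr0 subr0 mulr1 => E.
  by exists c.
Qed.

Lemma axis_lipschitz Om g z i t B : regular_on Om g -> axis_segment Om z i t ->
  (forall x, Om x -> `|pderiv i g x| <= B) ->
  `|g (z + t *: ax R i) - g z| <= `|t| * B.
Proof.
move=> rg seg HB; have [th [th01 ->]] := axis_mvt rg seg.
by rewrite normrM ler_wpM2l // HB //; exact: seg.
Qed.

Inductive axis_path Om y : R -> 'rV[R]_n -> Prop :=
| APnil : axis_path Om y 0 y
| APcons l z i t of axis_path Om y l z & axis_segment Om z i t :
    axis_path Om y (l + `|t|) (z + t *: ax R i).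

Lemma axis_path_ge0 Om y l x : axis_path Om y l x -> 0 <= l.
Proof. by elim=> // {}l z i t _ l0 _; rewrite addr_ge0. Qed.

Lemma axis_path_sub Om Om' y l x : Om `<=` Om' -> axis_path Om y l x -> axis_path Om' y l x.
Proof.
move=> sub; elim=> [|{}l z i t _ IH seg]; first exact: APnil.
by apply: APcons => // th /seg /sub.
Qed.

Lemma path_lipschitz Om g y l x B : regular_on Om g ->
  (forall i z, Om z -> `|pderiv i g z| <= B) -> axis_path Om y l x ->
  `|g x - g y| <= l * B.
Proof.
move=> rg HB; elim=> [|{x}{}l z i t _ IH seg].
  by rewrite subrr normr0 mul0r.
have -> : g (z + t *: ax R i) - g y = (g z - g y) + (g (z + t *: ax R i) - g z) by ring.
apply: le_trans (ler_normD _ _) _; rewrite mulrDl lerD //.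
by apply: axis_lipschitz rg seg _; exact: HB.
Qed.

(* Axis-parallel paths involve partial derivatives only, so that Fréchet
   differentiability is never needed. *)
Lemma path_taylor Om g y (B : nat -> R) k : smooth_on Om g ->
  (forall s z, Om z -> `|pderivs s g z| <= B (size s)) ->
  (forall s, pderivs s g y = 0) -> Om y ->
  forall l x, axis_path Om y l x -> Om x ->
  forall s, `|pderivs s g x| <= B (size s + k)%N * (l ^+ k / k`!%:R).
Proof.
move=> sg HB g0 Omy.
(* A letter [i] is required to form a word of length [m]; for [n = 0] only the empty word exists. *)
have B0 m (i : 'I_n) : 0 <= B m.
  by have := le_trans (normr_ge0 _) (HB (nseq m i) y Omy); rewrite size_nseq.
elim: k => [|k IH] l x.
  by move=> _ Omx s; rewrite addn0 expr0 fact0 divr1 mulr1 HB.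
elim=> [_ s|{x}{}l z i t p IHp seg _ s].
  by rewrite g0 normr0 expr0n /= mul0r mulr0.
have Omz : Om z by have := seg 0; rewrite scale0r addr0; apply; rewrite lexx ler01.
set b := B (size s + k.+1)%N; have b0 : 0 <= b := B0 _ i.
have l0 := axis_path_ge0 p.
have IHz := IHp Omz s; rewrite -/b in IHz.
(* [G] is the desired bound as a function of the arc length [l + th |t|]; its derivative [dG] is
   [|t|] times the bound of order [k] on the next derivative, known by the outer induction. *)
pose G (th : R) := b * ((l + th * `|t|) ^+ k.+1 / k.+1`!%:R).
pose dG (th : R) := `|t| * (b * ((l + th * `|t|) ^+ k / k`!%:R)).
have fk : k.+1`!%:R = k.+1%:R * k`!%:R :> R by rewrite factS natrM.
have k0 : k`!%:R != 0 :> R by rewrite pnatr_eq0 -lt0n fact_gt0.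
have HG (th : R) : is_derive th 1 G (dG th).
  have H1 : is_derive th 1 (cst l + id * cst `|t| : R -> R) `|t|.
    apply: is_derive_eq.
    by rewrite /GRing.scale /= mulr0 mulr1 !add0r.
  have H2 : is_derive th 1 ((cst l + id * cst `|t| : R -> R) ^+ k.+1)
      ((k.+1%:R * (l + th * `|t|) ^+ k) * `|t|).
    exact: is_deriveX.
  have H3 : is_derive th 1
      (cst (b / k.+1`!%:R) * (cst l + id * cst `|t| : R -> R) ^+ k.+1) (dG th).
    apply: is_derive_eq.
    rewrite /GRing.scale /= mulr0 addr0 /dG fk.
    have k1 : 1 + k%:R != 0 :> R by rewrite -(natrD _ 1 k) pnatr_eq0.
    by field; rewrite k0 k1.
  have -> // : G = cst (b / k.+1`!%:R) * (cst l + id * cst `|t| : R -> R) ^+ k.+1.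
  apply/funext => h; rewrite /G -[RHS]/(_ * _) mulrA mulrAC; congr (_ * _).
  by rewrite fctE.
have Hp (th : R) : 0 <= th <= 1 ->
    `|t * pderiv i (pderivs s g) (z + th *: (t *: ax R i))| <= dG th.
  move=> th01; rewrite normrM ler_wpM2l //.
  have th0 : 0 <= th by case/andP: th01.
  have -> : th * `|t| = `|th * t| by rewrite normrM ger0_norm.
  have -> : b = B (size (i :: s) + k)%N by rewrite /b addnS.
  apply: (IH _ _ _ _ (i :: s)); last exact: seg.
  rewrite scalerA; apply: APcons => // th' /andP[th'0 th'1].
  rewrite -scalerA scalerA; apply: seg.
  rewrite mulr_ge0 //= mulr_ile1 //.
  by case/andP: th01.
have rs : regular_on Om (pderivs s g) := smooth_regular (smooth_pderivs s sg).
have Hf (th : R) : 0 <= th <= 1 ->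
    is_derive th 1 (fun h : R => pderivs s g (z + h *: (t *: ax R i)))
      (t * pderiv i (pderivs s g) (z + th *: (t *: ax R i))).
  by move=> /seg /rs [_ d]; exact: is_derive_segment.
have := dominated_mvt Hf (fun th _ => HG th) Hp; rewrite scale1r scale0r addr0 /G mul1r mul0r addr0 => H.
have -> : pderivs s g (z + t *: ax R i) =
  pderivs s g z + (pderivs s g (z + t *: ax R i) - pderivs s g z) by ring.
apply: le_trans (ler_normD _ _) _; apply: le_trans (lerD IHz H) _.
by rewrite addrCA subrr addr0.
Qed.

End AxisPaths.

(** * Limits, truncations and symmetry of derivatives *)

Section Boxes.
Variables (R : realType) (n : nat).
Implicit Types (x y z c : 'rV[R]_n) (r t : R) (i j : 'I_n) (Om : set 'rV[R]_n).

Lemma rV_norm_le x r : 0 <= r -> (forall i, `|x 0 i| <= r) -> `|x| <= r.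
Proof.
move=> r0 H; rewrite /Num.norm /= mx_normrE; apply: bigmax_le => // -[i j] _ /=.
by rewrite ord1.
Qed.

Lemma rV_norm_lt x r : 0 < r -> (forall i, `|x 0 i| < r) -> `|x| < r.
Proof.
move=> r0 H; rewrite /Num.norm /= mx_normrE; apply: bigmax_lt => // -[i j] _ /=.
by rewrite ord1.
Qed.

Lemma rV_coord_le x i : `|x 0 i| <= `|x|.
Proof.
by rewrite [leRHS]/Num.norm /= mx_normrE; apply/bigmax_geP; right; exists (0, i).
Qed.

Lemma norm_ax_le i : `|ax R i| <= 1.
Proof.
apply: rV_norm_le => // j; rewrite mxE eqxx /=; case: (j == i); by rewrite ?normr1 ?normr0.
Qed.

Lemma ball_rVP c r x : 0 < r -> ball c r x <-> forall i, `|c 0 i - x 0 i| < r.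
Proof.
move=> r0; rewrite -ball_normE /ball_ /=; split=> [H i|H].
  by apply: le_lt_trans H; have := rV_coord_le (c - x) i; rewrite !mxE.
by apply: rV_norm_lt => // i; rewrite !mxE.
Qed.

Lemma ball_pos c r x : ball c r x -> 0 < r.
Proof. by rewrite -ball_normE /ball_ /=; apply: le_lt_trans. Qed.

Lemma ball_segment Om x i r t : ball x r `<=` Om -> `|t| < r -> axis_segment Om x i t.
Proof.
move=> sub tr th /andP[h0 h1]; apply: sub; rewrite -ball_normE /ball_ /=.
rewrite opprD addNKr normrN !normrZ; apply: le_lt_trans tr.
rewrite mulrCA ler_piMr // ger0_norm // mulr_ile1 //; exact: norm_ax_le.
Qed.

(** The coordinates are changed one at a time. Balls of the sup norm are boxes, so every
    intermediate point stays inside; each of the [n] steps has length at most [|x - y|]. *)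
Lemma box_path c r x y : ball c r x -> ball c r y ->
  exists l, l <= n%:R * `|x - y| /\ axis_path (ball c r) y l x.
Proof.
move=> bx yb; have r0 := ball_pos bx.
have {bx} bx := (ball_rVP c x r0).1 bx; have {yb} yb := (ball_rVP c y r0).1 yb.
pose mix m : 'rV[R]_n := \row_j (if (j < m)%N then x 0 j else y 0 j).
suff H m : (m <= n)%N -> exists l, l <= m%:R * `|x - y| /\ axis_path (ball c r) y l (mix m).
  have [l [l1 p]] := H n (leqnn n); exists l; split=> //.
  suff <- : mix n = x by [].
  by apply/rowP => j; rewrite mxE ltn_ord.
elim: m => [_|m IH mn].
  exists 0; split; first by rewrite mul0r.
  suff -> : mix 0%N = y by exact: APnil.
  by apply/rowP => j; rewrite mxE ltn0.
have [l [lm p]] := IH (ltnW mn); pose i := Ordinal mn; pose t := x 0 i - y 0 i.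
have E : mix m.+1 = mix m + t *: ax R i.
  apply/rowP => j; rewrite !mxE eqxx /= ltnS leq_eqVlt.
  have [->|ji] := eqVneq j i; first by rewrite eqxx ltnn /= mulr1 /t; ring.
  have -> : (j == m :> nat) = false by apply: contra_neqF ji => /eqP jm; exact: val_inj.
  by rewrite /= mulr0 addr0.
exists (l + `|t|); split.
  rewrite -natr1 mulrDl mul1r lerD //.
  by have := rV_coord_le (x - y) i; rewrite !mxE.
rewrite E; apply: APcons => // th /andP[h0 h1]; apply/(ball_rVP _ _ r0) => j.
rewrite !mxE eqxx /=; have [->|ji] := eqVneq j i; last first.
  by rewrite /= !mulr0 addr0; case: ifP.
rewrite /= ltnn mulr1 /t.
have -> : c 0 i - (y 0 i + th * (x 0 i - y 0 i)) =
  th * (c 0 i - x 0 i) + (1 - th) * (c 0 i - y 0 i) by ring.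
apply: le_lt_trans (ler_normD _ _) _; rewrite !normrM (ger0_norm h0).
rewrite [`|1 - th|]ger0_norm ?subr_ge0 //.
have [->|h0'] := eqVneq th 0; first by rewrite mul0r add0r subr0 mul1r.
rewrite (_ : r = th * r + (1 - th) * r); last by ring.
rewrite ltr_leD ?ler_wpM2l ?subr_ge0 ?(ltW (yb i)) //.
by rewrite ltr_pM2l // lt0r h0'.
Qed.

Lemma open_ball_sub Om x : open Om -> Om x -> exists r, 0 < r /\ ball x r `<=` Om.
Proof.
by move=> oOm Omx; have /nbhs_ballP[r /= r0 H] := open_nbhs_nbhs (conj oOm Omx); exists r.
Qed.

Lemma continuous_epsP (g : 'rV[R]_n -> R) x : {for x, continuous g} <->
  forall e, 0 < e -> exists d, 0 < d /\ forall y, `|x - y| < d -> `|g x - g y| <= e.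
Proof.
have P := @cvgrPdist_le _ _ _ (nbhs x) (nbhs_filter x) g (g x); split=> [/P H e e0|H].
  have /nbhs_ballP[d /= d0 Hd] := H e e0; exists d; split=> // y xy; apply: Hd.
  by rewrite -ball_normE.
apply/P => e /H[d [d0 Hd]]; apply/nbhs_ballP; exists d => //= y.
by rewrite -ball_normE; exact: Hd.
Qed.

End Boxes.

Section Limits.
Variables (R : realType) (n : nat).
Implicit Types (x y z : 'rV[R]_n) (Om : set 'rV[R]_n) (g : 'rV[R]_n -> R).

Lemma axis_taylor2 Om g B x i r h : regular_on Om g -> regular_on Om (pderiv i g) ->
  (forall z, Om z -> `|pderiv i (pderiv i g) z| <= B) -> ball x r `<=` Om -> `|h| < r ->
  `|g (x + h *: ax R i) - g x - h * pderiv i g x| <= B * h ^+ 2.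
Proof.
move=> rg rg' HB sub hr.
have B0 : 0 <= B.
  apply: le_trans (HB x _) => //; apply: sub; apply: ballxx.
  exact: le_lt_trans hr.
have [th [/andP[h0 h1] ->]] := axis_mvt rg (ball_segment i sub hr).
rewrite scalerA -mulrBr normrM.
have hth : `|th * h| <= `|h| by rewrite normrM ger0_norm // ler_piMl.
have := axis_lipschitz rg' (ball_segment i sub (le_lt_trans hth hr)) HB.
move=> /(ler_wpM2l (normr_ge0 h)) /le_trans; apply.
rewrite -real_normK ?num_real // expr2 [B * _]mulrC -mulrA ler_wpM2l // ler_wpM2r //.
Qed.

Lemma regular_limit Om (G : nat -> 'rV[R]_n -> R) g B : open Om ->
  (forall N, regular_on Om (G N)) -> (forall N i, regular_on Om (pderiv i (G N))) ->
  (forall N i x, Om x -> `|pderiv i (G N) x| <= B) ->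
  (forall N i j x, Om x -> `|pderiv j (pderiv i (G N)) x| <= B) ->
  (forall x, Om x -> (fun N => G N x) @ \oo --> g x) ->
  regular_on Om g /\
  forall i x, Om x -> (fun N => pderiv i (G N) x) @ \oo --> pderiv i g x.
Proof.
move=> oOm rG rG' HB HB' Gg.
have D i x : Om x -> exists2 l, (fun N => pderiv i (G N) x) @ \oo --> l &
    is_derive x (ax R i) g l.
  move=> Omx; have [r [r0 sub]] := open_ball_sub oOm Omx.
  have B0 : 0 <= B := le_trans (normr_ge0 _) (HB 0%N i x Omx).
  have T N h := axis_taylor2 (h := h) (rG N) (rG' N i) (HB' N i i) sub.
  have Omh h : `|h| < r -> Om (x + h *: ax R i).
    move=> hr; have := ball_segment i sub hr; move=> /(_ 1); rewrite scale1r; apply.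
    by rewrite ler01 lexx.
  have [e e0|l Gl] := @cauchy_seq_cvg R (fun N => pderiv i (G N) x).
    have B1 : 0 < 4 * B + 4 by rewrite ltr_wpDl // mulr_ge0.
    (* The Taylor errors for two indices, [2 B h^2] in all, use up at most half of [e h]. With [h]
       now fixed, four function values within [e h / 8] of their limits use the other half. *)
    pose h := Num.min (r / 2) (e / (4 * B + 4)).
    have h0 : 0 < h by rewrite lt_min !divr_gt0.
    have hr : `|h| < r.
      rewrite gtr0_norm // gt_min; apply/orP; left.
      by rewrite ltr_pdivrMr // ltr_pMr // ltr1n.
    have he : h * (4 * B + 4) <= e by rewrite -ler_pdivlMr // ge_min lexx orbT.
    have he2 : 0 < e * h / 8 by rewrite divr_gt0 // mulr_gt0.
    have [N1 H1] := (cvg_seqP _ _).1 (Gg _ (Omh h hr)) _ he2.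
    have [N2 H2] := (cvg_seqP _ _).1 (Gg _ Omx) _ he2.
    exists (maxn N1 N2) => m k; rewrite !geq_max => /andP[m1 m2] /andP[k1 k2].
    rewrite -(ler_pM2l h0) -{1}(gtr0_norm h0) -normrM.
    have := T m h hr; have := T k h hr; have := H1 m m1; have := H1 k k1.
    have := H2 m m2; have := H2 k k2.
    move: (G m _) (G k _) (G m _) (G k _) (pderiv i (G m) x) (pderiv i (G k) x)
      (g _) (g _) => a b c d p q u v.
    move: he; rewrite !ler_norml => he.
    have {he}: (h * (4 * B + 4)) * h <= e * h by rewrite ler_wpM2r // ltW.
    have : 0 <= B * h ^+ 2 by rewrite mulr_ge0 // sqr_ge0.
    have : 0 <= h ^+ 2 by rewrite sqr_ge0.
    have -> : h * (4 * B + 4) * h = 4 * (B * h ^+ 2) + 4 * h ^+ 2 by ring.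
    rewrite mulrBr [h * e]mulrC; move: (B * h ^+ 2) (e * h) (h * p) (h * q) (h ^+ 2).
    move=> A E P Q K; lra.
  exists l => //; apply/is_derive_epsP => e e0.
  have B1 : 0 < B + 1 by rewrite ltr_wpDl.
  exists (Num.min r (e / (B + 1))); split=> [|h].
    by rewrite lt_min r0 divr_gt0.
  rewrite lt_min => /andP[hr he].
  have : (fun N => G N (x + h *: ax R i) - G N x - h * pderiv i (G N) x) @ \oo -->
     g (x + h *: ax R i) - g x - h * l.
    apply: cvgB; first by apply: cvgB; [exact: Gg _ (Omh h hr)|exact: Gg].
    by apply: cvgM => //; exact: cvg_cst.
  move=> /(@cvg_norm_le _ _ _ (B * h ^+ 2)) H; apply: le_trans (H _) _.
    by exists 0%N => N _; exact: T.
  rewrite -real_normK ?num_real // expr2 mulrA ler_wpM2r //.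
  rewrite mulrC; apply: le_trans (_ : `|h| * (B + 1) <= _).
    by rewrite ler_wpM2l // lerDl.
  by rewrite -ler_pdivlMr // ltW.
split=> [x Omx|i x Omx]; last by have [l Gl [_ dl]] := D i x Omx; rewrite (_ : pderiv i g x = l).
split=> [|i]; last by have [l _ []] := D i x Omx.
have [r [r0 sub]] := open_ball_sub oOm Omx.
apply/continuous_epsP => e e0.
(* [C] is a Lipschitz constant along box paths common to all [G N], so continuity passes to the
   limit. *)
pose C := n%:R * (`|B| + 1).
have C0 : 0 <= C by rewrite mulr_ge0 // addr_ge0.
have C1 : 0 < C + 1 by rewrite ltr_wpDl.
exists (Num.min r (e / (C + 1))); split=> [|y].
  by rewrite lt_min r0 divr_gt0.
rewrite lt_min => /andP[yr ye].
have by_ : ball x r y by rewrite -ball_normE.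
have [l [l1 p]] := box_path (ballxx x r0) by_.
have : (fun N => G N x - G N y) @ \oo --> g x - g y.
  by apply: cvgB; apply: Gg => //; exact: sub.
move=> /(@cvg_norm_le _ _ _ e); apply; exists 0%N => N _.
have HB2 i z : Om z -> `|pderiv i (G N) z| <= `|B| + 1.
  move=> /(HB N i) /le_trans; apply; apply: le_trans (ler_norm _) _.
  by rewrite lerDl.
apply: le_trans (path_lipschitz (rG N) HB2 (axis_path_sub sub p)) _.
apply: le_trans (_ : n%:R * `|x - y| * (`|B| + 1) <= _).
  by rewrite ler_wpM2r // addr_ge0.
rewrite mulrAC -/C; apply: le_trans (_ : (C + 1) * `|x - y| <= _).
  by rewrite ler_wpM2r // lerDl.
by rewrite mulrC -ler_pdivlMr // ltW.
Qed.

(* The bounds on second derivatives make the difference quotients of [G N]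
   close to its derivatives uniformly in [N], so pointwise convergence of the
   functions alone is enough. *)
Lemma smooth_limit Om (G : nat -> 'rV[R]_n -> R) g (B : nat -> R) : open Om ->
  (forall N, smooth_on Om (G N)) ->
  (forall N s x, Om x -> `|pderivs s (G N) x| <= B (size s)) ->
  (forall x, Om x -> (fun N => G N x) @ \oo --> g x) ->
  smooth_on Om g /\
  forall s x, Om x -> (fun N => pderivs s (G N) x) @ \oo --> pderivs s g x.
Proof.
move=> oOm sG HB Gg.
have C s : (forall x, Om x -> (fun N => pderivs s (G N) x) @ \oo --> pderivs s g x) ->
    regular_on Om (pderivs s g) /\
    forall i x, Om x -> (fun N => pderivs (i :: s) (G N) x) @ \oo --> pderivs (i :: s) g x.
  move=> H; apply: (@regular_limit Om (fun N => pderivs s (G N)) (pderivs s g)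
    (Num.max (B (size s).+1) (B (size s).+2))) => //.
  - by move=> N; exact: smooth_regular (smooth_pderivs s (sG N)).
  - by move=> N i; exact: smooth_regular (smooth_pderivs (i :: s) (sG N)).
  - by move=> N i x Omx; rewrite le_max (HB N (i :: s) x Omx).
  - by move=> N i j x Omx; rewrite le_max (HB N (j :: i :: s) x Omx) orbT.
have L s x : Om x -> (fun N => pderivs s (G N) x) @ \oo --> pderivs s g x.
  elim: s x => [|i s IH] x Omx; first exact: Gg.
  by have [_] := C s IH; apply.
by split=> //; apply/smoothP => s; have [] := C s (L s).
Qed.

Lemma smooth_limit_bound Om (G : nat -> 'rV[R]_n -> R) g (B : nat -> R) : open Om ->
  (forall N, smooth_on Om (G N)) ->
  (forall N s x, Om x -> `|pderivs s (G N) x| <= B (size s)) ->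
  (forall x, Om x -> (fun N => G N x) @ \oo --> g x) ->
  forall s x, Om x -> `|pderivs s g x| <= B (size s).
Proof.
move=> oOm sG HB Gg s x Omx; have [_ /(_ s x Omx)] := smooth_limit oOm sG HB Gg.
by move=> /cvg_norm_le; apply; exists 0%N => N _; exact: HB.
Qed.

(** At a point where all derivatives of [g] vanish, the truncated function is dominated by the
    original one, which is [o(h)] there, so its derivative exists and is zero; the second
    alternative covers points outside the closure of [A]. *)
Lemma smooth_restrict Om (A : set 'rV[R]_n) g : open Om -> open A -> smooth_on Om g ->
  (forall x, Om x -> ~ A x -> (forall s, pderivs s g x = 0) \/ (\forall y \near x, ~ A y)) ->
  let G := fun x => if `[< A x >] then g x else 0 in
  smooth_on Om G /\
  forall s x, Om x -> pderivs s G x = if `[< A x >] then pderivs s g x else 0.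
Proof.
move=> oOm oA sg HA G.
have step s : (forall x, Om x -> pderivs s G x = if `[< A x >] then pderivs s g x else 0) ->
    regular_on Om (pderivs s G) /\
    forall i x, Om x -> pderivs (i :: s) G x = if `[< A x >] then pderivs (i :: s) g x else 0.
  move=> E; set u := pderivs s g.
  have ru : regular_on Om u := smooth_regular (smooth_pderivs s sg).
  pose v x := if `[< A x >] then u x else 0.
  suff [rv Dv] : regular_on Om v /\
      forall i x, Om x -> pderiv i v x = if `[< A x >] then pderiv i u x else 0.
    split; first by apply: regular_congr oOm _ rv => y Omy; rewrite E.
    by move=> i x Omx; rewrite /= (pderiv_congr i oOm E Omx) Dv.
  suff K x : Om x -> {for x, continuous v} /\
      forall i, is_derive x (ax R i) v (if `[< A x >] then pderiv i u x else 0).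
    split=> [x /K[cv dv]|i x /K[_ dv]]; first by split=> // i; case: (dv i).
    by have [_] := dv i.
  move=> Omx; have [Ax|nAx] := pselect (A x).
    have near_uv : \forall y \near x, u y = v y.
      by apply: open_near oA Ax _ => y Ay; rewrite /v asboolT.
    have [cu du] := ru x Omx; rewrite asboolT //; split=> [|i].
      have : v @ x --> u x by exact: cvg_trans (near_eq_cvg near_uv) cu.
      by rewrite (_ : u x = v x) // /v asboolT.
    by apply: near_eq_is_derive near_uv _; exact: derivableP.
  rewrite asboolF //; have vx : v x = 0 by rewrite /v asboolF.
  have [u0|nA] := HA x Omx nAx; last first.
    have near_v : \forall y \near x, (fun=> 0) y = v y.
      by apply: filterS nA => y nAy; rewrite /v asboolF.
    split=> [|i]; last by apply: near_eq_is_derive near_v _; exact: is_derive_cst.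
    have c0 : {for x, continuous (fun=> 0 : R)} by exact: cst_continuous.
    have : v @ x --> (0 : R) by exact: cvg_trans (near_eq_cvg near_v) c0.
    by rewrite -[X in _ --> X]vx.
  have [cu du] := ru x Omx; have ux : u x = 0 := u0 s.
  have vu y : `|v y| <= `|u y| by rewrite /v; case: ifP => // _; rewrite normr0.
  split=> [|i].
    apply/continuous_epsP => e e0; have /continuous_epsP /(_ e e0)[d [d0 Hd]] := cu.
    exists d; split=> // y /Hd; rewrite ux vx !sub0r !normrN; exact: le_trans.
  have /is_derive_epsP H := derivableP (du i); apply/is_derive_epsP => e e0.
  have [d [d0 Hd]] := H e e0; exists d; split=> // h hd.
  have := Hd h hd; rewrite (_ : 'D__ u x = 0); last exact: (u0 (i :: s)).
  by rewrite vx ux !subr0 mulr0 !subr0; exact: le_trans.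
have all s : forall x, Om x -> pderivs s G x = if `[< A x >] then pderivs s g x else 0.
  by elim: s => [|i s IH] //; have [_] := step s IH; apply.
by split=> //; apply/smoothP => s; have [] := step s (all s).
Qed.

(** Two applications of the mean value theorem write the second difference [del] as [h^2] times a
    mixed derivative at a point near [x], in either order. As [del] is symmetric, continuity of the
    mixed derivatives concludes. *)
Lemma axis_schwarz Om g i j x : open Om -> smooth_on Om g -> Om x ->
  pderiv i (pderiv j g) x = pderiv j (pderiv i g) x.
Proof.
move=> oOm sg Omx; have [r [r0 sub]] := open_ball_sub oOm Omx.
have rg := smooth_regular sg.
have rg' (k : 'I_n) := smooth_regular (smooth_pderivs [:: k] sg).
pose del h k l := g (x + h *: ax R k + h *: ax R l) - g (x + h *: ax R k) - g (x + h *: ax R l) + g x.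
have in_ball (a b h : R) k l : 0 <= a <= 1 -> 0 <= b <= 1 -> 0 < h -> h < r / 2 ->
    ball x r (x + a *: (h *: ax R k) + b *: (h *: ax R l)) /\
    `|x - (x + a *: (h *: ax R k) + b *: (h *: ax R l))| <= 2 * h.
  move=> /andP[a0 a1] /andP[b0 b1] h0 hr.
  have N : `|x - (x + a *: (h *: ax R k) + b *: (h *: ax R l))| <= 2 * h.
    rewrite -addrA opprD addNKr normrN; apply: le_trans (ler_normD _ _) _.
    rewrite !normrZ !(ger0_norm a0) !(ger0_norm b0) !(gtr0_norm h0).
    rewrite mulrDl mul1r; apply: lerD.
      by rewrite mulrCA ler_piMr ?(ltW h0) // mulr_ile1 // norm_ax_le.
    by rewrite mulrCA ler_piMr ?(ltW h0) // mulr_ile1 // norm_ax_le.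
  split=> //; rewrite -ball_normE /ball_ /=; apply: le_lt_trans N _.
  by rewrite mulrC -ltr_pdivlMr.
have key k l h : 0 < h -> h < r / 2 -> exists a b : R, [/\ 0 <= a <= 1, 0 <= b <= 1 &
    del h k l = h * (h * pderiv l (pderiv k g) (x + a *: (h *: ax R k) + b *: (h *: ax R l)))].
  move=> h0 hr; pose u y := g (y + h *: ax R l) - g y.
  pose Om' : set 'rV[R]_n := [set y | Om y /\ Om (y + h *: ax R l)].
  have du y m : Om' y -> is_derive y (ax R m) u (pderiv m g (y + h *: ax R l) - pderiv m g y).
    move=> [Omy Omy']; apply: is_deriveB.
      by apply: is_derive_transl; exact: smooth_is_derive sg Omy'.
    exact: smooth_is_derive sg Omy.
  have seg : axis_segment Om' x k h.
    move=> a a01; split.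
      have [] := in_ball a 0 h k l a01 _ h0 hr; first by rewrite lexx ler01.
      by rewrite scale0r addr0 => + _; exact: sub.
    have [] := in_ball a 1 h k l a01 _ h0 hr; first by rewrite lexx ler01.
    by rewrite scale1r => + _; exact: sub.
  have [a [a01 Ea]] : exists a : R, 0 <= a <= 1 /\ u (x + h *: ax R k) - u x =
      h * pderiv k u (x + a *: (h *: ax R k)).
    have [//|||c] := @MVT_segment R (fun t : R => u (x + t *: (h *: ax R k)))
      (fun t => h * pderiv k u (x + t *: (h *: ax R k))) 0 1.
    - move=> t; rewrite in_itv /= => /andP[t0 t1]; apply: is_derive_segment.
      by have [] := du _ k (seg t _) => //; rewrite !ltW.
    - apply: derivable_within_continuous => t; rewrite in_itv /= => /seg /(du _ k) [d _].
      by have [] := is_derive_segment d.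
    - rewrite in_itv /= => c01; rewrite scale1r scale0r addr0 subr0 mulr1 => E.
      by exists c.
  have E : pderiv k u (x + a *: (h *: ax R k)) =
     pderiv k g (x + a *: (h *: ax R k) + h *: ax R l) - pderiv k g (x + a *: (h *: ax R k)).
    by have [_] := du _ k (seg a a01).
  have seg2 : axis_segment Om (x + a *: (h *: ax R k)) l h.
    by move=> b b01; have [+ _] := in_ball a b h k l a01 b01 h0 hr; exact: sub.
  have [b [b01 Eb]] := axis_mvt (rg' k) seg2.
  exists a, b; split=> //.
  rewrite -[pderiv k g]/(pderivs [:: k] g) in E *.
  rewrite -Eb -[pderivs _ _]/(pderiv k g) -E -Ea /del /u; ring.
apply/eqP; rewrite -subr_eq0 -normr_le0; apply/ler_addgt0Pr => e e0; rewrite add0r.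
have cont (k l : 'I_n) : exists d, 0 < d /\ forall y, `|x - y| < d ->
    `|pderiv l (pderiv k g) x - pderiv l (pderiv k g) y| <= e / 2.
  have [cg _] := smooth_regular (smooth_pderivs [:: l; k] sg) Omx.
  by have /continuous_epsP := cg; apply; rewrite divr_gt0.
have [d1 [d10 H1]] := cont i j; have [d2 [d20 H2]] := cont j i.
pose h := Num.min (r / 4) (Num.min (d1 / 4) (d2 / 4)).
have h0 : 0 < h by rewrite !lt_min !divr_gt0.
have hr : h < r / 2.
  by apply: le_lt_trans (_ : r / 4 < _); [rewrite ge_min lexx|lra].
have hd1 : 2 * h < d1.
  by have : h <= d1 / 4; [rewrite !ge_min lexx /= orbT|lra].
have hd2 : 2 * h < d2.
  by have : h <= d2 / 4; [rewrite !ge_min lexx /= !orbT|lra].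
have [a [b [a01 b01 E1]]] := key i j h h0 hr.
have [a' [b' [a01' b01' E2]]] := key j i h h0 hr.
have [_ n1] := in_ball a b h i j a01 b01 h0 hr.
have [_ n2] := in_ball a' b' h j i a01' b01' h0 hr.
have {}H1 := H1 _ (le_lt_trans n1 hd1); have {}H2 := H2 _ (le_lt_trans n2 hd2).
have : del h i j = del h j i.
  by rewrite /del [x + h *: ax R i + _]addrAC; ring.
rewrite E1 E2 => /(mulfI (lt0r_neq0 h0)) /(mulfI (lt0r_neq0 h0)) E.
apply: le_trans (ler_distD _ _ _) _; rewrite [leRHS]splitr; apply: lerD; first exact: H2.
rewrite -E distrC; exact: H1.
Qed.

(** The classes are defined by multi-indices, that is by words in a fixed order, whereas the
    estimates run over all words; this connects the two. *)
Lemma pderivs_perm Om g s t : open Om -> smooth_on Om g -> perm_eq s t ->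
  forall x, Om x -> pderivs s g x = pderivs t g x.
Proof.
move=> oOm sg.
have swap i (u v : seq 'I_n) x : Om x -> pderivs (i :: u ++ v) g x = pderivs (u ++ i :: v) g x.
  elim: u x => [|j u IH] x Omx //=.
  rewrite (axis_schwarz i j oOm (smooth_pderivs (u ++ v) sg) Omx).
  exact: (pderiv_congr j oOm IH Omx).
elim: s t => [|i s IH] t st x Omx; first by rewrite perm_sym in st; rewrite (perm_nilP st).
have it : i \in t by rewrite -(perm_mem st) mem_head.
have [u [v tE]] : exists u v, t = u ++ i :: v by case/splitPr: it => u v; exists u, v.
rewrite tE -swap //=; apply: (pderiv_congr i oOm _ Omx) => y Omy; apply: IH => //.
rewrite -(perm_cons i) (perm_trans st) // tE perm_catC /= perm_cons.
by rewrite perm_catC.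
Qed.

End Limits.

(** * Geometric bounds on derivatives *)

Section GeometricJets.
Variables (R : realType) (n : nat) (Om : set 'rV[R]_n).
Hypothesis oOm : open Om.
Implicit Types (x : 'rV[R]_n) (f g u : 'rV[R]_n -> R) (c mu K : R) (s t : seq 'I_n).

(** Cauchy estimates at the single point [x], for a function analytic at scale [1 / mu] there.
    Products, inverses and exponentials keep this form with explicit constants. *)
Definition geo f x c mu :=
  forall s, `|pderivs s f x| <= (size s)`!%:R * (c * mu ^+ size s).

Lemma geo_ge0 f x c mu : geo f x c mu -> 0 <= c.
Proof.
by move=> /(_ [::]) /=; rewrite fact0 expr0 mulr1 mul1r; apply: le_trans.
Qed.

Lemma geo_le f x c mu c' mu' : 0 <= mu -> c <= c' -> mu <= mu' ->
  geo f x c mu -> geo f x c' mu'.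
Proof.
move=> mu0 cc mm H s; apply: le_trans (H s) _; rewrite ler_wpM2l //.
have c0 := geo_ge0 H.
by apply: ler_pM => //; rewrite ?exprn_ge0 // lerXn2r // nnegrE // (le_trans mu0).
Qed.

Lemma geo_congr f g x c mu : (forall y, Om y -> f y = g y) -> Om x ->
  geo f x c mu -> geo g x c mu.
Proof. by move=> fg Omx H s; rewrite -(pderivs_congr s oOm fg). Qed.

Lemma geo_cst c0 x c mu : Om x -> `|c0| <= c -> 0 <= mu -> geo (fun=> c0) x c mu.
Proof.
move=> Omx c0c mu0 s; have c_ge0 : 0 <= c by exact: le_trans c0c.
case: s => [|i s]; first by rewrite /= fact0 expr0 mulr1 mul1r.
by rewrite (pderivs_cst (s := i :: s) _ oOm) // normr0 mulr_ge0 // mulr_ge0 // exprn_ge0.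
Qed.

Lemma leqSexp2 m : (m.+1 <= 2 ^ m)%N.
Proof. exact: ltn_expl. Qed.

Lemma natrS_le_exp2 m : m.+1%:R <= 2 ^+ m :> R.
Proof. by rewrite -natrX ler_nat leqSexp2. Qed.

(** All [m + 1] Leibniz terms have the same bound [m! c c' mu^m], and [m + 1 <= 2^m] converts their
    number into the doubling of [mu]. *)
Lemma geoM f g x c c' mu : smooth_on Om f -> smooth_on Om g -> Om x -> 0 <= mu ->
  geo f x c mu -> geo g x c' mu -> geo (fun y => f y * g y) x (c * c') (2 * mu).
Proof.
move=> sf sg Omx mu0 Hf Hg s; set m := size s.
have c0 := geo_ge0 Hf; have c0' := geo_ge0 Hg.
apply: le_trans (leibniz_bound (b := fun k => k`!%:R * (c * mu ^+ k))
  (c := fun k => k`!%:R * (c' * mu ^+ k)) oOm sf sg Omx (fun t _ => Hf t) (fun t _ => Hg t)) _.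
rewrite -/m (eq_bigr (fun=> m`!%:R * (c * c' * mu ^+ m))) => [|k _].
  rewrite sumr_const card_ord -[leLHS]mulr_natr.
  rewrite (_ : _ *  m.+1%:R = m`!%:R * (c * c' * (m.+1%:R * mu ^+ m))); last by ring.
  rewrite exprMn ler_wpM2l // ler_wpM2l ?mulr_ge0 //.
  by rewrite ler_wpM2r ?exprn_ge0 // natrS_le_exp2.
have km : (k <= m)%N by rewrite -ltnS.
have -> : mu ^+ m = mu ^+ k * mu ^+ (m - k)%N by rewrite -exprD subnKC.
by rewrite -(bin_fact km) !natrM; ring.
Qed.

Lemma geoD f g x c c' mu : smooth_on Om f -> smooth_on Om g -> Om x ->
  geo f x c mu -> geo g x c' mu -> geo (fun y => f y + g y) x (c + c') mu.
Proof.
move=> sf sg Omx Hf Hg s; rewrite (pderivsD s oOm) //.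
apply: le_trans (ler_normD _ _) _; rewrite mulrDl mulrDr; exact: lerD.
Qed.

Lemma geo_sum I (r : seq I) (F : I -> 'rV[R]_n -> R) x (c : I -> R) mu : Om x ->
  (forall k, smooth_on Om (F k)) -> (forall k, geo (F k) x (c k) mu) ->
  geo (fun y => \sum_(k <- r) F k y) x (\sum_(k <- r) c k) mu.
Proof.
move=> Omx sF HF s; rewrite (pderivs_sum r s oOm (fun k _ => sF k) Omx).
apply: le_trans (ler_norm_sum _ _ _) _; rewrite mulr_suml mulr_sumr.
by apply: ler_sum => k _; exact: HF.
Qed.

Lemma geoZ a f x c mu : smooth_on Om f -> Om x ->
  geo f x c mu -> geo (fun y => a * f y) x (`|a| * c) mu.
Proof.
move=> sf Omx H s; rewrite (pderivsZ a s oOm sf Omx) normrM.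
rewrite (_ : _`!%:R * _ = `|a| * ((size s)`!%:R * (c * mu ^+ size s))); last by ring.
by rewrite ler_wpM2l.
Qed.

Lemma geoX f x c mu q : smooth_on Om f -> Om x -> 0 <= mu ->
  geo f x c mu -> geo (fun y => f y ^+ q) x (c ^+ q) (2 ^+ q * mu).
Proof.
move=> sf Omx mu0 Hf; elim: q => [|q IH].
  apply: (@geo_congr (fun=> 1) _ _ _ _ _ Omx); first by move=> y _; rewrite expr0.
  by rewrite !expr0; apply: geo_cst; rewrite ?normr1 ?mul1r.
apply: (@geo_congr (fun y => f y * f y ^+ q) _ _ _ _ _ Omx).
  by move=> y _; rewrite exprS.
rewrite !exprS -mulrA; apply: (geoM sf (smoothX q oOm sf) Omx _ _ IH).
  by rewrite mulr_ge0 // exprn_ge0.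
apply: (geo_le mu0 (lexx _) _ Hf).
by rewrite ler_peMl // exprn_ege1 // ler1n.
Qed.

(* Subtracting the constant [f x] removes the term containing the highest
   derivative of [g]. *)
Lemma leibniz_tail_bound f g s x (b c : nat -> R) :
  smooth_on Om f -> smooth_on Om g -> Om x ->
  (forall t, (0 < size t <= size s)%N -> `|pderivs t f x| <= b (size t)) ->
  (forall t, (size t < size s)%N -> `|pderivs t g x| <= c (size t)) ->
  `|pderivs s (fun y => f y * g y) x - f x * pderivs s g x| <=
    \sum_(k < size s) 'C(size s, k.+1)%:R * b k.+1 * c (size s - k.+1)%N.
Proof.
move=> sf sg Omx Hb Hc; set m := size s.
pose f' y := f y + - f x.
have sf' : smooth_on Om f' := smoothD oOm sf (smooth_cst (- f x) oOm).
have -> : pderivs s (fun y => f y * g y) x - f x * pderivs s g x =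
    pderivs s (fun y => f' y * g y) x.
  rewrite -(pderivsZ (f x) s oOm sg Omx).
  rewrite -(pderivsB s oOm (smoothM oOm sf sg) (smoothM oOm (smooth_cst (f x) oOm) sg) Omx).
  by apply: (pderivs_congr s oOm) Omx => y _; rewrite /f' mulrBl.
pose b' k := if k is 0%N then 0 else b k.
(* A crude bound for the top derivatives of [g], about which nothing is assumed; it only meets the
   coefficient [b' 0 = 0]. *)
pose top := \sum_(t : m.-tuple 'I_n) `|pderivs t g x|.
pose c' k := if (k < m)%N then c k else top.
have Hb' t : (size t <= m)%N -> `|pderivs t f' x| <= b' (size t).
  case: t => [|i t] ht; first by rewrite /= /f' subrr normr0.
  rewrite (pderivsD (i :: t) oOm sf (smooth_cst (- f x) oOm) Omx).
  by rewrite (pderivs_cst (s := i :: t) _ oOm) // addr0; exact: Hb.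
have Hc' t : (size t <= m)%N -> `|pderivs t g x| <= c' (size t).
  rewrite leq_eqVlt /c' => /orP[/eqP tm|tm]; last by rewrite tm; exact: Hc.
  have tm' : size t == m by rewrite tm.
  rewrite tm ltnn /top (bigD1 (Tuple tm')) //= lerDl sumr_ge0 // => ? _; exact: normr_ge0.
apply: le_trans (leibniz_bound oOm sf' sg Omx Hb' Hc') _.
rewrite big_ord_recl /= mulr0 mul0r add0r -/m; apply: ler_sum => k _.
rewrite /bump /= add1n /c' ltn_subrL.
by rewrite (leq_ltn_trans (leq0n k) (ltn_ord k)).
Qed.

Lemma leibniz_flat f g s x : smooth_on Om f -> smooth_on Om g -> Om x ->
  (forall t, pderivs t f x = 0) -> pderivs s (fun y => f y * g y) x = 0.
Proof.
move=> sf sg Omx f0; apply/eqP; rewrite -normr_le0.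
(* Any finite bound on the derivatives of [g] will do, since it gets multiplied by zero. *)
pose c (k : nat) := \sum_(j < (size s).+1) \sum_(t : j.-tuple 'I_n) `|pderivs t g x|.
have Hf t : (size t <= size s)%N -> `|pderivs t f x| <= (fun=> 0) (size t).
  by rewrite f0 normr0.
have Hg t : (size t <= size s)%N -> `|pderivs t g x| <= c (size t).
  move=> tm; have tm' : (size t < (size s).+1)%N by [].
  rewrite /c (bigD1 (Ordinal tm')) //= (bigD1 (in_tuple t)) //= -addrA lerDl addr_ge0 //.
    by apply: sumr_ge0 => ? _; exact: normr_ge0.
  by apply: sumr_ge0 => ? _; apply: sumr_ge0 => ? _; exact: normr_ge0.
apply: le_trans (leibniz_bound (b := fun=> 0) (c := c) oOm sf sg Omx Hf Hg) _.
by rewrite big1 // => j _; rewrite /= mulr0 mul0r.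
Qed.

(** Differentiating [u v = 1] expresses a derivative of [v] by those of lower order. The bounds on
    [u] are relative to its value [u x], which cancels, and the induction closes because
    [2^0 + ... + 2^(N-1) <= 2^N]. *)
Lemma geoV u x mu : smooth_on Om u -> (forall y, Om y -> u y != 0) -> Om x -> 0 < u x ->
  0 <= mu -> geo u x (u x) mu -> geo (fun y => (u y)^-1) x (u x)^-1 (2 * mu).
Proof.
move=> su u0 Omx ux mu0 Hu s; set v := fun y => (u y)^-1.
have sv : smooth_on Om v by exact: smoothV.
have v0 : 0 <= (u x)^-1 by rewrite invr_ge0 ltW.
have [m] := ubnP (size s); elim: m s => // m IH s; rewrite ltnS => sm.
case: s sm => [|i s]; first by rewrite /= fact0 expr0 mul1r mulr1 /v ger0_norm.
set s' := i :: s; move=> sm.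
have E : pderivs s' (fun y => u y * v y) x = 0.
  rewrite (pderivs_congr (g := fun=> 1) s' oOm _ Omx); first exact: (pderivs_cst _ oOm).
  by move=> y Omy; rewrite /v divff // u0.
have := leibniz_tail_bound (s := s') (b := fun k => k`!%:R * (u x * mu ^+ k))
  (c := fun k => k`!%:R * ((u x)^-1 * (2 * mu) ^+ k)) su sv Omx (fun t _ => Hu t).
rewrite E sub0r normrN normrM (gtr0_norm ux) => /(_ _)H.
have {}H : u x * `|pderivs s' v x| <=
  \sum_(k < size s') 'C(size s', k.+1)%:R * (k.+1`!%:R * (u x * mu ^+ k.+1)) *
    ((size s' - k.+1)%N`!%:R * ((u x)^-1 * (2 * mu) ^+ (size s' - k.+1)%N)).
  by apply: H => t ts; apply: IH; exact: leq_trans ts sm.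
rewrite -(ler_pM2l ux); apply: le_trans H _; set N := size s'.
have -> : u x * (N`!%:R * ((u x)^-1 * (2 * mu) ^+ N)) = N`!%:R * (2 * mu) ^+ N.
  by rewrite mulrCA mulVKf // gt_eqF.
have -> : \sum_(k < N) 'C(N, k.+1)%:R * (k.+1`!%:R * (u x * mu ^+ k.+1)) *
    ((N - k.+1)%N`!%:R * ((u x)^-1 * (2 * mu) ^+ (N - k.+1)%N)) =
  \sum_(k < N) N`!%:R * mu ^+ N * 2 ^+ (N - k.+1)%N.
  apply: eq_bigr => k _; have kN := ltn_ord k.
  have -> : mu ^+ N = mu ^+ k.+1 * mu ^+ (N - k.+1)%N by rewrite -exprD subnKC.
  rewrite -(bin_fact kN) !natrM exprMn.
  by field; rewrite gt_eqF.
rewrite -mulr_sumr -mulrA ler_wpM2l // exprMn [leRHS]mulrC ler_wpM2l ?exprn_ge0 //.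
elim: N => [|N IHN]; first by rewrite big_ord0 expr0 ler01.
rewrite big_ord_recl subSS subn0 exprS.
rewrite (eq_bigr (fun k : 'I_N => 2 ^+ (N - k.+1)%N)) => [|k _].
  by move: IHN; set S := \sum_(k < N) _ => IHN; lra.
by rewrite /bump /= ?add1n ?subSS.
Qed.

(* [expg K] are the Taylor coefficients of [(1 - t)^(-K)], the solution of
   [G' = K G / (1 - t)], and [expS K] their partial sums. *)
Fixpoint expS K j : R := if j is j'.+1 then expS K j' * (1 + K / j'.+1%:R) else 1.

Definition expg K j : R := if j is j'.+1 then K * expS K j' / j'.+1%:R else 1.

Lemma expS_ge0 K j : 0 <= K -> 0 <= expS K j.
Proof.
move=> K0; elim: j => //= j IH; rewrite mulr_ge0 // addr_ge0 // divr_ge0 //.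
Qed.

Lemma expg_ge0 K j : 0 <= K -> 0 <= expg K j.
Proof.
by move=> K0; case: j => //= j; rewrite divr_ge0 // mulr_ge0 // expS_ge0.
Qed.

Lemma expS_sum K j : expS K j = \sum_(i < j.+1) expg K i.
Proof.
elim: j => [|j IH]; first by rewrite big_ord_recr big_ord0 /= add0r.
by rewrite big_ord_recr -IH /= mulrDr mulr1 mulrA [expS K j * K]mulrC.
Qed.

Lemma expg_le K j : 0 <= K -> expg K j <= expS K j.
Proof.
move=> K0; rewrite expS_sum big_ord_recr /= lerDr sumr_ge0 // => i _; exact: expg_ge0.
Qed.

Lemma powfact_le_expR (y : R) l : 0 <= y -> y ^+ l / l`!%:R <= expR y.
Proof.
case: l => [|l] y0; first by rewrite fact0 expr0 divr1; have := expR_ge1Dx y; lra.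
by have := expR_ge1Dxn l y0; lra.
Qed.

(** With [y = K / 2], a factor [1 + K / (j+1)] is at most [3] once [j + 1 >= y]; the earlier ones
    are at most [3 y / (l+1)] and build up a term [y^l / l!] of the exponential series. The exponent
    [K / 2] is what leaves [exp(-P/2)] in [geo_expRN]. *)
Lemma expS_le K j : 0 <= K -> expS K j <= expR (K / 2) * 3 ^+ j.
Proof.
move=> K0; set y := K / 2; have y0 : 0 <= y by rewrite divr_ge0.
suff [l [lj H]] : exists l, (l <= j)%N /\ expS K j <= y ^+ l / l`!%:R * 3 ^+ j.
  apply: le_trans H _; rewrite ler_wpM2r ?exprn_ge0 //; exact: powfact_le_expR.
elim: j => [|j [l [lj IH]]] /=.
  by exists 0%N; rewrite fact0 expr0 divr1 mul1r expr0.
have j0 : 0 < j.+1%:R :> R by rewrite ltr0Sn.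
have KE : K = 2 * y by rewrite /y mulrC divfK.
have [yj|jy] := leP y j.+1%:R.
  exists l; split; first exact: leqW.
  rewrite exprSr mulrA; apply: ler_pM => //; first exact: expS_ge0.
    by rewrite addr_ge0 // divr_ge0.
  have : K / j.+1%:R <= 2 by rewrite ler_pdivrMr // KE ler_pM2l.
  by move: (K / _) => z; lra.
exists l.+1; split=> //.
have -> : y ^+ l.+1 / l.+1`!%:R * 3 ^+ j.+1 = y ^+ l / l`!%:R * 3 ^+ j * (3 * (y / l.+1%:R)).
  by rewrite factS natrM !exprS invfM; ring.
apply: ler_pM => //; first exact: expS_ge0.
  by rewrite addr_ge0 // divr_ge0.
have H1 : 1 <= y / j.+1%:R by rewrite ler_pdivlMr // mul1r ltW.
have H2 : y / j.+1%:R <= y / l.+1%:R.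
  by rewrite ler_wpM2l // lef_pV2 ?posrE ?ltr0Sn // ler_nat.
have -> : K / j.+1%:R = 2 * (y / j.+1%:R) by rewrite KE; ring.
by move: (y / _) (y / _) H1 H2 => z z'; lra.
Qed.

(** A majorant argument on [(exp P)' = P' exp P]: the recursion is that of the coefficients
    [expg K], and doubling [mu] pays for the factor [k + 1] coming from [P']. Only derivatives of
    positive order are compared with [K], so that [-P] may be treated with [K = P x]. *)
Lemma geo_expR (P : 'rV[R]_n -> R) x K mu : smooth_on Om P -> Om x -> 0 <= K -> 0 <= mu ->
  (forall s, (0 < size s)%N -> `|pderivs s P x| <= (size s)`!%:R * (K * mu ^+ size s)) ->
  geo (fun y => expR (P y)) x (expR (P x + K / 2)) (6 * mu).
Proof.
move=> sP Omx K0 mu0 HP.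
have sE : smooth_on Om (fun y => expR (P y)) by exact: smooth_expR.
have H s : `|pderivs s (fun y => expR (P y)) x| <=
    (size s)`!%:R * (expR (P x) * (2 * mu) ^+ size s * expg K (size s)).
  have [m] := ubnP (size s); elim: m s => // m IH s; rewrite ltnS.
  case: (lastP s) => [_|t i]; first by rewrite /= fact0 expr0 !mulr1 mul1r ger0_norm ?expR_ge0.
  rewrite size_rcons => tm; rewrite pderivs_rcons.
  rewrite (pderivs_congr (g := fun y => pderiv i P y * expR (P y)) t oOm _ Omx); last first.
    by move=> y Omy; rewrite (pderiv_expR i (smooth_regular sP) Omy).
  apply: le_trans (leibniz_bound (b := fun k => k.+1`!%:R * (K * mu ^+ k.+1))
    (c := fun k => k`!%:R * (expR (P x) * (2 * mu) ^+ k * expg K k)) oOm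
    (smooth_pderivs [:: i] sP) sE Omx _ _) _.
  - move=> t' _; rewrite -[pderivs [:: i] P]/(pderiv i P) -pderivs_rcons.
    by have := HP (rcons t' i); rewrite size_rcons; apply.
  - by move=> t' t't; apply: IH; exact: leq_ltn_trans t't tm.
  set N := size t.
  have -> : N.+1`!%:R * (expR (P x) * (2 * mu) ^+ N.+1 * expg K N.+1) =
      \sum_(k < N.+1) N`!%:R * K * expR (P x) * (2 * mu) ^+ N.+1 * expg K (N - k)%N.
    rewrite -mulr_sumr (reindex_inj rev_ord_inj) /=.
    rewrite (eq_bigr (fun i : 'I_N.+1 => expg K i)) => [|k _].
      by rewrite -expS_sum factS natrM; field; rewrite addrC natr1 pnatr_eq0.
    by rewrite subSS subKn // -ltnS.
  apply: ler_sum => k _; have kN : (k <= N)%N by rewrite -ltnS.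
  have -> : 'C(N, k)%:R * (k.+1`!%:R * (K * mu ^+ k.+1)) *
     ((N - k)%N`!%:R * (expR (P x) * (2 * mu) ^+ (N - k)%N * expg K (N - k)%N)) =
     N`!%:R * K * expR (P x) * ((k.+1%:R * mu ^+ k.+1) * (2 * mu) ^+ (N - k)%N) *
       expg K (N - k)%N.
    rewrite factS natrM.
    have -> : N`!%:R = 'C(N, k)%:R * (k`!%:R * (N - k)%N`!%:R) :> R by rewrite -!natrM bin_fact.
    ring.
  rewrite ler_wpM2r ?expg_ge0 // ler_wpM2l ?mulr_ge0 ?expR_ge0 //.
  have -> : (2 * mu) ^+ N.+1 = (2 * mu) ^+ k.+1 * (2 * mu) ^+ (N - k)%N.
    by rewrite -exprD addSn subnKC.
  rewrite ler_wpM2r ?exprn_ge0 ?mulr_ge0 //.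
  rewrite exprMn ler_wpM2r ?exprn_ge0 //; apply: le_trans (natrS_le_exp2 k) _.
  by rewrite ler_weXn2l // ler1n.
move=> s; apply: le_trans (H s) _; rewrite ler_wpM2l // expRD.
rewrite (_ : 6 * mu = (2 * mu) * 3); last by ring.
rewrite [leRHS](_ : _ = expR (P x) * (2 * mu) ^+ size s * (expR (K / 2) * 3 ^+ size s));
  last by rewrite [in LHS]exprMn; ring.
rewrite ler_wpM2l ?mulr_ge0 ?expR_ge0 ?exprn_ge0 ?mulr_ge0 //.
exact: le_trans (expg_le _ K0) (expS_le _ K0).
Qed.

Lemma geo_expRN (P : 'rV[R]_n -> R) x mu : smooth_on Om P -> Om x -> 0 <= mu ->
  geo P x (P x) mu -> geo (fun y => expR (- P y)) x (expR (- (P x / 2))) (6 * mu).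
Proof.
move=> sP Omx mu0 HP; have P0 := geo_ge0 HP.
have := @geo_expR (fun y => - P y) x (P x) mu (smoothN oOm sP) Omx P0 mu0.
rewrite (_ : - P x + P x / 2 = - (P x / 2)); last by field.
apply=> s _; rewrite (pderivsN s oOm sP Omx) normrN; exact: HP.
Qed.

Lemma expRB1_le (y : R) : 0 <= y -> expR y - 1 <= y * expR y.
Proof.
move=> y0; have := expR_ge1Dx (- y); rewrite expRN.
have e0 := expR_gt0 y; rewrite -(ler_pM2r e0) mulVf ?gt_eqF //; lra.
Qed.

(** The factor [P x] kept in front is what later makes differences of the functions [exp(P_k)] as
    small as the tail of the weight. *)
Lemma geo_expRB1 (P : 'rV[R]_n -> R) x mu : smooth_on Om P -> Om x -> 0 <= mu ->
  geo P x (P x) mu ->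
  geo (fun y => expR (P y) - 1) x (P x * expR (P x + P x / 2)) (12 * mu).
Proof.
move=> sP Omx mu0 HP; have P0 := geo_ge0 HP.
have sE : smooth_on Om (fun y => expR (P y)) by exact: smooth_expR.
have s1 : smooth_on Om (fun=> 1 : R) by exact: smooth_cst.
case/lastP => [|t i].
  rewrite /= fact0 expr0 mul1r mulr1 ger0_norm; last first.
    by rewrite subr_ge0 -[X in X <= _]expR0 ler_expR.
  apply: le_trans (expRB1_le P0) _; rewrite ler_wpM2l // ler_expR; lra.
rewrite pderivs_rcons size_rcons.
rewrite (pderivs_congr (g := fun y => pderiv i P y * expR (P y)) t oOm _ Omx); last first.
  move=> y Omy; have := pderivsB [:: i] oOm sE s1 Omy; rewrite /= => ->.
  by rewrite pderiv_cst subr0 (pderiv_expR i (smooth_regular sP) Omy).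
have G1 : geo (pderiv i P) x (2 * mu * P x) (6 * mu).
  move=> s; rewrite -pderivs_rcons; apply: le_trans (HP _) _.
  rewrite size_rcons factS natrM; set N := size s.
  rewrite [leLHS](_ : _ = N`!%:R * (P x * mu * (mu ^+ N * N.+1%:R))); last by rewrite exprS; ring.
  rewrite [leRHS](_ : _ = N`!%:R * (P x * mu * (mu ^+ N * (2 * 6 ^+ N))));
    last by rewrite exprMn; ring.
  rewrite ler_wpM2l // ler_wpM2l ?mulr_ge0 // ler_wpM2l ?exprn_ge0 //.
  apply: le_trans (natrS_le_exp2 _) _; apply: le_trans (_ : 6 ^+ N <= _).
    by rewrite lerXn2r ?nnegrE // ler_nat.
  by rewrite ler_peMl ?exprn_ge0 // ler1n.
have G2 : geo (fun y => expR (P y)) x (expR (P x + P x / 2)) (6 * mu).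
  by apply: geo_expR.
have mu6 : 0 <= 6 * mu by rewrite mulr_ge0.
apply: le_trans (geoM (smooth_pderivs [:: i] sP) sE Omx mu6 G1 G2 t) _.
rewrite (_ : 2 * (6 * mu) = 12 * mu); last by ring.
apply: ler_pM => //; first by rewrite !mulr_ge0 ?exprn_ge0 ?expR_ge0 ?mulr_ge0.
  by rewrite ler_nat leq_fact.
rewrite exprS (_ : 2 * mu * P x * _ * _ = P x * expR (P x + P x / 2) * (2 * mu * (12 * mu) ^+ size t));
  last by ring.
rewrite ler_wpM2l ?mulr_ge0 ?expR_ge0 // ler_wpM2r ?exprn_ge0 ?mulr_ge0 //.
by rewrite ler_wpM2r // ler_nat.
Qed.

End GeometricJets.

(** * Strongly regular sequences *)

Section StronglyRegularSequences.
Variables (R : realType) (M : nat -> R) (A : R).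
Hypotheses (A0 : 0 < A) (M0 : M 0%N = 1) (Mmono : forall j, M j <= M j.+1).
Hypothesis Mconv : forall j, M j.+1 / M j <= M j.+2 / M j.+1.
Hypothesis Mgrow : forall j k, M (j + k)%N <= A ^+ (j + k) * M j * M k.
Hypothesis Msum : forall l, (\sum_(l <= j <oo) (M j / (j.+1%:R * M j.+1))%:E
  <= (A * (M l / M l.+1))%:E)%E.

(** Reciprocals of the quotients in the convexity condition: a non-increasing sequence in [(0, 1]],
    with [M_j] the product of the [1 / a_i], [i < j]. *)
Definition qt (M : nat -> R) j := M j / M j.+1.
Local Notation a := (qt M).

Lemma M_ge1 j : 1 <= M j.
Proof. by elim: j => [|j IH]; [rewrite M0|exact: le_trans (Mmono j)]. Qed.

Lemma M_gt0 j : 0 < M j.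
Proof. exact: lt_le_trans (M_ge1 j). Qed.

Lemma qt_gt0 j : 0 < a j.
Proof. by rewrite divr_gt0 // M_gt0. Qed.

Lemma qt_le1 j : a j <= 1.
Proof. by rewrite ler_pdivrMr ?M_gt0 // mul1r Mmono. Qed.

Lemma qtS j : a j.+1 <= a j.
Proof.
rewrite -(invrK (a j.+1)) -(invrK (a j)) lef_pV2 ?posrE ?invr_gt0 ?qt_gt0 //.
by rewrite /qt !invf_div.
Qed.

Lemma qt_noninc j k : (j <= k)%N -> a k <= a j.
Proof.
elim: k => [|k IH]; first by rewrite leqn0 => /eqP ->.
by rewrite leq_eqVlt => /orP[/eqP->//|jk]; exact: le_trans (qtS k) (IH jk).
Qed.

Lemma MSqt j : M j.+1 = M j / a j.
Proof. by rewrite /qt invf_div mulrCA divff ?mulr1 // gt_eqF // M_gt0. Qed.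

(** Shifting the indices by [i] can only increase the factors [1 / a_k] whose product is [M j]. *)
Lemma M_supermul i j : M i * M j <= M (i + j)%N.
Proof.
elim: j => [|j IH]; first by rewrite M0 mulr1 addn0.
rewrite addnS !MSqt mulrA; apply: ler_pM => //.
- by rewrite mulr_ge0 // ltW // M_gt0.
- by rewrite invr_ge0 ltW // qt_gt0.
by rewrite lef_pV2 ?posrE ?qt_gt0 //; exact: qt_noninc (leq_addl _ _).
Qed.

Lemma qt_sum_le l N : \sum_(l <= j < N) a j / j.+1%:R <= A * a l.
Proof.
rewrite -lee_fin -sumEFin; apply: le_trans (Msum l).
rewrite (eq_bigr (fun j => (M j / (j.+1%:R * M j.+1))%:E)) => [|j _]; last first.
  by rewrite /qt -mulrA -invfM [_ * M _]mulrC.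
apply: (@nneseries_lim_ge _ _ xpredT) => j _ _.
by rewrite lee_fin divr_ge0 ?mulr_ge0 // ltW // M_gt0.
Qed.

(** On each dyadic block the sum of [a_j / (j+1)] is at least half the quotient at the right end.
    The sum over all blocks is at most [A a_l], so with [Q >= 4 A] blocks the last quotient is at
    most [a_l / 2]. *)
Lemma qt_halves : exists Q, (0 < Q)%N /\ forall l, a (2 ^ Q * l.+1)%N <= a l / 2.
Proof.
have block N l : N%:R / 2 * a (2 ^ N * l.+1)%N <=
    \sum_(l.+1 <= j < 2 ^ N * l.+1) a j / j.+1%:R.
  elim: N => [|N IH]; first by rewrite mul0r mul0r expn0 mul1n big_geq.
  have le1 : (l.+1 <= 2 ^ N * l.+1)%N by rewrite leq_pmull // expn_gt0.
  have le2 : (2 ^ N * l.+1 <= 2 ^ N.+1 * l.+1)%N by rewrite leq_mul2r leq_exp2l ?leqnSn ?orbT.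
  rewrite (bigop.big_cat_nat le1 le2) /=.
  set b := a (2 ^ N.+1 * l.+1)%N; have b0 : 0 < b := qt_gt0 _.
  have IH' : N%:R / 2 * b <= \sum_(l.+1 <= j < 2 ^ N * l.+1) a j / j.+1%:R.
    by apply: le_trans IH; rewrite ler_wpM2l ?divr_ge0 // qt_noninc.
  suff H : b / 2 <= \sum_(2 ^ N * l.+1 <= j < 2 ^ N.+1 * l.+1) a j / j.+1%:R.
    by rewrite -natr1 mulrDl mulrDl; apply: lerD => //; rewrite mul1r mulrC.
  apply: le_trans (_ : \sum_(2 ^ N * l.+1 <= j < 2 ^ N.+1 * l.+1)
      b / (2 ^ N.+1 * l.+1)%:R <= _).
    rewrite sumr_const_nat expnS -mulnA mul2n -addnn addnK -[leRHS]mulr_natr natrD.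
    set x : R := (2 ^ N * l.+1)%:R.
    have x0 : x != 0 by rewrite pnatr_eq0 muln_eq0 expn_eq0.
    by rewrite (_ : x + x = 2 * x); [rewrite invfM mulrA divfK|ring].
  apply: ler_sum_nat => j /andP[_ jlt]; apply: ler_pM; rewrite ?invr_ge0 //.
  - exact: ltW.
  - by apply: qt_noninc; exact: ltnW.
  - by rewrite lef_pV2 ?posrE ?ltr0n // ?muln_gt0 ?expn_gt0 // ler_nat.
have [Q HQ] : exists Q, 4 * A <= Q%:R.
  exists (Num.truncn (4 * A)).+1; rewrite ltW //; exact: truncnS_gt.
have Q0 : (0 < Q)%N by rewrite -(ltr0n R) (lt_le_trans _ HQ) // mulr_gt0.
exists Q; split=> // l.
have H1 := block Q l; have H2 := qt_sum_le l.+1 (2 ^ Q * l.+1).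
set b := a (2 ^ Q * l.+1)%N in H1 *; have b0 : 0 < b := qt_gt0 _.
have H3 : 2 * A * b <= A * a l.
  apply: le_trans (_ : Q%:R / 2 * b <= _).
    by rewrite ler_wpM2r ?(ltW b0) // ler_pdivlMr // mulrAC -(natrM _ 2 2).
  apply: le_trans H1 (le_trans H2 _); rewrite ler_wpM2l ?(ltW A0) //; exact: qtS.
rewrite ler_pdivlMr // mulrC.
by move: H3; rewrite mulrAC [2 * b * A]mulrC ler_pM2l.
Qed.

(* A large enough power of the quotients decays faster than 1/j, which is all
   that strong non-quasianalyticity is needed for. *)
Lemma qt_pow_sum : exists q C, [/\ (0 < q)%N, 0 < C &
  forall l N, \sum_(l <= j < N) a j ^+ (2 * q)%N <= C * l.+1%:R * a l ^+ (2 * q)%N].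
Proof.
(* With [p = 2 (Q + 2)] one has [2^p = 16 * 2^Q * 2^Q], which absorbs both the constant [2 * 2^Q]
   and the growth of the index from [l] to [l']. The block before [l'] and the rest after it then
   take half of the constant each. *)
have [Q [Q0 HQ]] := qt_halves; exists Q.+2, (2 * 2 ^+ Q); split=> [//||l N].
  by rewrite mulr_gt0 // exprn_gt0.
set p := (2 * Q.+2)%N.
have [d] := ubnP (N - l)%N; elim: d l => // d IH l; rewrite ltnS => Nl.
have al0 := qt_gt0 l; have ap0 : 0 < a l ^+ p := exprn_gt0 _ al0.
have K m : \sum_(l <= j < m) a j ^+ p <= m%:R * a l ^+ p.
  have [lm|ml] := leqP l m; last first.
    by rewrite big_geq ?(ltnW ml) // mulr_ge0 // ltW.
  apply: le_trans (_ : \sum_(l <= j < m) a l ^+ p <= _).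
    apply: ler_sum_nat => j /andP[lj _]; rewrite lerXn2r ?nnegrE ?(ltW (qt_gt0 _)) //.
    exact: qt_noninc.
  by rewrite sumr_const_nat -[leLHS]mulr_natl ler_wpM2r ?(ltW ap0) // ler_nat leq_subr.
set l' := (2 ^ Q * l.+1)%N.
have ll' : (l < l')%N by rewrite /l' -[X in (X <= _)%N]mul1n leq_mul2r expn_gt0.
have El' : l'%:R = 2 ^+ Q * l.+1%:R :> R by rewrite natrM natrX.
have [Nl'|l'N] := leqP N l'.
  apply: le_trans (K N) _; rewrite ler_wpM2r ?(ltW ap0) //.
  apply: le_trans (_ : l'%:R <= _); first by rewrite ler_nat.
  by rewrite El' ler_wpM2r // ler_peMl ?exprn_ge0 // ler1n.
rewrite (bigop.big_cat_nat (ltnW ll') (ltnW l'N)) /=.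
have H1 := K l'.
have H2 : \sum_(l' <= j < N) a j ^+ p <= 2 * 2 ^+ Q * l'.+1%:R * a l' ^+ p.
  by apply: IH; lia.
have H3 : a l' ^+ p <= a l ^+ p / 2 ^+ p.
  have al2 : 0 <= a l / 2 by rewrite mulr_ge0 ?invr_ge0 // ltW.
  rewrite -expr_div_n lerXn2r ?nnegrE ?(ltW (qt_gt0 _)) //; exact: HQ.
have H4 : l'.+1%:R <= 2 * 2 ^+ Q * l.+1%:R :> R.
  rewrite -natr1 El'; have : 1 <= 2 ^+ Q * l.+1%:R :> R by rewrite -El' ler1n (leq_ltn_trans _ ll').
  lra.
have H5 : 2 * 2 ^+ Q * l'.+1%:R * a l' ^+ p <= 2 ^+ Q * l.+1%:R * a l ^+ p.
  apply: le_trans (_ : 2 * 2 ^+ Q * (2 * 2 ^+ Q * l.+1%:R) * (a l ^+ p / 2 ^+ p) <= _).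
    have z1 : 0 <= 2 * 2 ^+ Q :> R by rewrite mulr_ge0 // exprn_ge0.
    apply: ler_pM H3; [exact: mulr_ge0|by rewrite exprn_ge0 // ltW ?qt_gt0|].
    exact: ler_wpM2l.
  have -> : 2 ^+ p = 16 * 2 ^+ Q * 2 ^+ Q :> R.
    by rewrite /p mul2n -addnn exprD !exprS; ring.
  have z0 : 2 ^+ Q != 0 :> R by rewrite expf_neq0.
  rewrite [leLHS](_ : _ = 4^-1 * (l.+1%:R * a l ^+ p)); last by field.
  rewrite -[leRHS]mulrA; apply: ler_wpM2r; first by rewrite mulr_ge0 // ltW.
  apply: le_trans (_ : 1 <= _); last by rewrite exprn_ege1 // ler1n.
  by rewrite invf_le1 // ler1n.
apply: le_trans (lerD H1 (le_trans H2 H5)) _.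
by rewrite El' le_eqVlt; apply/orP; left; apply/eqP; ring.
Qed.

(** [N] is the number of quotients exceeding [u], and the index at which [u^j M_j] is smallest; it
    exists because the quotients tend to zero by [qt_halves]. *)
Lemma qt_count (u : R) : 0 < u -> exists N, a N <= u /\ forall j, (j < N)%N -> u < a j.
Proof.
move=> u0; have [Q [Q0 HQ]] := qt_halves.
have H i : exists j, a j <= 2 ^- i.
  elim: i => [|i [j IH]]; first by exists 0%N; rewrite expr0 invr1 qt_le1.
  exists (2 ^ Q * j.+1)%N; apply: le_trans (HQ j) _.
  by rewrite exprSr invfM ler_wpM2r // invr_ge0.
have E : exists j, a j <= u.
  have [j Hj] := H (Num.truncn u^-1).+1; exists j; apply: le_trans Hj _.
  rewrite -[leRHS]invrK lef_pV2 ?posrE ?invr_gt0 ?exprn_gt0 //.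
  apply: le_trans (ltW (truncnS_gt _)) _.
  by rewrite -natrX ler_nat ltnW // ltn_expl.
exists (ex_minn E); case: ex_minnP => N aN minN; split=> // j jN.
by rewrite ltNge; apply/negP => /minN; rewrite leqNgt jN.
Qed.

Section Count.
Variables (u : R) (N : nat).
Hypotheses (u0 : 0 < u) (aN : a N <= u) (Nmin : forall j, (j < N)%N -> u < a j).

(** The left side is the product of the ratios [u / a_j] for [j < N]. *)
Lemma count_upper : u ^+ N * M N <= 1.
Proof.
elim: N Nmin => [|m IH] H; first by rewrite expr0 M0 mulr1.
have um : u < a m by apply: H.
have {}IH := IH (fun j jm => H j (ltnW jm)).
rewrite MSqt exprS (_ : _ * _ = (u / a m) * (u ^+ m * M m)); last by ring.
rewrite mulr_ile1 // ?divr_ge0 ?mulr_ge0 ?exprn_ge0 ?(ltW u0) ?(ltW (qt_gt0 _)) ?(ltW (M_gt0 _)) //.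
by rewrite ler_pdivrMr ?qt_gt0 // mul1r ltW.
Qed.

(** The minimum over [j] is attained at [N], and it cannot be too small: minimality and moderate
    growth give [u^N M_N <= u^(2N) M_(2N) <= A^(2N) (u^N M_N)^2], and one divides by [u^N M_N]. *)
Lemma count_lower j : 1 <= A ^+ (2 * N)%N * (u ^+ j * M j).
Proof.
have Q i : 0 < u ^+ i * M i by rewrite mulr_gt0 ?exprn_gt0 ?M_gt0.
have up i : (N <= i)%N -> u ^+ N * M N <= u ^+ i * M i.
  elim: i => [|i IH]; first by rewrite leqn0 => /eqP ->.
  rewrite leq_eqVlt => /orP[/eqP<-//|Ni]; apply: le_trans (IH Ni) _.
  rewrite MSqt exprS (_ : u * _ * _ = (u / a i) * (u ^+ i * M i)); last by ring.
  rewrite ler_peMl ?(ltW (Q _)) // ler_pdivlMr ?qt_gt0 // mul1r.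
  by apply: le_trans aN; exact: qt_noninc.
have down i : u ^+ N * M N <= u ^+ (N - i)%N * M (N - i)%N.
  elim: i => [|i IH]; first by rewrite subn0.
  apply: le_trans IH _; have [Ni|iN] := leqP N i.
    have -> : (N - i = 0)%N by lia.
    by have -> : (N - i.+1 = 0)%N by lia.
  have -> : (N - i = (N - i.+1).+1)%N by lia.
  set k := (N - i.+1)%N; rewrite MSqt exprS.
  rewrite (_ : u * _ * _ = (u / a k) * (u ^+ k * M k)); last by ring.
  rewrite ler_piMl ?(ltW (Q _)) // ler_pdivrMr ?qt_gt0 // mul1r ltW // Nmin //.
  by rewrite /k; lia.
have minN : u ^+ N * M N <= u ^+ j * M j.
  by have [/up//|jN] := leqP N j; rewrite -(subKn (ltnW jN)); exact: down.
apply: le_trans (_ : A ^+ (2 * N)%N * (u ^+ N * M N) <= _); last first.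
  by rewrite ler_wpM2l // exprn_ge0 // ltW.
have H1 := up (N + N)%N (leq_addr _ _).
have H2 := Mgrow N N.
rewrite -(ler_pM2l (Q N)) mulr1; apply: le_trans H1 _.
rewrite (_ : u ^+ N * M N * _ = u ^+ (N + N)%N * (A ^+ (N + N)%N * M N * M N)).
  by rewrite ler_wpM2l // exprn_ge0 // ltW.
by rewrite mul2n -addnn !exprD; ring.
Qed.

End Count.

End StronglyRegularSequences.

(** * Rational weights *)

Section RationalWeights.
Variables (R : realType) (n : nat) (Om : set 'rV[R]_n) (r : nat).
Variables (phi : 'I_r -> 'rV[R]_n -> R) (Cphi lam : R).
Hypothesis oOm : open Om.
Hypothesis sphi : forall i, smooth_on Om (phi i).
Hypotheses (Cphi1 : 1 <= Cphi) (lam0 : 0 <= lam).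
Hypothesis phi_bound : forall i s x, Om x ->
  `|pderivs s (phi i) x| <= (size s)`!%:R * (Cphi * lam ^+ size s).
Variables (q : nat) (K : R) (eps : nat -> R).
Hypotheses (K0 : 0 <= K) (eps0 : forall j, 0 < eps j).

Definition sumsq (phi : 'I_r -> 'rV[R]_n -> R) y := \sum_i phi i y ^+ 2.
Local Notation rho := (sumsq phi).

Definition rterm (phi : 'I_r -> 'rV[R]_n -> R) (e : R) y := (sumsq phi y ^+ q + e)^-1.

Definition rweight (phi : 'I_r -> 'rV[R]_n -> R) lo hi y :=
  \sum_(lo <= j < hi) K * eps j * rterm phi (eps j) y.

Lemma sumsq_ge0 y : 0 <= rho y.
Proof. by rewrite sumr_ge0 // => i _; rewrite sqr_ge0. Qed.

Lemma rterm_den_gt0 e y : 0 < e -> 0 < rho y ^+ q + e.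
Proof. by move=> e0; rewrite ltr_wpDl // exprn_ge0 // sumsq_ge0. Qed.

Lemma smooth_sumsq : smooth_on Om rho.
Proof. by apply: smooth_sum => // i _; exact: smoothX. Qed.

Lemma smooth_den e : smooth_on Om (fun y => rho y ^+ q + e).
Proof. exact: smoothD oOm (smoothX q oOm smooth_sumsq) (smooth_cst e oOm). Qed.

Lemma smooth_rterm e : 0 < e -> smooth_on Om (rterm phi e).
Proof.
move=> e0; apply: smoothV oOm (smooth_den e) _ => y _.
by rewrite gt_eqF // rterm_den_gt0.
Qed.

Lemma smooth_rweight lo hi : smooth_on Om (rweight phi lo hi).
Proof.
apply: smooth_sum => // j _.
exact: smoothM oOm (smooth_cst (K * eps j) oOm) (smooth_rterm (eps0 j)).
Qed.

Lemma rweight_ge0 lo hi y : 0 <= rweight phi lo hi y.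
Proof.
apply: sumr_ge0 => j _; rewrite !mulr_ge0 ?(ltW (eps0 j)) // invr_ge0 ltW //.
exact: rterm_den_gt0.
Qed.

Lemma rweight_cat lo mid hi y : (lo <= mid)%N -> (mid <= hi)%N ->
  rweight phi lo hi y = rweight phi lo mid y + rweight phi mid hi y.
Proof. by move=> h1 h2; rewrite /rweight (bigop.big_cat_nat h1 h2). Qed.

(** [rconst / D] is the rate in [geo_rterm]: [Cphi lam / D] for the equations, a doubling for their
    squares, [2^q] for the power, [(r+1)^q] for their number, and a doubling for the inverse. *)
Definition rconst := 2 * (r.+1%:R ^+ q * 2 ^+ q * (2 * (Cphi * lam))).

Lemma rconst_ge0 : 0 <= rconst.
Proof.
have := Cphi1 => C1; rewrite /rconst !mulr_ge0 ?exprn_ge0 //; lra.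
Qed.

Section AtScale.
Variables (x : 'rV[R]_n) (D : R).
Hypotheses (Omx : Om x) (D0 : 0 < D) (D1 : D <= 1) (rhoD : rho x <= D ^+ 2).

Let Lx := Cphi * lam / D.

Let Lx_ge0 : 0 <= Lx.
Proof. by rewrite divr_ge0 ?(ltW D0) // mulr_ge0 //; have := Cphi1; lra. Qed.

(** The constant drops from [Cphi] to [D]: at order zero because [rho x <= D^2], at positive orders
    by charging [Cphi / D >= 1] to every derivative. *)
Lemma geo_phi i : geo (phi i) x D Lx.
Proof.
have C0 : 0 <= Cphi by have := Cphi1; lra.
case=> [|j s].
  rewrite /= fact0 expr0 mulr1 mul1r -ler_sqr ?nnegrE ?(ltW D0) // real_normK ?num_real //.
  apply: le_trans rhoD; rewrite /sumsq (bigD1 i) //= lerDl sumr_ge0 // => k _.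
  exact: sqr_ge0.
apply: le_trans (phi_bound i (j :: s) Omx) _; rewrite ler_wpM2l //.
set m := size s; rewrite /= /Lx -/m.
rewrite [leRHS](_ : _ = Cphi * (lam ^+ m.+1 * (Cphi ^+ m * (D ^-1) ^+ m))); last first.
  by rewrite !exprMn !exprS; field; rewrite gt_eqF.
rewrite ler_wpM2l // ler_peMr ?exprn_ge0 //.
by rewrite mulr_ege1 // exprn_ege1 // invf_ge1.
Qed.

Lemma geo_sumsq : geo rho x (r%:R * D ^+ 2) (2 * Lx).
Proof.
have H i : geo (fun y => phi i y ^+ 2) x (D ^+ 2) (2 * Lx).
  rewrite expr2; apply: (geo_congr oOm (f := fun y => phi i y * phi i y)) => //.
  exact: (geoM oOm (sphi i) (sphi i) Omx Lx_ge0 (geo_phi i) (geo_phi i)).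
have := @geo_sum R n Om oOm _ (index_enum 'I_r) (fun i y => phi i y ^+ 2) x
  (fun=> D ^+ 2) (2 * Lx) Omx (fun i => smoothX 2 oOm (sphi i)) H.
by rewrite sumr_const card_ord -[_ *+ r]mulr_natl.
Qed.

(** The condition on [e] makes the denominator at least as large as the size [D^(2q)] of its
    derivatives at scale [D], so that it bounds them itself and [geoV] applies. *)
Lemma geo_rterm e : 0 < e -> D ^+ (2 * q)%N <= rho x ^+ q + e ->
  geo (rterm phi e) x (rterm phi e x) (rconst / D).
Proof.
move=> e0 De; set u := fun y => rho y ^+ q + e.
have L2 : 0 <= 2 * Lx by rewrite mulr_ge0.
have ux : 0 < u x := rterm_den_gt0 x e0.
pose mu := r.+1%:R ^+ q * (2 ^+ q * (2 * Lx)).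
have mu0 : 0 <= mu by rewrite mulr_ge0 ?exprn_ge0 // mulr_ge0 ?exprn_ge0.
have -> : rconst / D = 2 * mu by rewrite /rconst /mu /Lx; field; rewrite gt_eqF.
apply: (geoV oOm (u := u) (smooth_den e) _ Omx ux mu0).
  by move=> y _; rewrite gt_eqF // rterm_den_gt0.
case=> [|i s]; first by rewrite /= fact0 expr0 mulr1 mul1r ger0_norm // ltW.
rewrite (pderivsD (i :: s) oOm (smoothX q oOm smooth_sumsq) (smooth_cst e oOm) Omx).
rewrite (pderivs_cst (s := i :: s) _ oOm) // addr0.
apply: le_trans (geoX oOm q smooth_sumsq Omx L2 geo_sumsq (i :: s)) _.
set m := size (i :: s); set T := 2 ^+ q * (2 * Lx).
have T0 : 0 <= T by rewrite mulr_ge0 ?exprn_ge0.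
have -> : (r%:R * D ^+ 2) ^+ q = D ^+ (2 * q)%N * r%:R ^+ q by rewrite exprMn -exprM mulrC.
rewrite ler_wpM2l // -mulrA; apply: ler_pM => //; first by rewrite exprn_ge0 // ltW.
  by rewrite mulr_ge0 ?exprn_ge0.
rewrite /mu -/T [leRHS]exprMn; apply: ler_pM; rewrite ?exprn_ge0 //.
(* The constant has to be [u x] itself, so the factor [r^q] goes into the rate, which is possible at
   positive order; [r + 1] keeps the base at least one. *)
apply: le_trans (_ : r.+1%:R ^+ q <= _).
  by rewrite lerXn2r ?nnegrE // ler_nat.
by rewrite /m /= ler_eXnr // exprn_ege1 // ler1n.
Qed.

(** The terms are nonnegative and share one rate, so their sum again bounds its own derivatives. *)
Lemma geo_rweight lo hi :
  (forall j, (lo <= j < hi)%N -> D ^+ (2 * q)%N <= rho x ^+ q + eps j) ->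
  geo (rweight phi lo hi) x (rweight phi lo hi x) (rconst / D).
Proof.
have mu0 : 0 <= rconst / D by rewrite divr_ge0 ?rconst_ge0 // ltW.
have T j : smooth_on Om (fun y => K * eps j * rterm phi (eps j) y).
  exact: smoothM oOm (smooth_cst (K * eps j) oOm) (smooth_rterm (eps0 j)).
have [lohi|hilo] := leqP lo hi; last first.
  move=> _; apply: (geo_congr oOm (f := fun=> 0)) => //.
    by move=> y _; rewrite /rweight big_geq // ltnW.
  by apply: (geo_cst oOm Omx _ mu0); rewrite normr0; exact: rweight_ge0.
elim: hi lohi => [|hi IH].
  rewrite leqn0 => /eqP-> _; apply: (geo_congr oOm (f := fun=> 0)) => //.
    by move=> y _; rewrite /rweight big_geq.
  by apply: (geo_cst oOm Omx _ mu0); rewrite normr0; exact: rweight_ge0.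
rewrite leq_eqVlt => /orP[/eqP->|lohi] H.
  apply: (geo_congr oOm (f := fun=> 0)) => //.
    by move=> y _; rewrite /rweight big_geq.
  by apply: (geo_cst oOm Omx _ mu0); rewrite normr0; exact: rweight_ge0.
have E y : rweight phi lo hi.+1 y = rweight phi lo hi y + K * eps hi * rterm phi (eps hi) y.
  by rewrite /rweight big_nat_recr.
apply: (geo_congr oOm (f := fun y => rweight phi lo hi y + K * eps hi * rterm phi (eps hi) y)) => //.
rewrite E; apply: (geoD oOm (smooth_rweight lo hi) (T hi) Omx).
  by apply: IH => // j /andP[h1 h2]; apply: H; rewrite h1 ltnW.
have c0 : 0 <= K * eps hi by rewrite mulr_ge0 // ltW.
rewrite -{2}(ger0_norm c0); apply: (geoZ oOm (K * eps hi) (smooth_rterm (eps0 hi)) Omx).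
by apply: geo_rterm => //; apply: H; rewrite -ltnS lohi leqnn.
Qed.

End AtScale.

End RationalWeights.

(** * Flat weights and division *)

(** The counterpart of [CM_bound] for real functions, over all words of derivatives instead of
    multi-indices. *)
Definition word_bound (R : realType) (n : nat) (M : nat -> R) (Om : set 'rV[R]_n)
    (sigma c : R) (F : 'rV[R]_n -> R) :=
  forall s x, Om x ->
    `|pderivs s F x| <= c * ((size s)`!%:R * (sigma ^+ size s * M (size s))).

Section FlatWeights.
Variables (R : realType) (n : nat) (Om : set 'rV[R]_n) (r : nat).
Variables (phi : 'I_r -> 'rV[R]_n -> R) (Cphi lam : R).
Hypothesis oOm : open Om.
Hypothesis sphi : forall i, smooth_on Om (phi i).
Hypotheses (Cphi1 : 1 <= Cphi) (lam0 : 0 <= lam).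
Hypothesis phi_bound : forall i s x, Om x ->
  `|pderivs s (phi i) x| <= (size s)`!%:R * (Cphi * lam ^+ size s).
Hypothesis sumsq_le1 : forall x, Om x -> sumsq phi x <= 1.

Variables (M : nat -> R) (A : R).
Hypotheses (A1 : 1 <= A) (M0 : M 0%N = 1) (Mmono : forall j, M j <= M j.+1).
Hypothesis Mconv : forall j, M j.+1 / M j <= M j.+2 / M j.+1.
Hypothesis Mgrow : forall j k, M (j + k)%N <= A ^+ (j + k) * M j * M k.
Hypothesis Msum : forall l, (\sum_(l <= j <oo) (M j / (j.+1%:R * M j.+1))%:E
  <= (A * (M l / M l.+1))%:E)%E.

Variables (q : nat) (C K B T : R).
Hypothesis C0 : 0 < C.
Hypothesis qC : forall l N,
  \sum_(l <= j < N) qt M j ^+ (2 * q)%N <= C * l.+1%:R * qt M l ^+ (2 * q)%N.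
Hypotheses (K0 : 0 <= K) (KA : A ^+ 2 <= expR (K / 4)).
Hypotheses (B1 : 1 <= B) (T0 : 0 <= T).
Hypothesis BT : A ^+ 2 * T * expR (3 / 2 * (K * (1 + C))) <= B.

Let A0 : 0 < A. Proof. exact: lt_le_trans A1. Qed.
Let B0 : 0 < B. Proof. exact: lt_le_trans B1. Qed.
Local Notation a := (qt M).
Local Notation rho := (sumsq phi).
Let Mgt0 j : 0 < M j. Proof. exact: M_gt0. Qed.
Let a_gt0 j : 0 < a j. Proof. exact: qt_gt0. Qed.

Let eps j := (a j / B) ^+ (2 * q).
Let P lo hi := rweight q K eps phi lo hi.
Let d x := Num.sqrt (rho x).
Let tail lo hi := \sum_(lo <= j < hi) eps j.
Let Lam := rconst r Cphi lam q.

Let eps_gt0 j : 0 < eps j.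
Proof. by rewrite exprn_gt0 // divr_gt0. Qed.

Let s_gt0 j : 0 < a j / B. Proof. exact: divr_gt0. Qed.
Let s_ge0 j : 0 <= a j / B. Proof. exact: ltW. Qed.

Let rho_ge0 x : 0 <= rho x. Proof. exact: sumsq_ge0. Qed.

Let d_ge0 x : 0 <= d x. Proof. exact: sqrtr_ge0. Qed.

Let d_sq x : d x ^+ 2 = rho x. Proof. by rewrite sqr_sqrtr. Qed.

Let d_pow x : d x ^+ (2 * q) = rho x ^+ q. Proof. by rewrite exprM d_sq. Qed.

Let P_ge0 lo hi x : 0 <= P lo hi x. Proof. exact: rweight_ge0. Qed.

Let tail_ge0 lo hi : 0 <= tail lo hi.
Proof. by apply: sumr_ge0 => j _; exact: ltW. Qed.

Let Lam_ge0 : 0 <= Lam. Proof. exact: rconst_ge0. Qed.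

Let sP lo hi : smooth_on Om (P lo hi). Proof. exact: smooth_rweight. Qed.

Let term_le1 j x : eps j * rterm q phi (eps j) x <= 1.
Proof.
rewrite ler_pdivrMr ?mul1r ?lerDr ?exprn_ge0 //.
exact: rterm_den_gt0.
Qed.

Let P_le_card lo hi x : P lo hi x <= K * (hi - lo)%:R.
Proof.
rewrite /P /rweight; apply: le_trans (_ : \sum_(lo <= j < hi) K <= _).
  by apply: ler_sum => j _; rewrite -mulrA ler_piMr.
by rewrite sumr_const_nat -[leLHS]mulr_natr.
Qed.

Let P_tail lo hi x : 0 < d x -> P lo hi x * d x ^+ (2 * q) <= K * tail lo hi.
Proof.
move=> dx; rewrite /P /rweight mulr_suml mulr_sumr; apply: ler_sum => j _.
rewrite -!mulrA ler_wpM2l // ler_piMr ?(ltW (eps_gt0 j)) // mulrC.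
have := rterm_den_gt0 phi q x (eps_gt0 j) => H.
rewrite ler_pdivrMr // mul1r d_pow lerDl ltW //.
Qed.

Let P_cat lo mid hi x : (lo <= mid)%N -> (mid <= hi)%N ->
  P lo hi x = P lo mid x + P mid hi x.
Proof. exact: rweight_cat. Qed.

(** Each of the first [N] terms is at most [K]. The later ones are summed by [P_tail] and [qC], and
    [a_N <= B d] cancels the power of [d]. *)
Let P_upper x k N : 0 < d x -> a N <= B * d x -> (forall j, (j < N)%N -> B * d x < a j) ->
  P 0 k x <= K * (N%:R + C * N.+1%:R).
Proof.
move=> dx aN Nmin; apply: le_trans (_ : P 0 (maxn k N) x <= _).
  by rewrite (P_cat x (leq0n k) (leq_maxl k N)) lerDl.
rewrite (P_cat x (leq0n N) (leq_maxr k N)) mulrDr; apply: lerD.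
  by have := P_le_card 0 N x; rewrite subn0.
have dq : 0 < d x ^+ (2 * q) by rewrite exprn_gt0.
rewrite -(ler_pM2r dq); apply: le_trans (P_tail _ _ dx) _.
rewrite -!mulrA ler_wpM2l // mulrA.
have Bq : 0 < B ^+ (2 * q) by rewrite exprn_gt0.
rewrite -(ler_pM2r Bq) /tail mulr_suml.
rewrite (eq_bigr (fun j => a j ^+ (2 * q))) => [|j _]; last first.
  by rewrite /eps expr_div_n divfK // gt_eqF.
apply: le_trans (qC _ _) _.
rewrite [leRHS](_ : _ = C * N.+1%:R * (B * d x) ^+ (2 * q)); last by rewrite exprMn; ring.
have CN : 0 <= C * N.+1%:R by rewrite mulr_ge0 // ltW.
rewrite ler_wpM2l // lerXn2r ?nnegrE ?(ltW (a_gt0 _)) //.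
by rewrite mulr_ge0 // ltW.
Qed.

(** For [j < N] one has [eps_j >= D^(2q) >= rho^q], so that each of these terms is at least
    [K / 2]. *)
Let P_lower x D k N : 0 < D -> rho x <= D ^+ 2 -> (forall j, (j < N)%N -> B * D < a j) ->
  (N <= k)%N -> K * N%:R / 2 <= P 0 k x.
Proof.
move=> D0 rD Nmin Nk; apply: le_trans (_ : P 0 N x <= _); last first.
  by rewrite (P_cat x (leq0n N) Nk) lerDl.
rewrite /P /rweight; apply: le_trans (_ : \sum_(0 <= j < N) K / 2 <= _).
  by rewrite sumr_const_nat subn0 -[leRHS]mulr_natr mulrAC.
apply: ler_sum_nat => j /andP[_ /Nmin jN]; rewrite -mulrA ler_wpM2l //.
have H : rho x ^+ q <= eps j.
  apply: le_trans (_ : D ^+ (2 * q) <= _).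
    by rewrite exprM lerXn2r ?nnegrE // exprn_ge0 // ltW.
  apply: lerXn2r; rewrite ?nnegrE ?(ltW D0) ?s_ge0 //.
  by rewrite ler_pdivlMr // mulrC ltW.
rewrite -[rterm _ _ _ _]mul1r mulrA mulr1 ler_pdivlMr ?rterm_den_gt0 //.
by move: H; move: (eps j) (rho x ^+ q) => e z; lra.
Qed.

(** [P_lower] gives [exp(-P/2) <= exp(-K N / 4) <= A^(-2N)], which [count_lower] bounds by
    [(B D)^j M_j] for every [j] at once. *)
Let expP_le x D k N j : 0 < D -> rho x <= D ^+ 2 -> a N <= B * D ->
  (forall j, (j < N)%N -> B * D < a j) -> (N <= k)%N ->
  expR (- (P 0 k x / 2)) <= (B * D) ^+ j * M j.
Proof.
move=> D0 rD aN Nmin Nk; have H := P_lower D0 rD Nmin Nk.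
have BD : 0 < B * D by rewrite mulr_gt0.
have := count_lower A0 M0 Mmono Mconv Mgrow BD aN Nmin j; set z := _ * M j => Hz.
have z0 : 0 <= z by rewrite mulr_ge0 ?exprn_ge0 // ltW.
rewrite expRN -div1r ler_pdivrMr ?expR_gt0 //.
apply: le_trans Hz _; rewrite [leRHS]mulrC ler_wpM2r //.
rewrite exprM; apply: le_trans (_ : expR (K / 4) ^+ N <= _).
  by rewrite lerXn2r ?nnegrE ?expR_ge0 // exprn_ge0 // ltW.
rewrite -expRM_natl ler_expR; move: H; move: (P 0 k x) N%:R => p y.
rewrite (_ : K * y / 2 = 2 * (y * (K / 4))); last by field.
by lra.
Qed.

(* The partial sum [P 0 k.+1] is only analytic at scale [d x] or [a k / B],
   whichever is larger. *)
Let scale k x := Num.max (d x) (a k / B).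

Let scale_gt0 k x : 0 < scale k x.
Proof. by rewrite lt_max divr_gt0 ?orbT. Qed.

Let scale_le1 k x : Om x -> scale k x <= 1.
Proof.
move=> Omx; rewrite ge_max -[X in _ <= X]sqrtr1 ler_wsqrtr ?sumsq_le1 //=.
rewrite ler_pdivrMr // mul1r; apply: le_trans B1.
exact: qt_le1.
Qed.

Let rho_scale k x : rho x <= scale k x ^+ 2.
Proof.
rewrite -d_sq lerXn2r ?nnegrE ?le_max ?lexx ?(ltW (scale_gt0 _ _)) //.
by rewrite d_ge0.
Qed.

Let eps_scale k x j : (j <= k)%N -> scale k x ^+ (2 * q) <= rho x ^+ q + eps j.
Proof.
move=> jk; rewrite /scale maxEle; case: ifP => _; last first.
  by rewrite d_pow lerDl ltW.
apply: le_trans (_ : eps j <= _); last by rewrite lerDr exprn_ge0.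
apply: lerXn2r; rewrite ?nnegrE ?s_ge0 //.
by rewrite ler_wpM2r ?invr_ge0 ?(ltW B0) //; exact: qt_noninc.
Qed.

(** The floor [a_k / B] of the scale stops the count at [k + 1] at the latest, so that all terms
    used in [P_lower] do occur in [P 0 k.+1]. *)
Let scale_count k x : exists N, [/\ a N <= B * scale k x,
  forall j, (j < N)%N -> B * scale k x < a j & (N <= k.+1)%N].
Proof.
have BD : 0 < B * scale k x by rewrite mulr_gt0.
have [N [aN Nmin]] := qt_count A0 M0 Mmono Mconv Msum BD.
exists N; split=> //; rewrite leqNgt; apply/negP => kN.
have := Nmin k.+1 kN; apply/negP; rewrite -leNgt.
apply: le_trans (_ : a k <= _); first exact: qtS.
rewrite -ler_pdivrMl // mulrC le_max lexx orbT //.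
Qed.

Let geo_P k x : Om x -> geo (P 0 k.+1) x (P 0 k.+1 x) (Lam / scale k x).
Proof.
move=> Omx; apply: (geo_rweight oOm sphi Cphi1 lam0 phi_bound K0 eps_gt0 Omx) => //.
- exact: scale_le1.
- by move=> j /andP[_ jk]; exact: eps_scale.
Qed.

(** [expP_le] is used at the order [size s + l]: the first part of the power of the scale cancels
    the loss due to the derivatives, the rest is a gain. Taking [l = 0] gives the Carleman bound,
    [l = 1] flatness. *)
Let wk_bound k x s l : Om x -> `|pderivs s (fun y => expR (- P 0 k.+1 y)) x| <=
  (size s)`!%:R * ((6 * Lam) ^+ size s * (scale k x ^+ l * (B ^+ (size s + l) * M (size s + l)%N))).
Proof.
move=> Omx; have D0 := scale_gt0 k x; set D := scale k x in D0 *.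
have mu0 : 0 <= Lam / D by rewrite divr_ge0 // ltW.
apply: le_trans (geo_expRN oOm (sP 0 k.+1) Omx mu0 (geo_P k Omx) s) _.
have [N [aN Nmin Nk]] := scale_count k x.
have H := expP_le (size s + l)%N D0 (rho_scale k x) aN Nmin Nk.
rewrite ler_wpM2l //; set m := size s in H *.
have mm : 0 <= (6 * (Lam / D)) ^+ m by rewrite exprn_ge0 // mulr_ge0.
apply: le_trans (ler_wpM2r mm H) _.
rewrite le_eqVlt; apply/orP; left; apply/eqP.
rewrite !exprMn exprVn [D ^+ (m + l)]exprD; field.
by rewrite expf_neq0 // gt_eqF.
Qed.

Let a_small (e : R) : 0 < e -> exists k0, forall k, (k0 <= k)%N -> a k <= e.
Proof.
move=> e0; have [N [aN _]] := qt_count A0 M0 Mmono Mconv Msum e0.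
by exists N => k Nk; apply: le_trans aN; exact: qt_noninc.
Qed.

Let w x : R := limn (fun k => expR (- P 0 k.+1 x)).

Let w_cvg x : (fun k => expR (- P 0 k.+1 x)) @ \oo --> w x.
Proof.
apply: nonincreasing_is_cvgn.
  apply/nonincreasing_seqP => k; rewrite ler_expR lerN2.
  by rewrite (P_cat x (leq0n k.+1) (leqnSn k.+1)) lerDl.
by exists 0 => _ [k _ <-]; exact: expR_ge0.
Qed.

Local Notation CMR := (word_bound M).

Let sexpN k : smooth_on Om (fun y => expR (- P 0 k.+1 y)).
Proof. exact: smooth_expR oOm (smoothN oOm (sP 0 k.+1)). Qed.

Let wk_CMR k : CMR Om (6 * Lam * B) 1 (fun y => expR (- P 0 k.+1 y)).
Proof.
move=> s x Omx; apply: le_trans (wk_bound k s 0 Omx) _.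
by rewrite addn0 expr0 !mul1r [(6 * Lam * B) ^+ _]exprMn -mulrA.
Qed.

Let w_smooth : smooth_on Om w /\
  forall s x, Om x -> (fun N => pderivs s (fun y => expR (- P 0 N.+1 y)) x) @ \oo --> pderivs s w x.
Proof.
exact: (@smooth_limit R n Om (fun k y => expR (- P 0 k.+1 y)) w
  (fun m => 1 * (m`!%:R * ((6 * Lam * B) ^+ m * M m))) oOm sexpN wk_CMR (fun x _ => @w_cvg x)).
Qed.

Let w_CMR : CMR Om (6 * Lam * B) 1 w.
Proof.
exact: (@smooth_limit_bound R n Om (fun k y => expR (- P 0 k.+1 y)) w
  (fun m => 1 * (m`!%:R * ((6 * Lam * B) ^+ m * M m))) oOm sexpN wk_CMR (fun x _ => @w_cvg x)).
Qed.

(** On the zero set the scale equals [a_k / B], which tends to zero, and [wk_bound] with [l = 1] has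
    it as a factor. *)
Let w_flat x s : Om x -> rho x = 0 -> pderivs s w x = 0.
Proof.
move=> Omx rx; apply/eqP; rewrite -normr_le0; apply/ler_addgt0Pr => e e0; rewrite add0r.
have dx : d x = 0 by rewrite /d rx sqrtr0.
set m := size s; pose c := m`!%:R * ((6 * Lam) ^+ m * (B ^+ (m + 1) * M (m + 1)%N)).
have c0 : 0 <= c.
  by rewrite !mulr_ge0 ?exprn_ge0 ?(ltW B0) ?(ltW (Mgt0 _)) // mulr_ge0.
have c1 : 0 < c + 1 by rewrite ltr_wpDl.
have [k0 Hk0] := a_small (divr_gt0 e0 c1).
apply: (cvg_norm_le (w_smooth.2 s x Omx)); exists k0 => k kk.
apply: le_trans (wk_bound k s 1 Omx) _; rewrite -/m expr1.
have sk : scale k x <= e / (c + 1).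
  rewrite /scale dx ge_max divr_ge0 ?(ltW e0) ?(ltW c1) //=.
  apply: le_trans (Hk0 k kk); rewrite ler_pdivrMr // ler_peMr // ltW //.
rewrite (_ : m`!%:R * _ = c * scale k x); last by rewrite /c; ring.
apply: le_trans (ler_wpM2l c0 sk) _.
rewrite mulrCA ler_piMr ?(ltW e0) // ler_pdivrMr // mul1r lerDl //.
Qed.

Let E k y := expR (P 0 k.+1 y).

Let E_smooth k : smooth_on Om (E k). Proof. exact: smooth_expR. Qed.

(** The scale is bounded below by [a_k / B] on all of [Om]. Only membership in the class is wanted,
    so the constants may depend on [k]. *)
Let E_CMR k : exists c sigma, 0 < sigma /\ CMR Om sigma c (E k).
Proof.
set p := K * k.+1%:R; have s0 := s_gt0 k.
have z0 : 0 <= 6 * (Lam / (a k / B)) by rewrite mulr_ge0 // mulr_ge0 // invr_ge0 ltW.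
exists (expR (p + p / 2)), (6 * (Lam / (a k / B)) + 1); split.
  exact: ltr_wpDl.
move=> s x Omx; have D0 := scale_gt0 k x.
have mu0 : 0 <= Lam / scale k x by rewrite divr_ge0 // ltW.
have := geo_expR oOm (sP 0 k.+1) Omx (P_ge0 0 k.+1 x) mu0 (fun s _ => geo_P k Omx s).
move=> /(_ s) /le_trans; apply.
rewrite [leRHS]mulrCA ler_wpM2l //; apply: ler_pM.
- exact: expR_ge0.
- by rewrite exprn_ge0 // mulr_ge0.
- rewrite ler_expR; have := P_le_card 0 k.+1 x; rewrite subn0 -/p; lra.
- apply: le_trans (_ : (6 * (Lam / (a k / B)) + 1) ^+ size s <= _).
    apply: lerXn2r; rewrite ?nnegrE ?addr_ge0 //; first by rewrite mulr_ge0.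
    rewrite -[leLHS]addr0; apply: lerD => //.
    rewrite ler_wpM2l // ler_wpM2l // lef_pV2 ?posrE //.
    by rewrite /scale le_max lexx orbT.
  by rewrite ler_peMr ?M_ge1 // exprn_ge0 // addr_ge0.
Qed.

(** The decay rate after [absorb] has split [M_m] into three factors, which uses moderate growth
    twice. *)
Let S := A ^+ 2 * T.
Let S_ge0 : 0 <= S. Proof. by rewrite mulr_ge0 // sqr_ge0. Qed.
Let G := expR (3 / 2 * (K * C)) * (S ^+ (2 * q) * K * M (2 * q)).
Let G_ge0 : 0 <= G.
Proof. by rewrite mulr_ge0 ?expR_ge0 // mulr_ge0 ?(ltW (Mgt0 _)) // mulr_ge0 // exprn_ge0. Qed.

(** By the choice of [B], [(S d)^N M_N <= (S / B)^N <= exp(-c N)], while [P_upper] gives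
    [3/2 P <= c N + 3/2 K C]: the count cancels. *)
Let absorb_count x hi N : 0 < d x -> a N <= B * d x ->
  (forall j, (j < N)%N -> B * d x < a j) ->
  (S * d x) ^+ N * M N * expR (P 0 hi x + P 0 hi x / 2) <= expR (3 / 2 * (K * C)).
Proof.
move=> dx aN Nmin; set c := 3 / 2 * (K * (1 + C)).
have H1 : (S * d x) ^+ N * M N <= (S / B) ^+ N.
  have Bd : 0 < B * d x by rewrite mulr_gt0.
  have := count_upper M0 Mmono Bd Nmin => H.
  have -> : (S * d x) ^+ N * M N = (S / B) ^+ N * ((B * d x) ^+ N * M N).
    by rewrite !exprMn exprVn; field; rewrite expf_neq0 // gt_eqF.
  by rewrite ler_piMr // exprn_ge0 // mulr_ge0 // invr_ge0 ltW.
have H2 : (S / B) ^+ N <= expR (- (N%:R * c)).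
  rewrite expRN expRM_natl -exprVn; apply: lerXn2r.
  - by rewrite nnegrE mulr_ge0 // invr_ge0 ltW.
  - by rewrite nnegrE invr_ge0 expR_ge0.
  rewrite ler_pdivrMr // mulrC -ler_pdivrMr ?invr_gt0 ?expR_gt0 //.
  by rewrite invrK.
have H3 := P_upper hi dx aN Nmin.
apply: le_trans (ler_pM _ _ (le_trans H1 H2) (lexx _)) _.
- by rewrite mulr_ge0 ?exprn_ge0 ?(ltW (Mgt0 _)) // mulr_ge0.
- exact: expR_ge0.
rewrite -expRD ler_expR /c; move: H3; move: (P 0 hi x) => p.
rewrite -natr1; move: N%:R => y H.
have -> : - (y * (3 / 2 * (K * (1 + C)))) + (p + p / 2) =
  3 / 2 * (p - K * (y + C * (y + 1))) + 3 / 2 * (K * C) by field.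
lra.
Qed.

(* The decay of [F], used at the order [m = N + t + 2 q], pays for [exp P] with
   [M N], for the derivatives of [exp P] with [M t], and for the denominator in
   [P_tail] with [M (2 * q)]. *)
Let absorb x lo hi t L : 0 < d x -> 0 <= L -> exists m,
  ((T * d x) ^+ m * M m) *
    (P lo hi x * expR (P 0 hi x + P 0 hi x / 2) * (L / d x) ^+ t) <=
  G * tail lo hi * ((L * S) ^+ t * M t).
Proof.
move=> dx L0; have Bd : 0 < B * d x by rewrite mulr_gt0.
have [N [aN Nmin]] := qt_count A0 M0 Mmono Mconv Msum Bd.
set m := (N + (t + 2 * q))%N; exists m.
set p := P lo hi x; set e := expR _.
have p0 : 0 <= p := P_ge0 _ _ _.
have e0 : 0 <= e := expR_ge0 _.
have H1 : (T * d x) ^+ m * M m <=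
    (S * d x) ^+ m * (M N * (M t * M (2 * q))).
  apply: le_trans (_ : (T * d x) ^+ m * (A ^+ m * M N * (A ^+ m * M t * M (2 * q))) <= _).
    rewrite ler_wpM2l ?exprn_ge0 ?mulr_ge0 //; apply: le_trans (Mgrow _ _) _.
    rewrite ler_wpM2l ?mulr_ge0 ?exprn_ge0 ?(ltW A0) ?(ltW (Mgt0 _)) //.
    apply: le_trans (Mgrow _ _) _.
    rewrite ler_wpM2r ?(ltW (Mgt0 _)) // ler_wpM2r ?(ltW (Mgt0 _)) //.
    by rewrite ler_weXn2l // leq_addl.
  rewrite le_eqVlt; apply/orP; left; apply/eqP.
  by rewrite /S expr2 !exprMn; ring.
apply: le_trans (ler_wpM2r _ H1) _.
  by rewrite mulr_ge0 ?mulr_ge0 // exprn_ge0 // mulr_ge0 // invr_ge0 ltW.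
rewrite [leLHS](_ : _ = ((S * d x) ^+ N * M N * e) *
    ((S ^+ (2 * q) * (p * d x ^+ (2 * q)) * M (2 * q)) * ((L * S) ^+ t * M t))); last first.
  rewrite /m !exprD !exprMn exprVn; field.
  by rewrite expf_neq0 // gt_eqF.
rewrite [leRHS](_ : _ = expR (3 / 2 * (K * C)) *
  ((S ^+ (2 * q) * K * M (2 * q) * tail lo hi) * ((L * S) ^+ t * M t))); last by rewrite /G; ring.
have w0 : 0 <= (L * S) ^+ t * M t.
  by apply: mulr_ge0; [rewrite exprn_ge0 // mulr_ge0|exact: ltW].
apply: ler_pM.
- apply: mulr_ge0 => //; apply: mulr_ge0; last exact: ltW.
  by rewrite exprn_ge0 // mulr_ge0.
- apply: mulr_ge0 => //; apply: mulr_ge0; last exact: ltW.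
  by rewrite mulr_ge0 ?exprn_ge0 // mulr_ge0 // exprn_ge0.
- exact: absorb_count aN Nmin.
rewrite ler_wpM2r //.
rewrite [leRHS](_ : _ = S ^+ (2 * q) * (K * tail lo hi) * M (2 * q)); last by ring.
rewrite ler_wpM2r ?(ltW (Mgt0 _)) // ler_wpM2l ?exprn_ge0 //.
exact: P_tail.
Qed.

Let M_mul i j : M i * M j <= M (i + j). Proof. exact: M_supermul. Qed.

Let eP k y := expR (P 0 k y).
Let seP k : smooth_on Om (eP k). Proof. exact: smooth_expR. Qed.

Let seB lo hi : smooth_on Om (fun y => eP hi y - eP lo y).
Proof. exact: smoothD oOm (seP hi) (smoothN oOm (seP lo)). Qed.

(** The difference is [exp(P 0 lo)] times [exp(P lo hi) - 1]; the factor [P lo hi x] survives and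
    the two exponential costs recombine into that of [P 0 hi]. *)
Let geo_eB x lo hi : Om x -> 0 < d x -> (lo <= hi)%N ->
  geo (fun y => eP hi y - eP lo y) x
    (P lo hi x * expR (P 0 hi x + P 0 hi x / 2)) (24 * Lam / d x).
Proof.
move=> Omx dx lohi.
have d1 : d x <= 1 by rewrite -[X in _ <= X]sqrtr1 ler_wsqrtr ?sumsq_le1.
have rd : rho x <= d x ^+ 2 by rewrite d_sq.
have gP l h : geo (P l h) x (P l h x) (Lam / d x).
  apply: (geo_rweight oOm sphi Cphi1 lam0 phi_bound K0 eps_gt0 Omx dx d1 rd) => j _.
  by rewrite d_pow lerDl ltW.
have mu0 : 0 <= Lam / d x by rewrite mulr_ge0 // invr_ge0 ltW.
have g1 : geo (eP lo) x (expR (P 0 lo x + P 0 lo x / 2)) (12 * (Lam / d x)).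
  apply: (@geo_le R n _ _ _ (6 * (Lam / d x))) (lexx _) _ _.
  - by rewrite mulr_ge0.
  - by rewrite ler_wpM2r // ler_nat.
  exact: (geo_expR oOm (sP 0 lo) Omx (P_ge0 0 lo x) mu0 (fun s _ => gP 0%N lo s)).
have g2 := geo_expRB1 oOm (sP lo hi) Omx mu0 (gP lo hi).
have mu12 : 0 <= 12 * (Lam / d x) by rewrite mulr_ge0.
have s2 : smooth_on Om (fun y => expR (P lo hi y) - 1).
  exact: smoothD oOm (smooth_expR oOm (sP lo hi)) (smooth_cst (-1) oOm).
have := geoM oOm (seP lo) s2 Omx mu12 g1 g2.
rewrite (_ : 2 * (12 * (Lam / d x)) = 24 * Lam / d x); last by ring.
rewrite mulrCA -expRD (P_cat x (leq0n lo) lohi).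
rewrite (_ : P 0 lo x + P 0 lo x / 2 + (P lo hi x + P lo hi x / 2) =
  P 0 lo x + P lo hi x + (P 0 lo x + P lo hi x) / 2); last by ring.
apply: (geo_congr oOm) => // y Omy.
by rewrite /eP mulrBr mulr1 -expRD -(P_cat y (leq0n lo) lohi).
Qed.

(** The order [m] of decay is independent of the word [s], so it can be chosen afresh at each point
    and for each Leibniz term. *)
Definition flat_bound (Om' : set 'rV[R]_n) Cf tau F := smooth_on Om' F /\
  forall x, Om' x -> forall s m, `|pderivs s F x| <=
    Cf * ((size s)`!%:R * (tau ^+ size s * M (size s))) *
      ((T * Num.sqrt (sumsq phi x)) ^+ m * M m).

Section Division.
Variables (Om' : set 'rV[R]_n) (F : 'rV[R]_n -> R) (Cf tau : R).
Hypotheses (oOm' : open Om') (subOm : Om' `<=` Om) (Cf0 : 0 <= Cf) (tau0 : 0 < tau).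
Hypothesis FF : flat_bound Om' Cf tau F.

Let sF : smooth_on Om' F. Proof. by case: FF. Qed.
Let sigma := 2 * Num.max tau (24 * Lam * S).
Let sigma_gt0 : 0 < sigma. Proof. by rewrite mulr_gt0 // lt_max tau0. Qed.

(** Leibniz' rule, in which [absorb] makes the decay of each derivative of [F] compensate the
    matching derivative of the exponentials. The factor [tail lo hi] turns this into a Cauchy
    estimate in one [C_{M,sigma}]. *)
Let diff_bound lo hi : (lo <= hi)%N ->
  CMR Om' sigma (Cf * G * tail lo hi) (fun y => F y * (eP hi y - eP lo y)).
Proof.
move=> lohi s x Omx'; have Omx := subOm Omx'; set m := size s.
set cc := Cf * G * tail lo hi; have cc0 : 0 <= cc by rewrite mulr_ge0 // mulr_ge0.
have sE' := smooth_sub subOm (seB lo hi).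
have L0 : 0 <= 24 * Lam by rewrite mulr_ge0.
(* Where [d x = 0], decay of order one already makes [F] flat, and the product is flat too. *)
have := d_ge0 x; rewrite le_eqVlt => /orP[/eqP d0|dx].
  rewrite (leibniz_flat oOm' s sF sE' Omx') ?normr0 => [|t].
    by rewrite mulr_ge0 // mulr_ge0 // mulr_ge0 ?(ltW (Mgt0 _)) // exprn_ge0 // ltW.
  have [_ /(_ x Omx' t 1%N)] := FF.
  by rewrite -/(d x) -d0 mulr0 expr0n /= mul0r mulr0 normr_le0 => /eqP.
have gE := geo_eB Omx dx lohi.
have ab t := absorb lo hi t dx L0.
(* [mm t] is the order of decay used when [t] derivatives fall on the exponentials. *)
pose mm t := projT1 (cid (ab t)); have abP t := projT2 (cid (ab t)); rewrite -/(mm _) in abP.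
set c1 := P lo hi x * _ in gE abP.
pose b k := Cf * (k`!%:R * (tau ^+ k * M k)) * ((T * d x) ^+ mm (m - k)%N * M (mm (m - k)%N)).
apply: le_trans (leibniz_bound (b := b) (c := fun k => k`!%:R * (c1 * (24 * Lam / d x) ^+ k))
  oOm' sF sE' Omx' (fun t _ => FF.2 x Omx' t (mm (m - size t)%N)) (fun t _ => gE t)) _.
rewrite -/m; apply: le_trans (_ : \sum_(k < m.+1)
    cc * (m`!%:R * ((sigma / 2) ^+ m * M m)) <= _).
  apply: ler_sum => k _; have km : (k <= m)%N by rewrite -ltnS.
  have R1 (u1 u2 u3 u4 u5 u6 u7 : R) : u1 * (u2 * (u3 * u4) * u5) * (u6 * u7) =
    u2 * (u1 * (u3 * u6)) * u4 * (u5 * u7) by ring.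
  rewrite /b R1 -!natrM bin_fact //.
  have z0 : 0 <= Cf * m`!%:R * (tau ^+ k * M k).
    by rewrite !mulr_ge0 ?exprn_ge0 ?(ltW tau0) // ltW.
  apply: le_trans (ler_wpM2l z0 (abP (m - k)%N)) _.
  have R2 (u1 u2 u3 u4 u5 u6 u7 u8 : R) : u1 * u2 * (u3 * u4) * (u5 * u6 * (u7 * u8)) =
    u1 * u5 * u6 * (u2 * ((u3 * u7) * (u4 * u8))) by ring.
  rewrite R2 -/cc.
  rewrite ler_wpM2l // ler_wpM2l //.
  have s2 : sigma / 2 = Num.max tau (24 * Lam * S) by rewrite /sigma mulrC mulKf.
  have LS : 0 <= 24 * Lam * S by rewrite mulr_ge0.
  apply: ler_pM; rewrite ?mulr_ge0 ?exprn_ge0 ?(ltW tau0) ?(ltW (Mgt0 _)) //.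
    rewrite s2 -[in leRHS](subnKC km) exprD; apply: ler_pM; rewrite ?exprn_ge0 ?(ltW tau0) //.
      by apply: lerXn2r; rewrite ?nnegrE ?le_max ?lexx ?(ltW tau0).
    by apply: lerXn2r; rewrite ?nnegrE ?le_max ?lexx ?LS ?orbT.
  by apply: le_trans (M_mul _ _) _; rewrite subnKC.
rewrite sumr_const card_ord -[leLHS]mulr_natl mulrCA ler_wpM2l //.
rewrite mulrCA ler_wpM2l // mulrA ler_wpM2r ?(ltW (Mgt0 _)) //.
rewrite exprMn exprVn mulrCA ler_piMr ?exprn_ge0 ?(ltW sigma_gt0) //.
by rewrite ler_pdivrMr ?exprn_gt0 // mul1r natrS_le_exp2.
Qed.

Let tail_bounded : exists2 c, 0 <= c & forall lo hi, tail lo hi <= c.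
Proof.
have a0q : 0 <= C * a 0%N ^+ (2 * q).
  by rewrite mulr_ge0 ?(ltW C0) // exprn_ge0 // (ltW (a_gt0 0%N)).
exists (C * a 0%N ^+ (2 * q)) => // lo hi.
have [lohi|hilo] := leqP lo hi; last first.
  by rewrite /tail big_geq // ltnW.
apply: le_trans (_ : tail 0 hi <= _).
  rewrite [leRHS](bigop.big_cat_nat (leq0n lo) lohi) /= lerDr; exact: tail_ge0.
have := qC 0 hi; rewrite mulr1; apply: le_trans.
apply: ler_sum => j _; apply: lerXn2r; rewrite ?nnegrE ?s_ge0 ?(ltW (a_gt0 _)) //.
by rewrite ler_pdivrMr // ler_peMr // ltW.
Qed.

Let tail_small (e : R) : 0 < e -> exists k0, forall lo hi, (k0 <= lo)%N -> (lo <= hi)%N ->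
  tail lo hi <= e.
Proof.
move=> e0; have [c c0 Hc] := tail_bounded.
have : cvgn (fun N => tail 0 N).
  apply: nondecreasing_is_cvgn.
    apply/nondecreasing_seqP => k.
    rewrite [leRHS](bigop.big_cat_nat (leq0n k) (leqnSn k)) /= lerDl; exact: tail_ge0.
  by exists c => _ [k _ <-].
move=> /cvg_ex[l /= /cvg_seqP /(_ (e / 2))]; rewrite divr_gt0 // => /(_ isT)[k0 Hk0].
exists k0 => lo hi h1 h2.
have -> : tail lo hi = (tail 0 hi - l) - (tail 0 lo - l).
  by rewrite /tail (bigop.big_cat_nat (leq0n lo) h2) /=; ring.
have := Hk0 lo h1; have := Hk0 hi (leq_trans h1 h2).
by rewrite !ler_norml; move: (tail 0 hi) (tail 0 lo) => u v; lra.
Qed.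

Let g_cvg x : Om' x -> exists l : R, (fun k => F x * E k x) @ \oo --> l.
Proof.
move=> Omx; apply: cauchy_seq_cvg => e e0.
have c0 : 0 <= Cf * G by rewrite mulr_ge0.
have c1 : 0 < Cf * G + 1 by rewrite ltr_wpDl.
have [k0 Hk0] := tail_small (divr_gt0 e0 c1).
have H i j : (k0 <= i)%N -> (i <= j)%N -> `|F x * E j x - F x * E i x| <= e.
  move=> ki ij; rewrite -mulrBr.
  have := @diff_bound i.+1 j.+1 ij [::] x Omx; rewrite /= fact0 expr0 M0 !mulr1.
  move=> H; apply: le_trans H _; have := Hk0 i.+1 j.+1 (leqW ki) ij.
  rewrite ler_pdivlMr // => H; apply: le_trans H.
  by rewrite mulrC ler_wpM2l // lerDl.
exists k0 => i j ki kj; have [ij|ji] := leqP i j; last by rewrite H // ltnW.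
by rewrite distrC H.
Qed.

Let g x : R := if pselect (Om' x) is left h then projT1 (cid (g_cvg h)) else 0.

Let g_lim x : Om' x -> (fun k => F x * E k x) @ \oo --> g x.
Proof.
move=> Omx; rewrite /g; case: pselect => // h; exact: (projT2 (cid (g_cvg h))).
Qed.

Let sFE k : smooth_on Om' (fun y => F y * E k y).
Proof. exact: smoothM oOm' sF (smooth_sub subOm (E_smooth k)). Qed.

Let FE_bound : exists c, forall k, CMR Om' sigma c (fun y => F y * E k y).
Proof.
have [c c0 Hc] := tail_bounded; exists (Cf + Cf * G * c) => k s x Omx.
have sD := smoothM oOm' sF (smooth_sub subOm (seB 0 k.+1)).
have E1 y : Om' y -> F y * E k y = F y + F y * (eP k.+1 y - eP 0 y).
  by move=> _; rewrite /eP /E [P 0 0 y]/(rweight _ _ _ _ _ _ _) /rweight big_geq // expR0; ring.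
rewrite (pderivs_congr s oOm' E1 Omx) (pderivsD s oOm' sF sD Omx).
apply: le_trans (ler_normD _ _) _; rewrite mulrDl; apply: lerD.
  have [_ /(_ x Omx s 0%N)] := FF; rewrite expr0 M0 !mulr1 => /le_trans; apply.
  rewrite ler_wpM2l // ler_wpM2l // ler_wpM2r ?(ltW (Mgt0 _)) //.
  apply: lerXn2r; rewrite ?nnegrE ?(ltW tau0) ?(ltW sigma_gt0) //.
  apply: le_trans (_ : Num.max tau (24 * Lam * S) <= _); first by rewrite le_max lexx.
  by rewrite /sigma ler_peMl ?ler1n // le_max (ltW tau0).
apply: le_trans (diff_bound (leq0n k.+1) s Omx) _; apply: ler_wpM2r.
  by rewrite mulr_ge0 // mulr_ge0 ?(ltW (Mgt0 _)) // exprn_ge0 // ltW.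
by apply: ler_wpM2l => //; exact: mulr_ge0.
Qed.

(** The Cauchy estimates of [diff_bound] keep their constant when the larger index goes to infinity,
    so [F E_k] tends to [g] in the norm of a single step. The third clause serves products of two
    flat germs, the last one closed ideals. *)
Lemma flat_division : exists g, [/\ smooth_on Om' g,
  forall x, Om' x -> F x = w x * g x,
  forall x s, Om' x -> (forall t, pderivs t F x = 0) -> pderivs s g x = 0 &
  exists2 sig, 0 < sig & (exists c, CMR Om' sig c g) /\
    forall e, 0 < e -> exists k0, forall k, (k0 <= k)%N -> CMR Om' sig e (fun y => F y * E k y - g y)].
Proof.
have [c Hc] := FE_bound.
have lim := @smooth_limit R n Om' (fun k y => F y * E k y) g
  (fun m => c * (m`!%:R * (sigma ^+ m * M m))) oOm' sFE Hc g_lim.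
exists g; split.
- by case: lim.
- move=> x Omx; have Omx' := subOm Omx.
  have H : (fun k => expR (- P 0 k.+1 x) * (F x * E k x)) @ \oo --> w x * g x.
    apply: cvgM; [exact: w_cvg|exact: g_lim].
  apply/esym; apply: (cvg_unique _ H) => //.
  rewrite (_ : (fun k => _) = fun=> F x); first exact: cvg_cst.
  apply/funext => k; rewrite mulrCA /E -expRD addrC subrr expR0 mulr1 //.
- move=> x s Omx F0; apply/eqP; rewrite -normr_le0.
  apply: (cvg_norm_le (lim.2 s x Omx)); exists 0%N => k _.
  by rewrite (leibniz_flat oOm' s sF (smooth_sub subOm (E_smooth k)) Omx F0) normr0.
exists sigma => //; split.
  exists c; exact: (@smooth_limit_bound R n Om' (fun k y => F y * E k y) g
    (fun m => c * (m`!%:R * (sigma ^+ m * M m))) oOm' sFE Hc g_lim).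
move=> e e0; have c0 : 0 <= Cf * G by rewrite mulr_ge0.
have c1 : 0 < Cf * G + 1 by rewrite ltr_wpDl.
have [k0 Hk] := tail_small (divr_gt0 e0 c1); exists k0 => k kk s x Omx.
have sD N : smooth_on Om' (fun y => F y * (eP (k + N).+1 y - eP k.+1 y)).
  exact: smoothM oOm' sF (smooth_sub subOm (seB k.+1 (k + N).+1)).
have bD N : CMR Om' sigma e (fun y => F y * (eP (k + N).+1 y - eP k.+1 y)).
  have le1 : (k.+1 <= (k + N).+1)%N by rewrite ltnS leq_addr.
  move=> t y Omy; apply: le_trans (diff_bound le1 t Omy) _; apply: ler_wpM2r.
    by rewrite mulr_ge0 // mulr_ge0 ?(ltW (Mgt0 _)) // exprn_ge0 // ltW.
  have := Hk _ _ (leqW kk) le1; rewrite ler_pdivlMr // => H; apply: le_trans H.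
  by rewrite mulrC ler_wpM2l // lerDl.
have lD y : Om' y -> (fun N => F y * (eP (k + N).+1 y - eP k.+1 y)) @ \oo --> g y - F y * E k y.
  move=> Omy; rewrite (_ : (fun N => _) = (fun N => F y * E (N + k)%N y - F y * E k y)).
    apply: cvgB; last exact: cvg_cst.
    by have := g_lim Omy; rewrite -(cvg_shiftn k).
  by apply/funext => N; rewrite mulrBr addnC.
have := @smooth_limit_bound R n Om' (fun N y => F y * (eP (k + N).+1 y - eP k.+1 y))
  (fun y => g y - F y * E k y) (fun m => e * (m`!%:R * (sigma ^+ m * M m))) oOm' sD bD lD s x Omx.
have sg : smooth_on Om' g by case: lim.
by rewrite (pderivsB s oOm' sg (sFE k) Omx) (pderivsB s oOm' (sFE k) sg Omx) distrC.
Qed.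

End Division.

Lemma flat_weight : exists (w : 'rV[R]_n -> R) (E : nat -> 'rV[R]_n -> R),
  [/\ smooth_on Om w /\ (exists2 sig, 0 < sig & CMR Om sig 1 w),
     forall x s, Om x -> sumsq phi x = 0 -> pderivs s w x = 0,
     forall k, smooth_on Om (E k) /\ (exists c sig, 0 < sig /\ CMR Om sig c (E k)) &
     forall Om' F Cf tau, open Om' -> Om' `<=` Om -> 0 <= Cf -> 0 < tau ->
       flat_bound Om' Cf tau F -> exists g, [/\ smooth_on Om' g,
         forall x, Om' x -> F x = w x * g x,
         forall x s, Om' x -> (forall t, pderivs t F x = 0) -> pderivs s g x = 0 &
         exists2 sig, 0 < sig & (exists c, CMR Om' sig c g) /\
           forall e, 0 < e -> exists k0, forall k, (k0 <= k)%N -> CMR Om' sig e (fun y => F y * E k y - g y)]].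
Proof.
exists w, E; split.
- split; first by case: w_smooth.
  have z : 0 <= 6 * Lam * B by apply: mulr_ge0; [exact: mulr_ge0|exact: ltW].
  exists (6 * Lam * B + 1) => [|s x Omx]; first exact: ltr_wpDl.
  apply: le_trans (w_CMR s Omx) _; rewrite !mul1r ler_wpM2l // ler_wpM2r ?(ltW (Mgt0 _)) //.
  by apply: lerXn2r; rewrite ?nnegrE ?addr_ge0 // lerDl.
- by move=> x s Omx rx; exact: (w_flat s Omx rx).
- by move=> k; split; [exact: E_smooth|exact: E_CMR].
- by move=> Om' F Cf tau oOm' sub Cf0 tau0 FF; exact: flat_division FF.
Qed.

End FlatWeights.

Section StronglyRegularConstants.
Variables (R : realType) (M : nat -> R).

(** The conditions survive enlarging [A], and [A >= 1] makes its powers monotone in the exponent. *)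
Lemma strongly_regular_ge1 : strongly_regular M -> exists A : R,
  [/\ 1 <= A, (M 0%N = 1 /\ (forall j, M j <= M j.+1)),
      forall j, M j.+1 / M j <= M j.+2 / M j.+1,
      forall j k, M (j + k)%N <= A ^+ (j + k) * M j * M k &
      forall l, (\sum_(l <= j <oo) (M j / (j.+1%:R * M j.+1))%:E
                   <= (A * (M l / M l.+1))%:E)%E].
Proof.
move=> [A [A0 [[M0 Mmono] Mconv Mgrow Msum]]].
have Mpos j : 0 < M j := M_gt0 M0 Mmono j.
exists (Num.max 1 A); split=> // [|j k|l].
- by rewrite le_max lexx.
- apply: le_trans (Mgrow j k) _; rewrite -!mulrA ler_wpM2r //.
    by rewrite mulr_ge0 // ltW.
  by apply: lerXn2r; rewrite ?nnegrE ?le_max ?lexx ?ler01 ?(ltW A0) ?orbT.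
- apply: le_trans (Msum l) _; rewrite lee_fin ler_wpM2r //.
    by rewrite divr_ge0 // ltW.
  by rewrite le_max lexx orbT.
Qed.

End StronglyRegularConstants.

(** The order of the quantifiers matters: [w] and [E] precede [F] and see only its decay rate [T],
    so that the real and imaginary parts of a germ are divided by one and the same weight. *)
Theorem flat_weight_exists (R : realType) (n : nat) (Om : set 'rV[R]_n) (r : nat)
    (phi : 'I_r -> 'rV[R]_n -> R) (Cphi lam : R) (M : nat -> R) (T : R) :
  open Om -> (forall i, smooth_on Om (phi i)) -> 1 <= Cphi -> 0 <= lam ->
  (forall i s x, Om x ->
    `|pderivs s (phi i) x| <= (size s)`!%:R * (Cphi * lam ^+ size s)) ->
  (forall x, Om x -> sumsq phi x <= 1) ->
  strongly_regular M -> 0 <= T ->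
  exists (w : 'rV[R]_n -> R) (E : nat -> 'rV[R]_n -> R),
  [/\ smooth_on Om w /\ (exists2 sig, 0 < sig & word_bound M Om sig 1 w),
     forall x s, Om x -> sumsq phi x = 0 -> pderivs s w x = 0,
     forall k, smooth_on Om (E k) /\ (exists c sig, 0 < sig /\ word_bound M Om sig c (E k)) &
     forall Om' F Cf tau, open Om' -> Om' `<=` Om -> 0 <= Cf -> 0 < tau ->
       flat_bound phi M T Om' Cf tau F -> exists g, [/\ smooth_on Om' g,
         forall x, Om' x -> F x = w x * g x,
         forall x s, Om' x -> (forall t, pderivs t F x = 0) -> pderivs s g x = 0 &
         exists2 sig, 0 < sig & (exists c, word_bound M Om' sig c g) /\
           forall e, 0 < e -> exists k0, forall k, (k0 <= k)%N ->
             word_bound M Om' sig e (fun y => F y * E k y - g y)]].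
Proof.
move=> oOm sphi C1 lam0 bphi rho1 hM T0.
have [A [A1 [M0 Mmono] Mconv Mgrow Msum]] := strongly_regular_ge1 hM.
have A0 : 0 < A by exact: lt_le_trans A1.
have [q [C [_ C0 qC]]] := qt_pow_sum A0 M0 Mmono Mconv Msum.
(* Then [exp(K / 4) = exp(A^2) >= A^2]. *)
pose K := 4 * A ^+ 2; have K0 : 0 <= K by rewrite mulr_ge0 // sqr_ge0.
have KA : A ^+ 2 <= expR (K / 4).
  rewrite /K mulrAC divff // mul1r; apply: le_trans (expR_ge1Dx _).
  by rewrite lerDr.
pose B := Num.max 1 (A ^+ 2 * T * expR (3 / 2 * (K * (1 + C)))).
have B1 : 1 <= B by rewrite le_max lexx.
have BT : A ^+ 2 * T * expR (3 / 2 * (K * (1 + C))) <= B by rewrite le_max lexx orbT.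
exact: (flat_weight oOm sphi C1 lam0 bphi rho1 A1 M0 Mmono Mconv Mgrow Msum C0 qC K0 KA B1 T0 BT).
Qed.

(** * Real-analytic submanifolds *)

Lemma summable_seq_le (R : realType) (T : choiceType) (f : T -> R) :
  summable [set: T] (fun t => (f t)%:E) ->
  exists2 S : R, 0 <= S & forall r : seq T, uniq r -> \sum_(t <- r) `|f t| <= S.
Proof.
rewrite /summable; set e := esum _ _ => fin.
have H r : uniq r -> ((\sum_(t <- r) `|f t|)%:E <= e)%E.
  move=> ur; apply: esum_ge; exists [set` r]; first by split.
  by rewrite -fsbig_seq // -sumEFin.
have e0 : (0 <= e)%E by have := H [::] isT; rewrite big_nil.
exists (fine e); first exact: fine_ge0.
move=> r ur; rewrite -lee_fin fineK; first exact: H.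
by rewrite ge0_fin_numE.
Qed.

Section PowerSeries.
Variables (R : realType) (n : nat).
Implicit Types (f g : 'rV[R]_n -> R) (x : 'rV[R]_n).

Let oT : open [set: 'rV[R]_n]. Proof. exact: openT. Qed.

(** The jet bounds of a monomial of degree [N] at points of norm at most [rad]; Vandermonde's
    identity makes the degrees add up under products. *)
Definition bin_jet (rad : R) f x (N : nat) := forall s : seq 'I_n,
  `|pderivs s f x| <= (size s)`!%:R * ('C(N, size s)%:R * (rad ^+ N * rad ^- size s)).

Lemma bin_jetM (rad : R) f g x N N' : 0 < rad ->
  smooth_on setT f -> smooth_on setT g ->
  bin_jet rad f x N -> bin_jet rad g x N' -> bin_jet rad (fun y => f y * g y) x (N + N').
Proof.
move=> rad0 sf sg Hf Hg s; set m := size s.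
apply: le_trans (leibniz_bound
  (b := fun k => k`!%:R * ('C(N, k)%:R * (rad ^+ N * rad ^- k)))
  (c := fun k => k`!%:R * ('C(N', k)%:R * (rad ^+ N' * rad ^- k)))
  oT sf sg I (fun t _ => Hf t) (fun t _ => Hg t)) _.
rewrite -/m -binomial.Vandermonde natr_sum mulr_suml mulr_sumr; apply: ler_sum => k _.
have km : (k <= m)%N by rewrite -ltnS.
have -> : rad ^- m = rad ^- k * rad ^- (m - k) by rewrite -invfM -exprD subnKC.
have R1 (u1 u2 u3 u4 u5 u6 u7 u8 u9 : R) :
  u1 * (u2 * (u3 * (u4 * u5))) * (u6 * (u7 * (u8 * u9))) =
  (u1 * (u2 * u6)) * ((u3 * u7) * ((u4 * u8) * (u5 * u9))) by ring.
by rewrite R1 -!natrM bin_fact // -exprD.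
Qed.

Lemma is_derive_coord i x v : is_derive x v (fun y : 'rV[R]_n => y 0 i) (v 0 i).
Proof.
apply/is_derive_epsP => e e0; exists 1; split=> // h _.
rewrite !mxE (_ : x 0 i + h * v 0 i - x 0 i - h * v 0 i = 0); last by ring.
by rewrite normr0 mulr_ge0 // ltW.
Qed.

Lemma pderiv_coord i j x : pderiv j (fun y : 'rV[R]_n => y 0 i) x = (j == i)%:R.
Proof. by have [_] := is_derive_coord i x (ax R j); rewrite mxE eqxx eq_sym. Qed.

Lemma pderivs_coord i s x : (1 < size s)%N -> pderivs s (fun y : 'rV[R]_n => y 0 i) x = 0.
Proof.
case/lastP: s => // s j; rewrite size_rcons ltnS => s0; rewrite pderivs_rcons.
rewrite (_ : pderiv j _ = fun=> (j == i)%:R); last by apply/funext => y; exact: pderiv_coord.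
exact: pderivs_cst oT _ _ _.
Qed.

Lemma smooth_coord i : smooth_on setT (fun y : 'rV[R]_n => y 0 i).
Proof.
apply/smoothP => s x _; case: s => [|j s].
  split=> [|j /=]; first exact: coord_continuous.
  by have [] := is_derive_coord i x (ax R j).
have E : pderivs (j :: s) (fun y : 'rV[R]_n => y 0 i) =
    fun=> if (0 < size s)%N then 0 else (j == i)%:R.
  apply/funext => y; case: s => [|k s]; first exact: pderiv_coord.
  by rewrite pderivs_coord.
by rewrite E; split=> [|k]; [exact: cst_continuous|exact: derivable_cst].
Qed.

Lemma bin_jet_coord rad i x : 0 < rad -> `|x| <= rad -> bin_jet rad (fun y => y 0 i) x 1.
Proof.
move=> rad0 xr s; have [s2|] := ltnP 1 (size s).
  rewrite pderivs_coord // normr0 mulr_ge0 // mulr_ge0 // mulr_ge0 ?invr_ge0 ?exprn_ge0 ?ltW //.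
case: s => [_|j [_|//]] /=.
  rewrite fact0 bin0 expr1 expr0 invr1 !mulr1 !mul1r.
  exact: le_trans (rV_coord_le x i) xr.
rewrite pderiv_coord expr1 divff ?(lt0r_neq0 rad0) // binn !mul1r.
by case: (j == i); rewrite ?normr1 ?normr0.
Qed.

Lemma bin_jet_cst1 rad x : 0 < rad -> bin_jet rad (fun=> 1) x 0.
Proof.
move=> rad0 [|i s]; first by rewrite /= fact0 bin0 !expr0 invr1 !mulr1 normr1.
by rewrite (pderivs_cst (s := i :: s) _ oT) // normr0 bin0n mul0r mulr0.
Qed.

Lemma smooth_monomial (J : mindex n) : smooth_on setT (fun x => monomial x J).
Proof.
rewrite /monomial; elim: (index_enum _) => [|i r IH].
  by apply: smooth_congr oT _ (smooth_cst 1 oT) => y _; rewrite big_nil.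
apply: smooth_congr oT _ (smoothM oT (smoothX (J i) oT (smooth_coord i)) IH) => y _.
by rewrite big_cons.
Qed.

Lemma bin_jet_congr rad f g x N : (forall y, f y = g y) -> bin_jet rad f x N -> bin_jet rad g x N.
Proof. by move=> /funext ->. Qed.

Lemma bin_jet_monomial rad (J : mindex n) x : 0 < rad -> `|x| <= rad ->
  bin_jet rad (fun x => monomial x J) x (mlength J).
Proof.
move=> rad0 xr; rewrite /monomial /mlength.
have P i k : smooth_on setT (fun y : 'rV[R]_n => y 0 i ^+ k) := smoothX k oT (smooth_coord i).
have HP i k : bin_jet rad (fun y => y 0 i ^+ k) x k.
  elim: k => [|k IH]; first by apply: bin_jet_congr (bin_jet_cst1 x rad0) => y; rewrite expr0.
  apply: bin_jet_congr (bin_jetM rad0 (smooth_coord i) (P i k) (bin_jet_coord i rad0 xr) IH) => y.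
  by rewrite exprS.
suff [] : smooth_on setT (fun y : 'rV[R]_n => \prod_(i < n) y 0 i ^+ J i) /\
  bin_jet rad (fun y => \prod_(i < n) y 0 i ^+ J i) x (\sum_(i < n) J i)%N by [].
elim: (index_enum _) => [|i r [IH1 IH2]].
  split; first by apply: smooth_congr oT _ (smooth_cst 1 oT) => y _; rewrite big_nil.
  by rewrite big_nil; apply: bin_jet_congr (bin_jet_cst1 x rad0) => y; rewrite big_nil.
split; first by apply: smooth_congr oT _ (smoothM oT (P i (J i)) IH1) => y _; rewrite big_cons.
rewrite big_cons; apply: bin_jet_congr (bin_jetM rad0 (P i (J i)) IH1 (HP i (J i)) IH2) => y.
by rewrite big_cons.
Qed.

Lemma monomial_const_mx (r : R) (J : mindex n) : monomial (const_mx r) J = r ^+ mlength J.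
Proof.
by rewrite /monomial /mlength -prodrXr; apply: eq_bigr => i _; rewrite mxE.
Qed.

End PowerSeries.

Section AnalyticAtZero.
Variables (R : realType) (n : nat).
Implicit Types (x y : 'rV[R]_n).

Lemma bin_le_exp2 N k : ('C(N, k) <= 2 ^ N)%N.
Proof.
elim: N k => [|N IH] [|k]; rewrite ?bin0 ?expn_gt0 // ?bin0n //.
by rewrite binS expnS mul2n -addnn leq_add.
Qed.

Lemma norm_const_mx_le (r : R) : 0 <= r -> `|const_mx r : 'rV[R]_n| <= r.
Proof. by move=> r0; apply: rV_norm_le => // i; rewrite mxE ger0_norm. Qed.

(** One integer controls the radius, the constant and the rate, so that finitely many functions get
    common bounds from a maximum. *)
Definition jet_class (N : nat) (g : 'rV[R]_n -> R) :=
  smooth_on (ball (0 : 'rV[R]_n) N%:R^-1) g /\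
  forall s x, ball 0 N%:R^-1 x -> `|pderivs s g x| <= (size s)`!%:R * (N%:R * N%:R ^+ size s).

Lemma jet_class_le N N' g : (0 < N)%N -> (N <= N')%N -> jet_class N g -> jet_class N' g.
Proof.
move=> N0 NN [sg bg].
have sub : ball (0 : 'rV[R]_n) N'%:R^-1 `<=` ball 0 N%:R^-1.
  by apply: le_ball; rewrite lef_pV2 ?posrE ?ltr0n ?(leq_trans N0) // ler_nat.
split; first exact: smooth_sub sg.
move=> s x /sub bx; apply: le_trans (bg s x bx) _; rewrite ler_wpM2l //.
by apply: ler_pM; rewrite ?exprn_ge0 ?ler_nat // lerXn2r ?nnegrE // ler_nat.
Qed.

(** The polynomial partial sums satisfy Cauchy estimates uniformly in [N], and [smooth_limit] passes
    them to the sum without differentiating the series term by term. *)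
Lemma real_analytic_jet U g : U 0 -> real_analytic_on U g ->
  exists N, (0 < N)%N /\ jet_class N g.
Proof.
move=> U0 /(_ 0 U0)[c [r [r0 H]]]; pose rad := r / 4.
have rad0 : 0 < rad by rewrite divr_gt0.
(* At this point the monomial of index [J] is [2^|J| rad^|J|], and [2^|J|] dominates the binomial
   coefficients in the jets at radius [rad]; [rad = r / 4] keeps [h0] inside the domain of
   convergence. *)
pose h0 : 'rV[R]_n := const_mx (2 * rad).
have h0r : `|h0| < r.
  have : `|h0| <= 2 * rad by apply: norm_const_mx_le; rewrite mulr_ge0 // ltW.
  move=> /le_lt_trans; apply; rewrite /rad; lra.
have [S S0 HS] := summable_seq_le (H h0 h0r).1.
pose Jof N (k : {ffun 'I_n -> 'I_N}) : mindex n := [ffun i => nat_of_ord (k i)].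
pose G N x := \sum_(k : {ffun 'I_n -> 'I_N}) c (Jof N k) * monomial x (Jof N k).
have sG N : smooth_on setT (G N).
  apply: smooth_sum => [|k _]; first exact: openT.
  exact: smoothM openT (smooth_cst _ openT) (smooth_monomial _).
have ballT : ball (0 : 'rV[R]_n) rad `<=` setT by [].
have obr : open (ball (0 : 'rV[R]_n) rad) by exact: ball_open.
have bG N s x : ball 0 rad x -> `|pderivs s (G N) x| <= (size s)`!%:R * (S * rad ^- size s).
  rewrite -ball_normE /ball_ /= sub0r normrN => /ltW xr.
  rewrite (pderivs_sum (index_enum _) s openT) //; last first.
    by move=> k _; exact: smoothM openT (smooth_cst _ openT) (smooth_monomial _).
  apply: le_trans (ler_norm_sum _ _ _) _.
  pose rs : seq (mindex n) := map (@Jof N) (index_enum _).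
  have urs : uniq rs.
    rewrite map_inj_uniq ?index_enum_uniq // => k k' /ffunP E; apply/ffunP => i.
    by apply: val_inj; have := E i; rewrite !ffunE.
  apply: le_trans (_ : (size s)`!%:R * ((\sum_(J <- rs) `|c J * monomial h0 J|) * rad ^- size s) <= _);
    last first.
    by rewrite ler_wpM2l // ler_wpM2r ?invr_ge0 ?exprn_ge0 ?(ltW rad0) // HS.
  rewrite big_map mulr_suml mulr_sumr; apply: ler_sum => k _; set J := Jof N k.
  rewrite (pderivsZ _ _ openT (smooth_monomial J)) // normrM normrM.
  have := bin_jet_monomial J rad0 xr s => /(ler_wpM2l (normr_ge0 (c J)))/le_trans; apply.
  rewrite mulrCA ler_wpM2l // -mulrA ler_wpM2l // mulrA.
  rewrite ler_wpM2r ?invr_ge0 ?exprn_ge0 ?(ltW rad0) //.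
  rewrite monomial_const_mx ger0_norm; last by rewrite exprn_ge0 // mulr_ge0 // ltW.
  rewrite [leRHS]exprMn.
  rewrite ler_wpM2r ?exprn_ge0 ?(ltW rad0) // -natrX ler_nat.
  exact: bin_le_exp2.
have limG x : ball 0 rad x -> (fun N => G N x) @ \oo --> g x.
  rewrite -ball_normE /ball_ /= sub0r normrN => xr.
  have xr' : `|x| < r by apply: lt_trans xr _; rewrite /rad; lra.
  by have [_] := H x xr'; rewrite add0r.
have sGb N : smooth_on (ball (0 : 'rV[R]_n) rad) (G N) := smooth_sub ballT (sG N).
have [sg _] := smooth_limit (B := fun m => m`!%:R * (S * rad ^- m)) obr sGb bG limG.
have bg := smooth_limit_bound (B := fun m => m`!%:R * (S * rad ^- m)) obr sGb bG limG.
pose N := (Num.truncn (Num.max S rad^-1)).+1.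
have NS : Num.max S rad^-1 <= N%:R by rewrite ltW // truncnS_gt.
have N1 : S <= N%:R by apply: le_trans NS; rewrite le_max lexx.
have N2 : rad^-1 <= N%:R by apply: le_trans NS; rewrite le_max lexx orbT.
have sub : ball (0 : 'rV[R]_n) N%:R^-1 `<=` ball 0 rad.
  by apply: le_ball; rewrite -[leRHS]invrK lef_pV2 ?posrE ?invr_gt0 ?ltr0n.
exists N; split=> //; split; first exact: smooth_sub sg.
move=> s x /sub bx; apply: le_trans (bg s x bx) _; rewrite ler_wpM2l //.
apply: ler_pM => //; first by rewrite invr_ge0 exprn_ge0 // ltW.
by rewrite -exprVn; apply: lerXn2r; rewrite ?nnegrE ?invr_ge0 ?(ltW rad0).
Qed.

Lemma analytic_map_jet U phi : U 0 -> analytic_map_on U phi ->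
  exists N, (0 < N)%N /\ forall i, jet_class N (fun x => phi x 0 i).
Proof.
move=> U0 aphi.
have H i := real_analytic_jet U0 (aphi i).
pose Nf i := projT1 (cid (H i)); have HN i := projT2 (cid (H i)).
exists (\max_i Nf i).+1; split=> // i; have [N0 jN] := HN i.
by apply: jet_class_le jN => //; apply: leqW; exact: (leq_bigmax i).
Qed.

Lemma jet_class_lipschitz N (phi : 'rV[R]_n -> 'rV[R]_n) :
  (forall i, jet_class N (fun x => phi x 0 i)) ->
  forall x y, ball 0 N%:R^-1 x -> ball 0 N%:R^-1 y ->
  `|phi x - phi y| <= n%:R * N%:R ^+ 2 * `|x - y|.
Proof.
move=> H x y bx yb; apply: rV_norm_le => [|i].
  by rewrite mulr_ge0 // mulr_ge0 // exprn_ge0.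
have [l [l1 p]] := box_path bx yb; have [si bi] := H i; rewrite !mxE.
have B j z : ball 0 N%:R^-1 z -> `|pderiv j (fun x => phi x 0 i) z| <= N%:R ^+ 2.
  by move=> /(bi [:: j] z); rewrite /= mul1r expr2.
apply: le_trans (path_lipschitz (smooth_regular si) B p) _.
by rewrite mulrAC; apply: ler_wpM2r => //; rewrite exprn_ge0.
Qed.

(** The equations are the coordinates of [phi] of index at least [k], padded with zeros to [n]
    functions. The nearby point of [X] is [psi] applied to the projection of [phi x] onto the linear
    model, and the Lipschitz bounds on [phi] and [psi] give both estimates. *)
Lemma submanifold_chart (X : set 'rV[R]_n) : analytic_submanifold_germ X ->
  exists (ph : 'I_n -> 'rV[R]_n -> R) (C lam r0 L : R),
  [/\ 0 < r0, 1 <= C, 0 <= lam & 1 <= L] /\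
  [/\ forall i, smooth_on (ball 0 r0) (ph i),
      forall i s x, ball 0 r0 x -> `|pderivs s (ph i) x| <= (size s)`!%:R * (C * lam ^+ size s),
      forall x, ball 0 r0 x -> sumsq ph x <= 1,
      forall x, ball 0 r0 x -> X x -> sumsq ph x = 0 &
      forall x, ball 0 r0 x -> exists y, [/\ X y, `|x - y| <= L * Num.sqrt (sumsq ph x) &
        `|y| <= L * `|x|]].
Proof.
move=> [k [U [V [phi [psi [kn [[oU U0] [oV V0]] [aphi apsi phi0] [HU HV] HX]]]]]].
have [N1 [N10 J1]] := analytic_map_jet U0 aphi.
have [N2 [N20 J2]] := analytic_map_jet V0 apsi.
pose N := (N1 + N2)%N; have N0 : (0 < N)%N by rewrite addn_gt0 N10.
have {}J1 i : jet_class N (fun x => phi x 0 i) := jet_class_le N10 (leq_addr _ _) (J1 i).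
have {}J2 i : jet_class N (fun x => psi x 0 i) := jet_class_le N20 (leq_addl _ _) (J2 i).
have lip1 := jet_class_lipschitz J1; have lip2 := jet_class_lipschitz J2.
have [rU [rU0 subU]] := open_ball_sub oU U0; have [rV [rV0 subV]] := open_ball_sub oV V0.
have Nge1 : 1 <= N%:R :> R by rewrite ler1n.
pose Lam : R := n.+1%:R * N%:R ^+ 2.
have Lam1 : 1 <= Lam by rewrite mulr_ege1 ?ler1n // exprn_ege1.
have Lam0 : 0 < Lam by exact: lt_le_trans Lam1.
have nLam : n%:R * N%:R ^+ 2 <= Lam by rewrite ler_wpM2r ?exprn_ge0 // ler_nat.
have Ninv0 : 0 < N%:R^-1 :> R by rewrite invr_gt0 ltr0n.
have {}lip1 x y : ball 0 N%:R^-1 x -> ball 0 N%:R^-1 y -> `|phi x - phi y| <= Lam * `|x - y|.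
  by move=> bx yb; apply: le_trans (lip1 _ _ bx yb) _; rewrite ler_wpM2r.
have {}lip2 x y : ball 0 N%:R^-1 x -> ball 0 N%:R^-1 y -> `|psi x - psi y| <= Lam * `|x - y|.
  by move=> bx yb; apply: le_trans (lip2 _ _ bx yb) _; rewrite ler_wpM2r.
(* Within [r1] the values of [phi] and their projections stay in the domain of [psi], and the bound
   [1 / (n+1)] makes a sum of [n] squares at most one. *)
pose r1 : R := Num.min N%:R^-1 (Num.min rV n.+1%:R^-1).
have r10 : 0 < r1 by rewrite !lt_min Ninv0 rV0 invr_gt0 ltr0n.
pose r0 : R := Num.min N%:R^-1 (Num.min rU (r1 / Lam)).
have r00 : 0 < r0 by rewrite !lt_min Ninv0 rU0 divr_gt0.
have inU x : ball 0 r0 x -> U x.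
  by move=> bx; apply: subU; apply: le_ball bx; rewrite /r0 !ge_min lexx orbT.
have inN x : ball 0 r0 x -> ball 0 N%:R^-1 x.
  by move=> bx; apply: le_ball bx; rewrite /r0 !ge_min lexx.
have ph_small x : ball 0 r0 x -> `|phi x| <= Lam * `|x| /\ `|phi x| < r1.
  move=> bx; have := lip1 x 0 (inN x bx) (ballxx _ Ninv0); rewrite phi0 !subr0 => H.
  split=> //; apply: le_lt_trans H _.
  have : `|x| < r1 / Lam.
    move: bx; rewrite -ball_normE /ball_ /= sub0r normrN => /lt_le_trans; apply.
    by rewrite /r0 !ge_min lexx !orbT.
  by rewrite ltr_pdivlMr // mulrC.
pose ph (i : 'I_n) : 'rV[R]_n -> R := if (k <= i)%N then (fun x => phi x 0 i) else fun=> 0.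
pose pr (z : 'rV[R]_n) : 'rV[R]_n := \row_i (if (k <= i)%N then 0 else z 0 i).
have ob : open (ball (0 : 'rV[R]_n) r0) by exact: ball_open.
have subN : ball (0 : 'rV[R]_n) r0 `<=` ball 0 N%:R^-1 by [].
exists ph, N%:R, N%:R, r0, (Lam ^+ 2); split; first by split=> //; rewrite exprn_ege1.
split.
- move=> i; rewrite /ph; case: ifP => _; last exact: smooth_cst.
  exact: smooth_sub subN (J1 i).1.
- move=> i s x bx; rewrite /ph; case: ifP => _; first exact: (J1 i).2 (inN x bx).
  have : `|pderivs s (fun=> 0) x| = 0 :> R.
    case: s => [|j s]; first by rewrite normr0.
    by rewrite (pderivs_cst (s := j :: s) _ ob) // normr0.
  by move=> ->; rewrite mulr_ge0 // mulr_ge0 // exprn_ge0.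
- move=> x bx; have [_ xr] := ph_small x bx.
  have b i : ph i x ^+ 2 <= n.+1%:R^-1.
    have n1 : 0 <= n.+1%:R^-1 :> R by rewrite invr_ge0.
    have n2 : n.+1%:R^-1 <= 1 :> R by rewrite invf_le1 ?ltr0n // ler1n.
    have : `|ph i x| <= n.+1%:R^-1.
      rewrite /ph; case: ifP => _; last by rewrite normr0.
      apply: le_trans (rV_coord_le _ _) _; apply: le_trans (ltW xr) _.
      by rewrite /r1 !ge_min lexx !orbT.
    rewrite -real_normK ?num_real // => H; rewrite expr2 -[leRHS]mul1r; apply: ler_pM => //.
    exact: le_trans H n2.
  apply: le_trans (_ : \sum_(i < n) n.+1%:R^-1 <= _); first exact: ler_sum.
  rewrite sumr_const card_ord -[leLHS]mulr_natl ler_pdivrMr ?ltr0n // mul1r ler_nat //.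
- move=> x bx Xx; rewrite /sumsq big1 // => i _; rewrite /ph; case: ifP => ki.
    by rewrite ((HX x (inU x bx)).1 Xx i ki) expr0n.
  by rewrite expr0n.
- move=> x bx; have [xL xr] := ph_small x bx.
  have Vb z : `|z| < r1 -> V z /\ ball 0 N%:R^-1 z.
    rewrite /r1 !lt_min => /and3P[z1 z2 _]; split; last by rewrite -ball_normE /ball_ /= sub0r normrN.
    by apply: subV; rewrite -ball_normE /ball_ /= sub0r normrN.
  have prle : `|pr (phi x)| <= `|phi x|.
    apply: rV_norm_le => // i; rewrite mxE; case: ifP => _; first by rewrite normr0.
    exact: rV_coord_le.
  have [Vp Np] := Vb _ (le_lt_trans prle xr); have [Vx Nx] := Vb _ xr.
  have [Uy Ey] := HV _ Vp; have [_ Ex] := HU x (inU x bx).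
  exists (psi (pr (phi x))); split.
  + by apply/(HX _ Uy) => i ki; rewrite Ey mxE ki.
  + rewrite -{1}Ex; apply: le_trans (lip2 _ _ Nx Np) _.
    apply: le_trans (_ : Lam * Num.sqrt (sumsq ph x) <= _); last first.
      by rewrite ler_wpM2r ?sqrtr_ge0 // expr2 ler_peMr // ltW.
    rewrite ler_wpM2l ?(ltW Lam0) //; apply: rV_norm_le => [|i]; first exact: sqrtr_ge0.
    rewrite !mxE; case: ifP => ki; last by rewrite subrr normr0 sqrtr_ge0.
    rewrite subr0 -sqrtr_sqr ler_wsqrtr // /sumsq (bigD1 i) //= /ph ki lerDl.
    by apply: sumr_ge0 => j _; exact: sqr_ge0.
  + have [_ psi0] := HU 0 U0; rewrite phi0 in psi0.
    have := lip2 _ 0 Np (ballxx _ Ninv0); rewrite psi0 !subr0 => /le_trans; apply.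
    rewrite expr2 -mulrA ler_wpM2l ?(ltW Lam0) //; exact: le_trans prle xL.
Qed.

End AnalyticAtZero.

(** * Germs and their representatives *)

Section ComplexNorm.
Variable R : realType.
Implicit Types (a b : R).

Lemma normc_le a b : Normc.normc (Complex a b) <= `|a| + `|b|.
Proof.
rewrite /Normc.normc -[leRHS]ger0_norm ?addr_ge0 // -sqrtr_sqr ler_wsqrtr //.
rewrite sqrrD !real_normK ?num_real // [leRHS]addrAC lerDl.
by rewrite mulrn_wge0 // mulr_ge0.
Qed.

Lemma normc_re a b : `|a| <= Normc.normc (Complex a b).
Proof. by rewrite /Normc.normc -sqrtr_sqr ler_wsqrtr // lerDl sqr_ge0. Qed.

Lemma normc_im a b : `|b| <= Normc.normc (Complex a b).
Proof. by rewrite /Normc.normc -sqrtr_sqr ler_wsqrtr // lerDr sqr_ge0. Qed.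

End ComplexNorm.

Section MultiIndexWords.
Variables (R : realType) (n : nat).

Definition mword (J : mindex n) : seq 'I_n := flatten [seq nseq (J i) i | i <- enum 'I_n].

Lemma mderivR_word J (g : 'rV[R]_n -> R) : mderivR J g = pderivs (mword J) g.
Proof.
rewrite /mderivR /mword; elim: (enum _) => //= i s ->; rewrite pderivs_cat.
by elim: (J i) => //= k ->.
Qed.

Lemma size_mword J : size (mword J) = mlength J.
Proof.
rewrite /mword size_flatten /shape -map_comp sumnE big_map /mlength big_enum.
by apply: eq_bigr => i _; rewrite /= size_nseq.
Qed.

Definition word_index (s : seq 'I_n) : mindex n := [ffun i => count_mem i s].

Lemma perm_word_index s : perm_eq s (mword (word_index s)).
Proof.
apply/allP => i _ /=; apply/eqP.
rewrite /mword count_flatten -map_comp sumnE big_map big_enum (bigD1 i) //=.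
rewrite count_nseq /= eqxx mul1n ffunE big1 ?addn0 // => j ji.
by rewrite count_nseq /= (negbTE ji) mul0n.
Qed.

Lemma mlength_word_index s : mlength (word_index s) = size s.
Proof. by rewrite -size_mword (perm_size (perm_word_index s)). Qed.

End MultiIndexWords.

Section RealClass.
Variables (R : realType) (n : nat) (M : nat -> R).
Hypothesis hM : strongly_regular M.
Implicit Types (Om : set 'rV[R]_n) (u v : 'rV[R]_n -> R).

Let M0 : M 0%N = 1. Proof. by have [A [_ [[]]]] := hM. Qed.
Let Mmono j : M j <= M j.+1. Proof. by have [A [_ [[]]]] := hM. Qed.
Let Mgt0 j : 0 < M j. Proof. exact: M_gt0. Qed.

(** Real and imaginary parts are handled separately in this class. It has no support condition;
    [extend0] restores that of [CM]. *)
Definition CMreal (M : nat -> R) Om u := smooth_on Om u /\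
  exists sig c, [/\ 0 < sig, 0 <= c & word_bound M Om sig c u].

Lemma word_bound_le Om sig c sig' c' u : 0 <= sig -> 0 <= c -> sig <= sig' -> c <= c' ->
  word_bound M Om sig c u -> word_bound M Om sig' c' u.
Proof.
move=> s0 c0 ss cc H s x Omx; apply: le_trans (H s x Omx) _; apply: ler_pM => //.
  by rewrite mulr_ge0 // mulr_ge0 ?exprn_ge0 // ltW.
rewrite ler_wpM2l // ler_wpM2r ?(ltW (Mgt0 _)) //.
by apply: lerXn2r; rewrite ?nnegrE // (le_trans s0).
Qed.

Lemma CMreal_sub Om Om' u : Om' `<=` Om -> CMreal M Om u -> CMreal M Om' u.
Proof.
move=> sub [su [sig [c [s0 c0 H]]]]; split; first exact: smooth_sub su.
by exists sig, c; split=> // s x /sub; exact: H.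
Qed.

Lemma CMreal_congr Om u v : open Om -> (forall x, Om x -> u x = v x) ->
  CMreal M Om u -> CMreal M Om v.
Proof.
move=> oOm uv [su [sig [c [s0 c0 H]]]]; split; first exact: smooth_congr uv su.
by exists sig, c; split=> // s x Omx; rewrite -(pderivs_congr s oOm uv Omx) H.
Qed.

Lemma CMreal_cst Om (k : R) : open Om -> CMreal M Om (fun=> k).
Proof.
move=> oOm; split; first exact: smooth_cst.
exists 1, `|k|; split=> // -[|i s] x Omx; first by rewrite /= fact0 expr0 M0 !mulr1.
rewrite (pderivs_cst (s := i :: s) _ oOm) // normr0 mulr_ge0 // mulr_ge0 //.
by rewrite mulr_ge0 ?exprn_ge0 // ltW.
Qed.

Lemma CMrealD Om u v : open Om -> CMreal M Om u -> CMreal M Om v ->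
  CMreal M Om (fun x => u x + v x).
Proof.
move=> oOm [su [s1 [c1 [s10 c10 H1]]]] [sv [s2 [c2 [s20 c20 H2]]]].
split; first exact: smoothD.
exists (Num.max s1 s2), (c1 + c2); split; [by rewrite lt_max s10|exact: addr_ge0|].
move=> s x Omx; rewrite (pderivsD s oOm su sv Omx); apply: le_trans (ler_normD _ _) _.
rewrite mulrDl; apply: lerD.
  by apply: (word_bound_le (ltW s10) c10 _ (lexx _) H1) => //; rewrite le_max lexx.
by apply: (word_bound_le (ltW s20) c20 _ (lexx _) H2) => //; rewrite le_max lexx orbT.
Qed.

Lemma CMrealM Om u v : open Om -> CMreal M Om u -> CMreal M Om v ->
  CMreal M Om (fun x => u x * v x).
Proof.
move=> oOm [su [s1 [c1 [s10 c10 H1]]]] [sv [s2 [c2 [s20 c20 H2]]]].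
split; first exact: smoothM.
set sg := Num.max s1 s2; have sg0 : 0 < sg by rewrite lt_max s10.
have {}H1 : word_bound M Om sg c1 u.
  by apply: (word_bound_le (ltW s10) c10 _ (lexx _) H1); rewrite le_max lexx.
have {}H2 : word_bound M Om sg c2 v.
  by apply: (word_bound_le (ltW s20) c20 _ (lexx _) H2); rewrite le_max lexx orbT.
exists (2 * sg), (c1 * c2); split; [exact: mulr_gt0|exact: mulr_ge0|].
move=> s x Omx; set m := size s.
apply: le_trans (leibniz_bound (b := fun k => c1 * (k`!%:R * (sg ^+ k * M k)))
  (c := fun k => c2 * (k`!%:R * (sg ^+ k * M k))) oOm su sv Omx
  (fun t _ => H1 t x Omx) (fun t _ => H2 t x Omx)) _.
rewrite -/m; apply: le_trans (_ : \sum_(k < m.+1) c1 * c2 * (m`!%:R * (sg ^+ m * M m)) <= _).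
  apply: ler_sum => k _; have km : (k <= m)%N by rewrite -ltnS.
  have R1 (x1 x2 x3 x4 x5 x6 x7 x8 x9 : R) :
    x1 * (x2 * (x3 * (x4 * x5))) * (x6 * (x7 * (x8 * x9))) =
    x2 * x6 * ((x1 * (x3 * x7)) * ((x4 * x8) * (x5 * x9))) by ring.
  rewrite R1 -!natrM bin_fact // -exprD subnKC //.
  rewrite ler_wpM2l ?mulr_ge0 // ler_wpM2l // ler_wpM2l ?exprn_ge0 ?(ltW sg0) //.
  have [A [A1 [M0' Mmono'] Mconv Mgrow Msum]] := strongly_regular_ge1 hM.
  by have := M_supermul M0' Mmono' Mconv k (m - k)%N; rewrite subnKC.
rewrite sumr_const card_ord -[leLHS]mulr_natl mulrCA ler_wpM2l ?mulr_ge0 //.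
rewrite mulrCA ler_wpM2l // exprMn mulrA ler_wpM2r ?(ltW (Mgt0 _)) //.
by rewrite ler_wpM2r ?exprn_ge0 ?(ltW sg0) // natrS_le_exp2.
Qed.

Lemma CMrealN Om u : open Om -> CMreal M Om u -> CMreal M Om (fun x => - u x).
Proof.
move=> oOm Hu; apply: CMreal_congr oOm _ (CMrealM oOm (CMreal_cst (-1) oOm) Hu).
by move=> x _; rewrite mulN1r.
Qed.

End RealClass.

Section ComplexClass.
Variables (R : realType) (n : nat) (M : nat -> R).
Hypothesis hM : strongly_regular M.
Implicit Types (Om : set 'rV[R]_n) (u v : 'rV[R]_n -> R) (f g : 'rV[R]_n -> R[i]).

Let M0 : M 0%N = 1. Proof. by have [A [_ [[]]]] := hM. Qed.
Let Mmono j : M j <= M j.+1. Proof. by have [A [_ [[]]]] := hM. Qed.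
Let Mgt0 j : 0 < M j. Proof. exact: M_gt0. Qed.

Definition cpx u v : 'rV[R]_n -> R[i] := fun x => Complex (u x) (v x).

Definition extend0 Om f : 'rV[R]_n -> R[i] := fun x => if `[< Om x >] then f x else 0.

Lemma extend0E Om f x : Om x -> extend0 Om f x = f x.
Proof. by move=> Omx; rewrite /extend0 asboolT. Qed.

Lemma CMs_bound_ext Om u v sig c : open Om -> smooth_on Om u -> smooth_on Om v ->
  word_bound M Om sig c u -> word_bound M Om sig c v ->
  [/\ supported_in Om (extend0 Om (cpx u v)), csmooth_on Om (extend0 Om (cpx u v)) &
      CM_bound M sig Om (c + c) (extend0 Om (cpx u v))].
Proof.
move=> oOm su sv Hu Hv; set f := extend0 _ _.
have fu y : Om y -> u y = complex.Re (f y) by move=> Omy; rewrite /f extend0E.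
have fv y : Om y -> v y = complex.Im (f y) by move=> Omy; rewrite /f extend0E.
split.
- by move=> x nOm; rewrite /f /extend0 asboolF.
- by split; [exact: smooth_congr fu su|exact: smooth_congr fv sv].
move=> J x Omx; rewrite /mderiv !mderivR_word -size_mword.
rewrite -(pderivs_congr _ oOm fu Omx) -(pderivs_congr _ oOm fv Omx).
apply: le_trans (normc_le _ _) _; apply: le_trans (lerD (Hu _ x Omx) (Hv _ x Omx)) _.
by rewrite le_eqVlt; apply/orP; left; apply/eqP; ring.
Qed.

Lemma CM_ext Om u v : open Om -> CMreal M Om u -> CMreal M Om v ->
  CM M Om (extend0 Om (cpx u v)).
Proof.
move=> oOm [su [s1 [c1 [s10 c10 H1]]]] [sv [s2 [c2 [s20 c20 H2]]]].
set sg := Num.max s1 s2; have sg0 : 0 < sg by rewrite lt_max s10.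
have H1' : word_bound M Om sg (Num.max c1 c2) u.
  by apply: (word_bound_le hM (ltW s10) c10 _ _ H1); rewrite le_max lexx.
have H2' : word_bound M Om sg (Num.max c1 c2) v.
  by apply: (word_bound_le hM (ltW s20) c20 _ _ H2); rewrite le_max lexx orbT.
have [h1 h2 h3] := CMs_bound_ext oOm su sv H1' H2'.
by exists sg; split=> //; split=> //; exists (Num.max c1 c2 + Num.max c1 c2).
Qed.

(** Symmetry of derivatives turns the bounds on multi-indices into bounds on words; [|c|] replaces
    [c] because [CM_bound] gives its constant no sign. *)
Lemma CM_parts Om f : open Om -> CM M Om f ->
  CMreal M Om (fun x => complex.Re (f x)) /\ CMreal M Om (fun x => complex.Im (f x)).
Proof.
move=> oOm [sig [sig0 [_ [su sv] [c Hc]]]].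
have H s x : Om x ->
    `|pderivs s (fun x => complex.Re (f x)) x| <= `|c| * ((size s)`!%:R * (sig ^+ size s * M (size s))) /\
    `|pderivs s (fun x => complex.Im (f x)) x| <= `|c| * ((size s)`!%:R * (sig ^+ size s * M (size s))).
  move=> Omx; have := Hc (word_index s) x Omx; rewrite mlength_word_index /mderiv !mderivR_word.
  rewrite -(pderivs_perm oOm su (perm_word_index s) Omx).
  rewrite -(pderivs_perm oOm sv (perm_word_index s) Omx) => H.
  have H' : Normc.normc (Complex (pderivs s (fun y => complex.Re (f y)) x)
     (pderivs s (fun y => complex.Im (f y)) x)) <= `|c| * ((size s)`!%:R * (sig ^+ size s * M (size s))).
    apply: le_trans H _; rewrite -!mulrA [X in c * X](_ : _ = (size s)`!%:R * (sig ^+ size s * M (size s)));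
      last by ring.
    rewrite ler_wpM2r ?ler_norm // mulr_ge0 // mulr_ge0 ?exprn_ge0 // ltW //.
  by split; apply: le_trans H'; [exact: normc_re|exact: normc_im].
by split; split=> //; exists sig, `|c|; split=> // s x /(H s)[].
Qed.

Lemma cpxE f x : cpx (fun x => complex.Re (f x)) (fun x => complex.Im (f x)) x = f x.
Proof. by rewrite /cpx; case: (f x). Qed.

End ComplexClass.

Section GermRepresentatives.
Variables (R : realType) (n : nat) (M : nat -> R).
Hypothesis hM : strongly_regular M.
Implicit Types (u v : 'rV[R]_n -> R) (f g : 'rV[R]_n -> R[i]) (gam : germ R n).

Lemma to_germM f g : to_germ (f * g) = to_germ f * to_germ g :> germ R n.
Proof. by rewrite /to_germ rmorphM. Qed.

Lemma to_germD f g : to_germ (f + g) = to_germ f + to_germ g :> germ R n.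
Proof. by rewrite /to_germ rmorphD. Qed.

Lemma to_germ0 : to_germ 0 = 0 :> germ R n.
Proof. by rewrite /to_germ rmorph0. Qed.

Lemma to_germ_eq_on Om f g : open_nbhs (0 : 'rV[R]_n) Om ->
  (forall x, Om x -> f x = g x) -> to_germ f = to_germ g.
Proof. by move=> [oOm Om0] fg; apply/to_germP; exact: open_near oOm Om0 fg. Qed.

Lemma near0_ball (P : 'rV[R]_n -> Prop) : (\forall x \near (0 : 'rV[R]_n), P x) ->
  exists r, 0 < r /\ forall x, ball 0 r x -> P x.
Proof. by move=> /nbhs_ballP[r /= r0 H]; exists r. Qed.

Lemma ball_open_nbhs (r : R) : 0 < r -> open_nbhs (0 : 'rV[R]_n) (ball 0 r).
Proof. by move=> r0; split; [exact: ball_open|exact: ballxx]. Qed.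

Lemma CM_germP gam : CM_germ M gam <-> exists r u v,
  [/\ 0 < r, CMreal M (ball 0 r) u, CMreal M (ball 0 r) v & gam = to_germ (cpx u v)].
Proof.
split=> [[Om [f [nOm fCM ->]]]|[r [u [v [r0 Hu Hv ->]]]]].
  have [oOm Om0] := nOm; have [r [r0 sub]] := open_ball_sub oOm Om0.
  have [Hu Hv] := CM_parts hM oOm fCM.
  exists r, (fun x => complex.Re (f x)), (fun x => complex.Im (f x)).
  split=> //; [exact: CMreal_sub Hu|exact: CMreal_sub Hv|].
  by apply: to_germ_eq_on nOm _ => x _; rewrite cpxE.
exists (ball 0 r), (extend0 (ball 0 r) (cpx u v)); split.
- exact: ball_open_nbhs.
- by apply: CM_ext => //; exact: ball_open.
- by apply: to_germ_eq_on (ball_open_nbhs r0) _ => x bx; rewrite extend0E.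
Qed.

Definition flat_at u (x : 'rV[R]_n) := forall s, pderivs s u x = 0.

(** A germ may be known to be flat through a representative other than the one in the class; the two
    agree near zero, hence so do their derivatives. *)
Lemma flat_idealP X gam : flat_ideal M X gam <-> exists r u v,
  [/\ 0 < r, CMreal M (ball 0 r) u, CMreal M (ball 0 r) v, gam = to_germ (cpx u v) &
      forall x, ball 0 r x -> X x -> flat_at u x /\ flat_at v x].
Proof.
split=> [[/CM_germP[r [u [v [r0 Hu Hv E]]]] [f [Ef nearf]]]|[r [u [v [r0 Hu Hv E H]]]]]; last first.
  split; first by apply/CM_germP; exists r, u, v.
  exists (cpx u v); split=> //; apply: open_near (ball_open_nbhs r0).1 (ball_open_nbhs r0).2 _.
  move=> x bx Xx J; have [fu fv] := H x bx Xx.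
  by rewrite /mderiv !mderivR_word /cpx fu fv.
have [r1 [r10 H1]] := near0_ball nearf.
have Efu := E; rewrite Ef in Efu; have [r2 [r20 H2]] := near0_ball ((to_germP _ _).1 Efu).
pose r3 := Num.min r (Num.min r1 r2); have r30 : 0 < r3 by rewrite !lt_min r0 r10.
have s1 : ball (0 : 'rV[R]_n) r3 `<=` ball 0 r by apply: le_ball; rewrite /r3 ge_min lexx.
have s2 : ball (0 : 'rV[R]_n) r3 `<=` ball 0 r1.
  by apply: le_ball; rewrite /r3 !ge_min lexx orbT.
have s3 : ball (0 : 'rV[R]_n) r3 `<=` ball 0 r2.
  by apply: le_ball; rewrite /r3 !ge_min lexx !orbT.
have ob : open (ball (0 : 'rV[R]_n) r3) by exact: ball_open.
exists r3, u, v; split=> //; [exact: CMreal_sub Hu|exact: CMreal_sub Hv|].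
move=> x bx Xx.
have fu y : ball 0 r3 y -> complex.Re (f y) = u y by move=> /s3 /H2 ->.
have fv y : ball 0 r3 y -> complex.Im (f y) = v y by move=> /s3 /H2 ->.
have [su _] := CMreal_sub s1 Hu; have [sv _] := CMreal_sub s1 Hv.
have D s : pderivs s u x = 0 /\ pderivs s v x = 0.
  have := H1 x (s2 x bx) Xx (word_index s); rewrite /mderiv !mderivR_word.
  rewrite (pderivs_congr _ ob fu bx) (pderivs_congr _ ob fv bx).
  rewrite -(pderivs_perm ob su (perm_word_index s) bx).
  by rewrite -(pderivs_perm ob sv (perm_word_index s) bx) => -[-> ->].
by split=> s; have [] := D s.
Qed.

End GermRepresentatives.

(** * Flat ideals and closed ideals *)

Section LBClosed.
Variables (R : realType) (n : nat) (M : nat -> R).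

(** A basic neighbourhood of zero contains a ball of the step [sig]. If [g] were outside [F], a
    neighbourhood of [g] missing [F] would thus contain some approximant [h]. *)
Lemma LB_closed_limit (Om : set 'rV[R]_n) (F : set ('rV[R]_n -> R[i])) g sig :
  LB_closed M Om F -> CM M Om g -> 0 < sig ->
  (forall e : R, 0 < e -> exists h, [/\ F h, supported_in Om (h - g), csmooth_on Om (h - g) &
     CM_bound M sig Om e (h - g)]) -> F g.
Proof.
move=> [FCM [_ Fo]] gCM sig0 H; apply: contrapT => nFg.
have [U [[_ _ HU] UV]] := Fo g (conj gCM nFg).
have [eps [eps0 He]] := HU sig sig0.
have e20 : 0 < eps / 2 by rewrite divr_gt0.
have [h [Fh h1 h2 h3]] := H _ e20.
have Uh : U (h - g).
  apply: He; first by split=> //; exists (eps / 2).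
  apply: le_lt_trans (_ : eps / 2 < _); last by rewrite ltr_pdivrMr // ltr_pMr // ltr1n.
  apply: ge_inf; first by exists 0 => c [].
  by split=> //; exact: ltW.
by have := UV _ Uh; rewrite addrC subrK => -[].
Qed.

End LBClosed.

Section FlatIdeals.
Variables (R : realType) (n : nat) (M : nat -> R) (X : set 'rV[R]_n).
Hypothesis hM : strongly_regular M.

Lemma cpxM (u v u' v' : 'rV[R]_n -> R) : cpx u v * cpx u' v' =
  cpx (fun x => u x * u' x - v x * v' x) (fun x => u x * v' x + v x * u' x).
Proof. by apply/funext => x. Qed.

Lemma cpxD (u v u' v' : 'rV[R]_n -> R) : cpx u v + cpx u' v' =
  cpx (fun x => u x + u' x) (fun x => v x + v' x).
Proof. by apply/funext => x. Qed.

Lemma CMrealB (Om : set 'rV[R]_n) u v : open Om -> CMreal M Om u -> CMreal M Om v ->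
  CMreal M Om (fun x => u x - v x).
Proof. by move=> oOm Hu Hv; apply: CMrealD oOm Hu (CMrealN hM oOm Hv). Qed.

Lemma flatM gam del : flat_ideal M X gam -> CM_germ M del -> flat_ideal M X (gam * del).
Proof.
move=> /(flat_idealP hM)[r [u [v [r0 Hu Hv -> fl]]]] /(CM_germP hM)[r' [u' [v' [r'0 Hu' Hv' ->]]]].
pose q := Num.min r r'; have q0 : 0 < q by rewrite lt_min r0.
have s1 : ball (0 : 'rV[R]_n) q `<=` ball 0 r by apply: le_ball; rewrite ge_min lexx.
have s2 : ball (0 : 'rV[R]_n) q `<=` ball 0 r' by apply: le_ball; rewrite ge_min lexx orbT.
have ob : open (ball (0 : 'rV[R]_n) q) by exact: ball_open.
have {}Hu := CMreal_sub s1 Hu; have {}Hv := CMreal_sub s1 Hv.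
have {}Hu' := CMreal_sub s2 Hu'; have {}Hv' := CMreal_sub s2 Hv'.
apply/(flat_idealP hM); exists q, (fun x => u x * u' x - v x * v' x),
  (fun x => u x * v' x + v x * u' x); split => //.
- by apply: (CMrealB ob); exact: (CMrealM hM ob).
- by apply: (CMrealD hM ob); exact: (CMrealM hM ob).
- by rewrite -to_germM cpxM.
move=> x bx Xx; have [fu fv] := fl x (s1 x bx) Xx.
have Z (a b : 'rV[R]_n -> R) s : CMreal M (ball 0 q) a -> CMreal M (ball 0 q) b ->
    flat_at a x -> pderivs s (fun y => a y * b y) x = 0.
  by move=> [sa _] [sb _] fa; exact: (leibniz_flat ob s sa sb bx fa).
have S (a b : 'rV[R]_n -> R) : CMreal M (ball 0 q) a -> CMreal M (ball 0 q) b ->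
    smooth_on (ball 0 q) (fun y => a y * b y).
  by move=> [sa _] [sb _]; exact: (smoothM ob sa sb).
split=> s.
  rewrite (pderivsB s ob (S _ _ Hu Hu') (S _ _ Hv Hv') bx).
  by rewrite (Z _ _ s Hu Hu' fu) (Z _ _ s Hv Hv' fv) subrr.
rewrite (pderivsD s ob (S _ _ Hu Hv') (S _ _ Hv Hu') bx).
by rewrite (Z _ _ s Hu Hv' fu) (Z _ _ s Hv Hu' fv) addr0.
Qed.

Lemma flatD gam del : flat_ideal M X gam -> flat_ideal M X del -> flat_ideal M X (gam + del).
Proof.
move=> /(flat_idealP hM)[r [u [v [r0 Hu Hv -> fl]]]].
move=> /(flat_idealP hM)[r' [u' [v' [r'0 Hu' Hv' -> fl']]]].
pose q := Num.min r r'; have q0 : 0 < q by rewrite lt_min r0.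
have s1 : ball (0 : 'rV[R]_n) q `<=` ball 0 r by apply: le_ball; rewrite ge_min lexx.
have s2 : ball (0 : 'rV[R]_n) q `<=` ball 0 r' by apply: le_ball; rewrite ge_min lexx orbT.
have ob : open (ball (0 : 'rV[R]_n) q) by exact: ball_open.
have {}Hu := CMreal_sub s1 Hu; have {}Hv := CMreal_sub s1 Hv.
have {}Hu' := CMreal_sub s2 Hu'; have {}Hv' := CMreal_sub s2 Hv'.
apply/(flat_idealP hM); exists q, (fun x => u x + u' x), (fun x => v x + v' x); split => //.
- exact: CMrealD.
- exact: CMrealD.
- by rewrite -to_germD cpxD.
move=> x bx Xx; have [fu fv] := fl x (s1 x bx) Xx; have [fu' fv'] := fl' x (s2 x bx) Xx.
split=> s.
  by rewrite (pderivsD s ob Hu.1 Hu'.1 bx) fu fu' addr0.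
by rewrite (pderivsD s ob Hv.1 Hv'.1 bx) fv fv' addr0.
Qed.

Lemma flat0 : flat_ideal M X 0.
Proof.
apply/(flat_idealP hM); exists 1, (fun=> 0), (fun=> 0).
have ob : open (ball (0 : 'rV[R]_n) 1) by exact: ball_open.
split=> //; try exact: CMreal_cst.
- by rewrite -[LHS]to_germ0.
by move=> x bx _; split=> s; case: s => // i s; exact: (pderivs_cst (s := i :: s) _ ob).
Qed.

Lemma flat_rep u v : flat_ideal M X (to_germ (cpx u v)) ->
  exists r, 0 < r /\ forall x, ball 0 r x -> X x -> flat_at u x /\ flat_at v x.
Proof.
move=> /(flat_idealP hM)[r [u' [v' [r0 _ _ /to_germP /near0_ball[r' [r'0 E]] fl]]]].
pose q := Num.min r r'; exists q; split; first by rewrite lt_min r0.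
have s1 : ball (0 : 'rV[R]_n) q `<=` ball 0 r by apply: le_ball; rewrite ge_min lexx.
have s2 : ball (0 : 'rV[R]_n) q `<=` ball 0 r' by apply: le_ball; rewrite ge_min lexx orbT.
have ob : open (ball (0 : 'rV[R]_n) q) by exact: ball_open.
move=> x bx Xx; have [fu fv] := fl x (s1 x bx) Xx; split=> s.
  rewrite (pderivs_congr (g := u') s ob _ bx) ?fu // => y /s2 /E.
  by rewrite /cpx => -[].
rewrite (pderivs_congr (g := v') s ob _ bx) ?fv // => y /s2 /E.
by rewrite /cpx => -[].
Qed.

End FlatIdeals.

(** * Decay of flat functions and their factorisation *)

Section TaylorFlat.
Variables (R : realType) (n : nat) (M : nat -> R).
Hypothesis hM : strongly_regular M.

(** Taylor's inequality from a flat point; [(j+k)! / k! <= 2^(j+k) j!] and moderate growth separate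
    the order of the derivative from the order of decay. [T] and [tau] are fixed before [F], as the
    construction of the weight requires. *)
Lemma taylor_flat_bound (sig L : R) : 0 < sig -> 0 <= L -> exists T tau : R,
  [/\ 0 <= T, 0 < tau & forall m (ph : 'I_m -> 'rV[R]_n -> R) r (D : set 'rV[R]_n) F c,
    D `<=` ball 0 r -> 0 <= c -> smooth_on (ball 0 r) F -> word_bound M (ball 0 r) sig c F ->
    (forall x, D x -> (exists y, [/\ ball 0 r y, flat_at F y &
       `|x - y| <= L * Num.sqrt (sumsq ph x)]) \/ flat_at F x) ->
    flat_bound ph M T D c tau F].
Proof.
move=> sig0 L0; have [A [A1 [M0 Mmono] Mconv Mgrow Msum]] := strongly_regular_ge1 hM.
have Mgt0 j : 0 < M j := M_gt0 M0 Mmono j.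
have A0 : 0 < A by exact: lt_le_trans A1.
pose tau := 2 * sig * A; have tau0 : 0 < tau by rewrite !mulr_gt0.
exists (tau * (n%:R * L)), tau; split=> //.
  by rewrite mulr_ge0 ?(ltW tau0) // mulr_ge0.
move=> m ph r D F c sub c0 sF bF HD; split; first exact: smooth_sub sF.
move=> x Dx s k; set d := Num.sqrt _; have d0 : 0 <= d by exact: sqrtr_ge0.
have rhs0 : 0 <= c * ((size s)`!%:R * (tau ^+ size s * M (size s))) *
    ((tau * (n%:R * L) * d) ^+ k * M k).
  apply: mulr_ge0; last first.
    apply: mulr_ge0; last exact: ltW.
    by rewrite exprn_ge0 // mulr_ge0 // mulr_ge0 ?(ltW tau0) // mulr_ge0.
  apply: mulr_ge0 => //; apply: mulr_ge0 => //.
  by apply: mulr_ge0; [exact/exprn_ge0/ltW|exact: ltW].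
have [[y [by_ fy xy]]|->] := HD x Dx; last by rewrite normr0.
have bx := sub x Dx; have [l [ln p]] := box_path bx by_.
have l0 := axis_path_ge0 p.
have := @path_taylor R n (ball 0 r) F y (fun m => c * (m`!%:R * (sig ^+ m * M m))) k sF
  (fun s z bz => bF s z bz) fy by_ l x p bx s => /le_trans; apply.
have ld : l <= n%:R * L * d by apply: le_trans ln _; rewrite -mulrA ler_wpM2l.
set j := size s in rhs0 *.
have F1 : (j + k)`!%:R / k`!%:R <= 2 ^+ (j + k) * j`!%:R :> R.
  rewrite ler_pdivrMr ?ltr0n ?fact_gt0 // -natrX -!natrM ler_nat.
  have jk : (k <= j + k)%N by exact: leq_addl.
  rewrite -(bin_fact jk) addnK -mulnA [(k`! * j`!)%N]mulnC leq_mul2r.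
  by rewrite bin_le_exp2 orbT.
have F2 := Mgrow j k.
apply: le_trans (_ : c * (sig ^+ (j + k) * (A ^+ (j + k) * M j * M k)) *
   ((2 ^+ (j + k) * j`!%:R) * (n%:R * L * d) ^+ k) <= _).
  rewrite [leLHS](_ : _ = c * (sig ^+ (j + k) * M (j + k)%N) *
    (((j + k)`!%:R / k`!%:R) * l ^+ k)); last by ring.
  have s0 : 0 <= sig ^+ (j + k) by rewrite exprn_ge0 // ltW.
  apply: ler_pM.
  - by rewrite mulr_ge0 // mulr_ge0 // ltW.
  - by rewrite mulr_ge0 ?exprn_ge0 // divr_ge0.
  - by rewrite ler_wpM2l // ler_wpM2l.
  apply: ler_pM => //; rewrite ?divr_ge0 ?exprn_ge0 //.
  by apply: lerXn2r; rewrite ?nnegrE // (le_trans l0).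
rewrite le_eqVlt; apply/orP; left; apply/eqP.
rewrite /tau !exprMn !exprD; ring.
Qed.

End TaylorFlat.

Section FlatFactor.
Variables (R : realType) (n : nat) (M : nat -> R).
Hypothesis hM : strongly_regular M.
Variables (ph : 'I_n -> 'rV[R]_n -> R) (C lam r L : R).
Hypotheses (C1 : 1 <= C) (lam0 : 0 <= lam) (L0 : 0 <= L).
Local Notation Om := (ball (0 : 'rV[R]_n) r).
Hypothesis sph : forall i, smooth_on Om (ph i).
Hypothesis bph : forall i s (x : 'rV[R]_n), Om x ->
  `|pderivs s (ph i) x| <= (size s)`!%:R * (C * lam ^+ size s).
Hypothesis rho1 : forall x : 'rV[R]_n, Om x -> sumsq ph x <= 1.

(** A common rate for the two parts gives a common [T], hence a single weight. The alternative of
    flatness at [x] itself covers the points where the cutoff vanishes. *)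
Lemma flat_factor (D : set 'rV[R]_n) (Fu Fv : 'rV[R]_n -> R) :
  open D -> D `<=` Om -> CMreal M Om Fu -> CMreal M Om Fv ->
  (forall x : 'rV[R]_n, D x -> (exists y : 'rV[R]_n, [/\ Om y, flat_at Fu y /\ flat_at Fv y &
       `|x - y| <= L * Num.sqrt (sumsq ph x)]) \/ (flat_at Fu x /\ flat_at Fv x)) ->
  exists (w : 'rV[R]_n -> R) (E : nat -> 'rV[R]_n -> R) (gu gv : 'rV[R]_n -> R), [/\ CMreal M Om w,
    forall x : 'rV[R]_n, Om x -> sumsq ph x = 0 -> flat_at w x,
    forall k, CMreal M Om (E k),
    CMreal M D gu /\ CMreal M D gv &
    [/\ forall x : 'rV[R]_n, D x -> Fu x = w x * gu x /\ Fv x = w x * gv x,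
      forall x : 'rV[R]_n, D x -> flat_at Fu x -> flat_at gu x,
      forall x : 'rV[R]_n, D x -> flat_at Fv x -> flat_at gv x &
      exists2 sig, 0 < sig & forall e, 0 < e -> exists k,
       word_bound M D sig e (fun y => Fu y * E k y - gu y) /\
       word_bound M D sig e (fun y => Fv y * E k y - gv y)]].
Proof.
move=> oD subD [su [s1 [c1 [s10 c10 b1]]]] [sv [s2 [c2 [s20 c20 b2]]]] HD.
have oOm : open Om by exact: ball_open.
set sg := Num.max s1 s2; have sg0 : 0 < sg by rewrite lt_max s10.
have {}b1 : word_bound M Om sg c1 Fu.
  by apply: (word_bound_le hM (ltW s10) c10 _ (lexx _) b1); rewrite le_max lexx.
have {}b2 : word_bound M Om sg c2 Fv.
  by apply: (word_bound_le hM (ltW s20) c20 _ (lexx _) b2); rewrite le_max lexx orbT.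
have [T [tau [T0 tau0 HT]]] := taylor_flat_bound n hM sg0 L0.
have FU : flat_bound ph M T D c1 tau Fu.
  apply: (HT n ph r D Fu c1 subD c10 su b1) => x /HD[[y [by_ [fu _] xy]]|[fu _]]; [left|by right].
  by exists y.
have FV : flat_bound ph M T D c2 tau Fv.
  apply: (HT n ph r D Fv c2 subD c20 sv b2) => x /HD[[y [by_ [_ fv] xy]]|[_ fv]]; [left|by right].
  by exists y.
have [w [E [[sw [sgw sgw0 bw]] fw HE HF]]] :=
  flat_weight_exists oOm sph C1 lam0 bph rho1 hM T0.
have [gu [sgu eu flu [sigu sigu0 [[cu bgu] lu]]]] := HF D Fu c1 tau oD subD c10 tau0 FU.
have [gv [sgv ev flv [sigv sigv0 [[cv bgv] lv]]]] := HF D Fv c2 tau oD subD c20 tau0 FV.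
have abs_bound sig c F D' : 0 < sig -> word_bound M D' sig c F -> word_bound M D' sig `|c| F.
  move=> sig0 H s x Dx; apply: le_trans (H s x Dx) _; rewrite ler_wpM2r ?ler_norm //.
  have [A [A1 [M0 Mmono] _ _ _]] := strongly_regular_ge1 hM.
  by rewrite mulr_ge0 // mulr_ge0 ?exprn_ge0 ?(ltW sig0) // ltW // (M_gt0 M0 Mmono).
exists w, E, gu, gv; split.
- by split=> //; exists sgw, 1.
- by move=> x Omx rx s; exact: fw.
- move=> k; have [sE [c [sig [sig0 bE]]]] := HE k; split=> //.
  by exists sig, `|c|; split=> //; exact: abs_bound.
- split; split=> //.
    by exists sigu, `|cu|; split=> //; exact: abs_bound.
  by exists sigv, `|cv|; split=> //; exact: abs_bound.
split.
- by move=> x Dx; split; [exact: eu|exact: ev].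
- by move=> x Dx fl s; exact: flu.
- by move=> x Dx fl s; exact: flv.
exists (Num.max sigu sigv); first by rewrite lt_max sigu0.
move=> e e0; have [k1 H1] := lu e e0; have [k2 H2] := lv e e0.
exists (maxn k1 k2); split.
  apply: (word_bound_le hM (ltW sigu0) (ltW e0) _ (lexx e) (H1 _ (leq_maxl _ _))).
  by rewrite le_max lexx.
apply: (word_bound_le hM (ltW sigv0) (ltW e0) _ (lexx e) (H2 _ (leq_maxr _ _))).
by rewrite le_max lexx orbT.
Qed.

End FlatFactor.

(** * Cutoff *)

Section Cutoff.
Variables (R : realType) (n : nat) (M : nat -> R).
Hypothesis hM : strongly_regular M.

Lemma open_pos_set (f : 'rV[R]_n -> R) : smooth_on setT f -> open [set x | 0 < f x].
Proof.
move=> /smooth_regular rf; rewrite openE => x /= fx.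
have [/continuous_epsP /(_ (f x / 2)) + _] := rf x I.
rewrite divr_gt0 // => /(_ isT)[d [d0 H]]; apply/nbhs_ballP; exists d => //= y.
rewrite -ball_normE /ball_ /= => /H; rewrite ler_norml => /andP[_]; lra.
Qed.

Definition sqball_def (r2 : R) (x : 'rV[R]_n) := r2 ^+ 2 - \sum_i x 0 i ^+ 2.

Lemma smooth_sqball_def r2 : smooth_on setT (sqball_def r2).
Proof.
apply: smoothD openT (smooth_cst _ openT) (smoothN openT _).
by apply: smooth_sum openT _ => i _; exact: (smoothX 2 openT (@smooth_coord R n i)).
Qed.

Lemma sqball_def_jets r2 rad : 1 <= rad -> exists C : R, 1 <= C /\
  forall s x, `|x| <= rad ->
    `|pderivs s (sqball_def r2) x| <= (size s)`!%:R * (C * 2 ^+ size s).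
Proof.
move=> rad1; have rad0 : 0 < rad by exact: lt_le_trans rad1.
pose c0 := r2 ^+ 2; pose c1 := n%:R * rad ^+ 2.
have c00 : 0 <= c0 by exact: sqr_ge0.
have c10 : 0 <= c1 by rewrite mulr_ge0 // sqr_ge0.
exists (1 + (c0 + c1)); split=> [|s x xr]; first by rewrite lerDl addr_ge0.
have G1 i : geo (fun y : 'rV[R]_n => y 0 i) x rad 1.
  move=> t; apply: le_trans (bin_jet_coord i rad0 xr t) _.
  rewrite ler_wpM2l // expr1n mulr1 expr1.
  case: (size t) => [|[|k]]; last by rewrite bin_small // mul0r ltW.
    by rewrite bin0 expr0 invr1 mulr1 mul1r.
  by rewrite binn mul1r expr1 divff ?gt_eqF.
have sX i : smooth_on setT (fun y : 'rV[R]_n => y 0 i) by exact: smooth_coord.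
have G2 i : geo (fun y : 'rV[R]_n => - (y 0 i * y 0 i)) x (rad * rad) 2.
  have := geoM openT (sX i) (sX i) I ler01 (G1 i) (G1 i); rewrite mulr1 => H t.
  by rewrite (pderivsN t openT (smoothM openT (sX i) (sX i)) I) normrN.
have sN i : smooth_on setT (fun y : 'rV[R]_n => - (y 0 i * y 0 i)).
  exact: smoothN openT (smoothM openT (sX i) (sX i)).
have G3 := geo_sum openT (index_enum 'I_n) I sN G2.
have G4 : geo (fun=> c0) x c0 2 by apply: (geo_cst openT I) => //; rewrite ger0_norm.
have G5 := geoD openT (smooth_cst c0 openT) (smooth_sum _ openT (fun i _ => sN i)) I G4 G3.
have E (y : 'rV[R]_n) : c0 + \sum_(i <- index_enum 'I_n) - (y 0 i * y 0 i) = sqball_def r2 y.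
  by rewrite /sqball_def sumrN; congr (_ - _); apply: eq_bigr => i _; rewrite expr2.
have := @geo_congr R n setT openT _ (sqball_def r2) x _ 2 (fun y _ => E y) I G5 s => /le_trans; apply.
rewrite ler_wpM2l // ler_wpM2r ?exprn_ge0 // sumr_const card_ord -[_ *+ n]mulr_natl -expr2.
by rewrite lerDr.
Qed.

(* No value [1] near [0] is needed: an invertible germ suffices. *)
Lemma cutoff (r r2 : R) : 0 < r -> 0 < r2 -> r2 <= 1 -> n%:R * r ^+ 2 <= 1 -> r <= 1 ->
  exists chi, [/\ CMreal M (ball (0 : 'rV[R]_n) r) chi,
    forall x : 'rV[R]_n, ball 0 r x -> r2 <= `|x| -> flat_at chi x &
    exists rho v, [/\ 0 < rho, CMreal M (ball (0 : 'rV[R]_n) rho) v &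
      forall x : 'rV[R]_n, ball 0 rho x -> chi x * v x = 1]].
Proof.
move=> r0 r20 r21 nr1 r1; set Om := ball (0 : 'rV[R]_n) r.
have oOm : open Om by exact: ball_open.
pose del := sqball_def r2; have sdel : smooth_on setT del by exact: smooth_sqball_def.
have subT : Om `<=` setT by [].
have nb (x : 'rV[R]_n) : Om x -> `|x| <= r.
  by rewrite /Om -ball_normE /ball_ /= sub0r normrN => /ltW.
pose ph (_ : 'I_1) := del.
have Eph x : sumsq ph x = del x ^+ 2 by rewrite /sumsq big_ord_recl big_ord0 addr0.
have [C [C1 bC]] := sqball_def_jets r2 (lexx 1).
have bph (i : 'I_1) s x : Om x -> `|pderivs s (ph i) x| <= (size s)`!%:R * (C * 2 ^+ size s).
  by move=> /nb xr; apply: bC; exact: le_trans r1.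
have sumx0 (x : 'rV[R]_n) : 0 <= \sum_i x 0 i ^+ 2 by apply: sumr_ge0 => i _; exact: sqr_ge0.
have rho1 x : Om x -> sumsq ph x <= 1.
  move=> /nb xr; rewrite Eph -[leRHS](expr1n _ 2) -real_normK ?num_real //.
  apply: lerXn2r; rewrite ?nnegrE // ler_norml; apply/andP.
  have S1 : \sum_i x 0 i ^+ 2 <= 1.
    apply: le_trans nr1; apply: le_trans (_ : \sum_(i < n) r ^+ 2 <= _).
      apply: ler_sum => i _; rewrite -real_normK ?num_real //.
      apply: lerXn2r; rewrite ?nnegrE // ?(ltW r0) //.
      exact: le_trans (rV_coord_le x i) xr.
    by rewrite sumr_const card_ord -[_ *+ n]mulr_natl.
  have S2 : r2 ^+ 2 <= 1 by rewrite expr_le1 // ltW.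
  have := sumx0 x; have : 0 <= r2 ^+ 2 := sqr_ge0 _.
  by rewrite /del /sqball_def; move: (r2 ^+ 2) (\sum_i _) S1 S2 => p q; split; lra.
have [w [E [[sw [sgw sgw0 bw]] fw _ HF]]] := flat_weight_exists oOm
  (fun i => smooth_sub subT sdel) C1 (ler0n _ 2) bph rho1 hM ler01.
(* [w] is flat on the sphere [del = 0], so it may be replaced by zero outside the Euclidean ball. *)
pose A := [set x : 'rV[R]_n | 0 < del x].
have oA : open A := open_pos_set sdel.
have HA x : Om x -> ~ A x -> (forall s, pderivs s w x = 0) \/ (\forall y \near x, ~ A y).
  move=> Omx /negP; rewrite -leNgt le_eqVlt => /orP[/eqP d0|dneg].
    by left=> s; apply: fw => //; rewrite Eph d0 expr0n.
  right; have oB : open [set y : 'rV[R]_n | 0 < - del y].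
    exact: open_pos_set (smoothN openT sdel).
  apply: (open_near oB) => [|y /=]; first by rewrite /= oppr_gt0.
  by rewrite oppr_gt0 /A /= => dy; apply/negP; rewrite -leNgt ltW.
have [schi Dchi] := smooth_restrict oOm oA sw HA.
set chi := fun x => _ in schi Dchi.
have [A' [A1 [M0 Mmono] Mconv Mgrow Msum]] := strongly_regular_ge1 hM.
have A'0 : 0 < A' by exact: lt_le_trans A1.
have Mgt0 j : 0 < M j := M_gt0 M0 Mmono j.
exists chi; split.
- split=> //; exists sgw, 1; split=> // s x Omx; rewrite Dchi //; case: ifP => _; first exact: bw.
  by rewrite normr0 mul1r mulr_ge0 // mulr_ge0 ?exprn_ge0 // ltW.
- move=> x Omx xr s; rewrite Dchi // asboolF // /A /= /del /sqball_def subr_gt0.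
  apply/negP; rewrite -leNgt.
  (* The sup norm is attained at a coordinate, so [|x| >= r2] forces the Euclidean norm to be at
     least [r2]. *)
  have xx : `|x| = 0 \/ exists i, `|x| = `|x 0 i|.
    have [x0|/mx_norm_neq0[[i j] /= xi]] := eqVneq (mx_norm x) 0; first by left; exact: x0.
    by right; exists j; move: xi; rewrite (ord1 i); exact.
  case: xx => [x0|[i xi]]; first by have := lt_le_trans r20 xr; rewrite x0 ltxx.
  apply: le_trans (_ : x 0 i ^+ 2 <= _); last first.
    by rewrite (bigD1 i) //= lerDl; apply: sumr_ge0 => j _; exact: sqr_ge0.
  rewrite -[x 0 i ^+ 2]real_normK ?num_real // -xi.
  by apply: lerXn2r; rewrite ?nnegrE ?(ltW r20).
(* The inverse of [chi] near zero is obtained by dividing the constant [1] by [w]. Where [del >= u],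
   [count_lower] keeps all [del^m M_m] above a positive constant, so [1] satisfies the decay
   hypothesis there. *)
pose u := r2 ^+ 2 / 2; have u0 : 0 < u by rewrite divr_gt0 // exprn_gt0.
pose Om' := Om `&` [set x | 0 < del x + - u].
have oOm' : open Om'.
  apply: openI => //; apply: open_pos_set.
  exact: smoothD openT sdel (smooth_cst _ openT).
have sub' : Om' `<=` Om by move=> x [].
have [N [aN Nmin]] := qt_count A'0 M0 Mmono Mconv Msum u0.
have F1 : flat_bound ph M 1 Om' (A' ^+ (2 * N)) 1 (fun=> 1).
  split; first exact: smooth_cst.
  move=> x [_ /= dx] s m; have du : u <= del x by lra.
  have -> : Num.sqrt (sumsq ph x) = del x.
    by rewrite Eph sqrtr_sqr ger0_norm // (le_trans _ du) // ltW.
  have A2 : 0 <= A' ^+ (2 * N) by rewrite exprn_ge0 // ltW.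
  case: s => [|i s]; last first.
    rewrite (pderivs_cst (s := i :: s) _ openT) // normr0 mul1r.
    apply: mulr_ge0; last first.
      apply: mulr_ge0; last exact: ltW.
      by rewrite exprn_ge0 // (le_trans _ du) // ltW.
    apply: mulr_ge0 => //; apply: mulr_ge0 => //.
    by apply: mulr_ge0; [exact: exprn_ge0|exact: ltW].
  rewrite /= normr1 fact0 expr0 M0 !mulr1 mul1r.
  apply: le_trans (count_lower A'0 M0 Mmono Mconv Mgrow u0 aN Nmin m) _.
  rewrite ler_wpM2l // ler_wpM2r ?(ltW (Mgt0 _)) //.
  by apply: lerXn2r; rewrite ?nnegrE ?(ltW u0) // (le_trans _ du) // ltW.
have [v [sv ev _ [sig sig0 [[c bv] _]]]] :=
  HF Om' (fun=> 1) (A' ^+ (2 * N)) 1 oOm' sub' (exprn_ge0 _ (ltW A'0)) ltr01 F1.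
have O0 : Om' 0.
  split; first exact: ballxx.
  rewrite /= /del /sqball_def big1 => [|i _]; last by rewrite mxE expr0n.
  have p0 : 0 < r2 ^+ 2 by rewrite exprn_gt0.
  by rewrite subr0 /u; move: (r2 ^+ 2) p0 => p; lra.
have [rho [rho0 subrho]] := open_ball_sub oOm' O0.
exists rho, v; split=> //.
  split; first exact: smooth_sub sv.
  exists sig, `|c|; split=> // s x bx; apply: le_trans (bv s x (subrho x bx)) _.
  by rewrite ler_wpM2r ?ler_norm // mulr_ge0 // mulr_ge0 ?exprn_ge0 ?ltW.
move=> x /subrho Ox; rewrite /chi asboolT; first by rewrite -ev.
case: Ox => _ /= dx; rewrite /A /=; lra.
Qed.

End Cutoff.

(** * Products with the ideal of flat germs *)

Section FlatProducts.
Variables (R : realType) (n : nat) (M : nat -> R) (X : set 'rV[R]_n).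
Hypotheses (hM : strongly_regular M) (hX : analytic_submanifold_germ X).

Lemma flat_at_zero (x : 'rV[R]_n) : flat_at (fun=> 0) x.
Proof. by case=> // i s; exact: (pderivs_cst (s := i :: s) _ openT). Qed.

Lemma ball0P (r : R) (x : 'rV[R]_n) : ball 0 r x <-> `|x| < r.
Proof. by rewrite -ball_normE /ball_ /= sub0r normrN. Qed.

(** Deriving this from the inclusion for closed ideals would require closedness of the flat ideal.
    Instead the quotient is flat on [X] because division preserves flatness; the radius [q / L]
    keeps the nearby points of [X] in the ball where the germ is flat. *)
Lemma flat_sub_square : flat_ideal M X `<=` ideal_mul (flat_ideal M X) (flat_ideal M X).
Proof.
move=> _ /(flat_idealP hM)[r [u [v [r0 Hu Hv -> fl]]]].
have [ph [C [lam [rc [L [[rc0 C1 lam0 L1] [sph bph rho1 XZ near]]]]]]] := submanifold_chart hX.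
pose q := Num.min r rc; have q0 : 0 < q by rewrite lt_min r0.
have s1 : ball (0 : 'rV[R]_n) q `<=` ball 0 r by apply: le_ball; rewrite ge_min lexx.
have s2 : ball (0 : 'rV[R]_n) q `<=` ball 0 rc by apply: le_ball; rewrite ge_min lexx orbT.
have L0 : 0 < L by exact: lt_le_trans L1.
have qL0 : 0 < q / L by rewrite divr_gt0.
have s3 : ball (0 : 'rV[R]_n) (q / L) `<=` ball 0 q.
  by apply: le_ball; rewrite ler_pdivrMr // ler_peMr // ltW.
have oD : open (ball (0 : 'rV[R]_n) (q / L)) by exact: ball_open.
have HD (x : 'rV[R]_n) : ball 0 (q / L) x -> (exists y : 'rV[R]_n,
    [/\ ball 0 q y, flat_at u y /\ flat_at v y & `|x - y| <= L * Num.sqrt (sumsq ph x)])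
    \/ (flat_at u x /\ flat_at v x).
  move=> bx; left; have [y [Xy xy yx]] := near x (s2 _ (s3 _ bx)).
  have by_ : ball 0 q y.
    by apply/ball0P/(le_lt_trans yx); rewrite mulrC -ltr_pdivlMr //; apply/ball0P.
  by exists y; split=> //; apply: fl => //; exact: s1.
have [w [E [gu [gv [Hw fw _ [Hgu Hgv] [ew flu flv _]]]]]] :=
  flat_factor hM C1 lam0 (ltW L0) (fun i => smooth_sub s2 (sph i))
    (fun i s x bx => bph i s x (s2 x bx)) (fun x bx => rho1 x (s2 x bx))
    oD s3 (CMreal_sub s1 Hu) (CMreal_sub s1 Hv) HD.
have ob : open (ball (0 : 'rV[R]_n) q) by exact: ball_open.
exists [:: (to_germ (cpx w (fun=> 0)), to_germ (cpx gu gv))]; split.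
  move=> p; rewrite inE => /eqP -> /=; split.
    apply/(flat_idealP hM); exists q, w, (fun=> 0); split=> //; first exact: CMreal_cst.
    move=> x bx Xx; split; last exact: flat_at_zero.
    by apply: fw => //; apply: XZ => //; exact: s2.
  apply/(flat_idealP hM); exists (q / L), gu, gv; split=> // x bx Xx.
  have [fu fv] := fl x (s1 _ (s3 _ bx)) Xx.
  by split; [exact: flu|exact: flv].
rewrite big_seq1 /= -to_germM cpxM; apply: to_germ_eq_on (ball_open_nbhs n qL0) _ => x bx.
by have [eu ev] := ew x bx; rewrite /cpx eu ev; congr Complex; ring.
Qed.

(** Closedness is available for the representative on [Om], whereas flatness is known only nearer to
    zero, and shrinking [Om] would change the representative. Hence the multiplication by [chi] on
    the fixed [Om], undone at the end by its inverse germ. *)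
Lemma flat_sub_prod (I : set (germ R n)) : closed_ideal M I ->
  I `&` flat_ideal M X `<=` ideal_mul (flat_ideal M X) I.
Proof.
move=> [[ICM I0 IB IM] [Om0 [[oOm0 Om00] Hcl]]] gam [Igam fgam].
have [ph [C [lam [rc [L [[rc0 C1 lam0 L1] [sph bph rho1 XZ near]]]]]]] := submanifold_chart hX.
have L0 : 0 < L by exact: lt_le_trans L1.
have [rO [rO0 subO]] := open_ball_sub oOm0 Om00.
pose r := Num.min rc (Num.min rO n.+1%:R^-1).
have n1 : 0 < n.+1%:R^-1 :> R by rewrite invr_gt0 ltr0n.
have r0 : 0 < r by rewrite !lt_min rc0 rO0.
have rn : r <= n.+1%:R^-1 by rewrite !ge_min lexx !orbT.
have r1 : r <= 1 by apply: le_trans rn _; rewrite invf_le1 ?ltr0n // ler1n.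
have nr1 : n%:R * r ^+ 2 <= 1.
  apply: le_trans (_ : n.+1%:R * (n.+1%:R^-1 * 1) <= _); last first.
    by rewrite mulr1 divff // pnatr_eq0.
  apply: ler_pM => //; rewrite ?sqr_ge0 ?ler_nat //.
  by rewrite expr2; apply: ler_pM => //; exact: ltW.
set Om := ball (0 : 'rV[R]_n) r; have oOm : open Om by exact: ball_open.
have nOm : open_nbhs (0 : 'rV[R]_n) Om := ball_open_nbhs n r0.
have sc : Om `<=` ball 0 rc by apply: le_ball; rewrite ge_min lexx.
have subOm0 : Om `<=` Om0.
  by apply: subset_trans subO; apply: le_ball; rewrite !ge_min lexx orbT.
have [IOm [[IOmCM _ _ IOmM] IOmI IOmcl]] := Hcl Om nOm subOm0.
have [f If Ef] : ((@to_germ R n) @` IOm) gam by rewrite IOmI.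
have fCM := IOmCM f If; have [Hu Hv] := CM_parts hM oOm fCM.
set u := fun x => complex.Re (f x) in Hu; set v := fun x => complex.Im (f x) in Hv.
have fE x : f x = cpx u v x by rewrite /u /v cpxE.
have [r' [r'0 fl]] : exists r, 0 < r /\ forall x, ball 0 r x -> X x -> flat_at u x /\ flat_at v x.
  apply: (flat_rep hM); rewrite -Ef in fgam.
  by have -> : cpx u v = f by apply/funext => x; rewrite -fE.
(* For [|x| < r2] the associated point [y] of [X], with [|y| <= L |x|], lies both in [Om] and in the
   ball where [u] and [v] are flat. *)
pose r2 := Num.min 1 (Num.min (r / L) (r' / L)).
have r20 : 0 < r2 by rewrite !lt_min ltr01 !divr_gt0.
have r21 : r2 <= 1 by rewrite ge_min lexx.
have r2L : r2 * L <= r by rewrite -ler_pdivlMr // !ge_min lexx orbT.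
have r2L' : r2 * L <= r' by rewrite -ler_pdivlMr // !ge_min lexx !orbT.
have [chi [Hchi fchi [rho [vv [rho0 Hvv chiv]]]]] := cutoff hM r0 r20 r21 nr1 r1.
pose Fu x := u x * chi x; pose Fv x := v x * chi x.
have HFu : CMreal M Om Fu := CMrealM hM oOm Hu Hchi.
have HFv : CMreal M Om Fv := CMrealM hM oOm Hv Hchi.
have HD (x : 'rV[R]_n) : Om x -> (exists y : 'rV[R]_n,
    [/\ Om y, flat_at Fu y /\ flat_at Fv y & `|x - y| <= L * Num.sqrt (sumsq ph x)])
    \/ (flat_at Fu x /\ flat_at Fv x).
  move=> bx; have [xr|xr] := ltP `|x| r2; last first.
    have fc := fchi x bx xr; right; split=> s.
      rewrite -(leibniz_flat oOm s Hchi.1 Hu.1 bx fc).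
      by apply: pderivs_congr oOm _ _ bx => y _; rewrite /Fu mulrC.
    rewrite -(leibniz_flat oOm s Hchi.1 Hv.1 bx fc).
    by apply: pderivs_congr oOm _ _ bx => y _; rewrite /Fv mulrC.
  left; have [y [Xy xy yx]] := near x (sc _ bx).
  have yr : `|y| < r2 * L.
    by apply: le_lt_trans yx _; rewrite mulrC ltr_pM2r.
  have by_ : Om y by apply/ball0P; exact: lt_le_trans yr r2L.
  have [fu fv] : flat_at u y /\ flat_at v y.
    by apply: fl => //; apply/ball0P; exact: lt_le_trans yr r2L'.
  exists y; split=> //; split=> s; first exact: (leibniz_flat oOm s Hu.1 Hchi.1 by_ fu).
  exact: (leibniz_flat oOm s Hv.1 Hchi.1 by_ fv).
have [w [E [gu [gv [Hw fw HE [Hgu Hgv] [ew _ _ [sig sig0 lim]]]]]]] :=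
  flat_factor hM C1 lam0 (ltW L0) (fun i => smooth_sub sc (sph i))
    (fun i s x bx => bph i s x (sc x bx)) (fun x bx => rho1 x (sc x bx))
    oOm (@subset_refl _ Om) HFu HFv HD.
pose g := extend0 Om (cpx gu gv).
have gCM : CM M Om g by exact: CM_ext.
have Ig : IOm g.
  apply: (LB_closed_limit IOmcl gCM sig0) => e e0.
  have e20 : 0 < e / 2 by rewrite divr_gt0.
  have [k [lu lv]] := lim _ e20.
  (* [chi E_k] is in the class on [Om], so its product with [f] stays in [IOm]; these products
     approximate [g]. *)
  pose h := extend0 Om (cpx (fun x => chi x * E k x) (fun=> 0)).
  have hCM : CM M Om h.
    exact: (CM_ext hM oOm (CMrealM hM oOm Hchi (HE k)) (CMreal_cst hM 0 oOm)).
  exists (h * f); have HhE : h * f - g = extend0 Om (cpx (fun y => Fu y * E k y - gu y)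
      (fun y => Fv y * E k y - gv y)).
    apply/funext => x; rewrite -[LHS]/(h x * f x - g x) /h /g /extend0.
    case: asboolP => _; last by rewrite mul0r subr0.
    by rewrite fE /cpx /Fu /Fv; congr Complex; ring.
  have [sgu sgv] : smooth_on Om gu /\ smooth_on Om gv by split; [case: Hgu|case: Hgv].
  have sB a b : CMreal M Om a -> smooth_on Om b -> smooth_on Om (fun y => a y * E k y - b y).
    by move=> [sa _] sb; exact: smoothD oOm (smoothM oOm sa (HE k).1) (smoothN oOm sb).
  have [h1 h2 h3] := CMs_bound_ext oOm (sB _ _ HFu sgu) (sB _ _ HFv sgv) lu lv.
  rewrite HhE; split=> //; first exact: IOmM.
  by rewrite [e]splitr.
have Iger : I (to_germ g) by rewrite -IOmI; exists g.
(* From [f chi = w g] and [chi vv = 1] near zero, [f = w (vv g)]. *)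
exists [:: (to_germ (cpx w (fun=> 0)), to_germ (cpx vv (fun=> 0)) * to_germ g)]; split.
  move=> p; rewrite inE => /eqP -> /=; split.
    apply/(flat_idealP hM); exists r, w, (fun=> 0); split=> //; first exact: CMreal_cst.
    move=> x bx Xx; split; last exact: flat_at_zero.
    by apply: fw => //; apply: XZ => //; exact: sc.
  apply: IM => //; apply/(CM_germP hM); exists rho, vv, (fun=> 0); split=> //.
  by apply: CMreal_cst => //; exact: ball_open.
rewrite big_seq1 /= -Ef -!to_germM.
have q0 : 0 < Num.min r rho by rewrite lt_min r0.
apply: to_germ_eq_on (ball_open_nbhs n q0) _ => x bx.
have bx1 : Om x by apply: le_ball bx; rewrite ge_min lexx.
have bx2 : ball 0 rho x by apply: le_ball bx; rewrite ge_min lexx orbT.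
have [eu ev] := ew x bx1; have cv := chiv x bx2.
rewrite -[RHS]/(cpx w (fun=> 0) x * (cpx vv (fun=> 0) x * g x)) /g extend0E // fE /cpx.
rewrite -[u x]mulr1 -[v x]mulr1 -cv !mulrA -/(Fu x) -/(Fv x) eu ev.
by congr Complex; ring.
Qed.

Lemma prod_sub_flat (I : set (germ R n)) : is_ideal_of (CM_germ M) I ->
  ideal_mul (flat_ideal M X) I `<=` I `&` flat_ideal M X.
Proof.
move=> [ICM I0 IB IM] _ [s [Hs ->]].
have ID a b : I a -> I b -> I (a + b).
  by move=> Ia Ib; rewrite -[b]opprK -[- b]sub0r; apply: (IB) => //; exact: IB.
elim: s Hs => [|p s IH] Hs; first by rewrite big_nil; split=> //; exact: flat0.
have [Ip1 Ip2] := Hs p (mem_head _ _).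
have [IH1 IH2] := IH (fun p' hp' => Hs p' (mem_behead (s := p :: s) hp')).
rewrite big_cons; split.
  by apply: ID => //; apply: IM => //; case: Ip1.
by apply: flatD => //; apply: flatM => //; exact: ICM.
Qed.

End FlatProducts.

Theorem theorem4p2p4 (R : realType) (n : nat) (X : set 'rV[R]_n)
    (hX : analytic_submanifold_germ X)
    (M : nat -> R) (hM : strongly_regular M) :
  (forall I : set (germ R n), closed_ideal M I ->
     I `&` flat_ideal M X = ideal_mul (flat_ideal M X) I) /\
  flat_ideal M X = ideal_mul (flat_ideal M X) (flat_ideal M X).
Proof.
split=> [I cI|]; apply/seteqP; split.
- exact: flat_sub_prod.
- by apply: prod_sub_flat => //; case: cI.
- exact: flat_sub_square.
move=> _ [s [Hs ->]]; elim: s Hs => [|p s IH] Hs; first by rewrite big_nil; exact: flat0.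
have [Ip1 Ip2] := Hs p (mem_head _ _).
rewrite big_cons; apply: flatD => //; first by apply: flatM => //; case: Ip2.
by apply: IH => p' hp'; apply: Hs; exact: (mem_behead (s := p :: s)).
Qed.
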